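(* Fix an integer $d\ge 1$, and let $h_t(0,u)$, $u\in\mathbb{T}^d$, $t\ge 0$, be the heat kernel of the diffusion on $\mathbb{T}^d$ with generator $\frac12\Delta$, started from the origin $0\in\mathbb{T}^d$. Then, for every bounded interval $[a,b]\subset(0,+\infty)$, there exists $C=C(a,b,d)>0$ such that, for all $p\in[1,2]$ and for all $N\in\mathbb{N}$ large enough, $$\sup_{t\in[a,b]}\left|\,\mathbb{E}\Bigl[\Bigl\|\frac{\eta_{tN^2}(0,\cdot)}{\pi}-1\Bigr\|_p^p\Bigr]^{1/p}-\bigl\|h_t(0,\cdot)-1\bigr\|_{L^p(\mathbb{T}^d)}\right|\;\le\;\frac{C}{N},$$ where $\eta_t(0,\cdot)$ is the averaging process on the discrete torus $\mathbb{T}^d_N$ started from the unit mass at $0$ and $\pi$ is the uniform distribution on $\mathbb{T}^d_N$.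
   Context: $\mathbb{T}^d=(\mathbb{R}/\mathbb{Z})^d$ is the continuous torus with Lebesgue measure (total mass 1). $\mathbb{T}^d_N=(\mathbb{Z}/N\mathbb{Z})^d$ is the discrete torus with graph distance $|x-y|$ (nearest neighbors are pairs with $|x-y|=1$); $\pi\equiv N^{-d}$ is the uniform distribution on it; $\mathcal{P}(\mathbb{T}^d_N)$ is the set of probability mass functions on $\mathbb{T}^d_N$; $\|\psi\|_p=\bigl(\sum_{x}\pi(x)|\psi(x)|^p\bigr)^{1/p}$ is the $L^p$-norm on $(\mathbb{T}^d_N,\pi)$. Averaging process: the Markov jump process on $\mathcal{P}(\mathbb{T}^d_N)$ with generator $\mathcal{L}f(\eta)=\frac12\sum_{x\in\mathbb{T}^d_N}\sum_{y:|x-y|=1}\bigl(f(\eta^{xy})-f(\eta)\bigr)$ for continuous $f$, where $\eta^{xy}(z)=\frac12(\eta(x)+\eta(y))$ if $z\in\{x,y\}$ and $\eta^{xy}(z)=\eta(z)$ otherwise. That is, each unordered nearest-neighbor pair has an independent rate-1 Poisson clock, and when it rings the two masses are replaced by their average. $\mathbb{P},\mathbb{E}$ are the law and expectation of the random updates. $\eta_t(0,\cdot)$ denotes the process at time $t$ started from the Dirac mass $\mathbf{1}_0$ at $0\in\mathbb{T}^d_N$. *)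

(* Defs.v *)
From HB Require Import structures.
From mathcomp Require Import all_boot all_order all_algebra.
From mathcomp Require Import all_classical all_reals all_analysis.

Set Implicit Arguments.
Unset Strict Implicit.
Unset Printing Implicit Defensive.

Import Order.TTheory GRing.Theory Num.Theory.
Import numFieldNormedType.Exports.

Local Open Scope classical_set_scope.
Local Open Scope ring_scope.

Section product_prob.
Context d1 d2 (T1 : measurableType d1) (T2 : measurableType d2) (R : realType).
Variables (P1 : probability T1 R) (P2 : probability T2 R).

Definition product_prob : set (T1 * T2) -> \bar R := (P1 \x P2)%E.

HB.instance Definition _ := Measure.on product_prob.

Let product_prob_setT : product_prob setT = 1%E.
Proof.
rewrite -[setT]setXTT; transitivity (P1 setT * P2 setT)%E.
  exact: (product_measure1E P1 P2 measurableT measurableT).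
by rewrite -[RHS]mule1; congr (_ * _)%E; exact: probability_setT.
Qed.

HB.instance Definition _ :=
  Measure_isProbability.Build _ _ _ product_prob product_prob_setT.

End product_prob.

Section tuple_cons.
Context d (T : measurableType d) (n : nat).

Definition tuple_cons (x : T * n.-tuple T) : n.+1.-tuple T :=
  [tuple of x.1 :: x.2].

Let measurable_tuple_cons : measurable_fun setT tuple_cons.
Proof. exact: measurable_cons. Qed.

HB.instance Definition _ :=
  isMeasurableFun.Build _ _ _ _ tuple_cons measurable_tuple_cons.

End tuple_cons.

Section torus_lebesgue.
Context (R : realType).

(* Lebesgue measure on [0, 1]^d, as the d-fold product of the Lebesgue measure
   on [0, 1]; it has total mass 1. *)
Fixpoint torus_lebesgue (d : nat) : probability (d.-tuple (measurableTypeR R)) R :=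
  if d is n.+1 then
    distribution (product_prob (uniform_prob (@ltr01 R)) (torus_lebesgue n))
                 (@tuple_cons _ (measurableTypeR R) n)
  else dirac [tuple].

End torus_lebesgue.

(* Functions on the torus (R/Z)^d are Z^d-periodic functions on 'rV[R]_d,
   integrated over the fundamental domain [0, 1]^d. *)
Section torus_functions.
Context (R : realType) (d : nat).
Implicit Types (phi : 'rV[R]_d -> R).

Definition row_of_tuple (u : d.-tuple R) : 'rV[R]_d := \row_i tnth u i.

Definition torus_integral phi : R :=
  \int[@torus_lebesgue R d]_u phi (row_of_tuple u).

Definition torus_norm (p : R) phi : \bar R :=
  Lnorm (@torus_lebesgue R d) p%:E (fun u => (phi (row_of_tuple u))%:E).

Definition basis_vec (i : 'I_d) : 'rV[R]_d := delta_mx 0 i.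

Definition torus_periodic phi := forall x i, phi (x + basis_vec i) = phi x.

Definition partial (i : 'I_d) phi : 'rV[R]_d -> R :=
  fun x => 'D_(basis_vec i) phi x.

Definition torus_C2 phi :=
  [/\ torus_periodic phi, continuous phi,
      forall i, (forall x, derivable phi x (basis_vec i)) /\
                continuous (partial i phi)
    & forall i j, (forall x, derivable (partial i phi) x (basis_vec j)) /\
                  continuous (partial j (partial i phi))].

Definition laplacian phi : 'rV[R]_d -> R :=
  fun x => \sum_(i < d) partial i (partial i phi) x.

(* [h t] is the continuous density of X_t, where X is the diffusion on the torus
   with generator [Delta / 2] started from 0: the laws [h t u du] satisfy the
   Kolmogorov equation d/dt E[phi(X_t)] = E[(Delta phi / 2)(X_t)] for every test
   function phi of class C^2, and X_0 = 0. This determines [h t] for t > 0. *)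
Record is_heat_kernel (h : R -> 'rV[R]_d -> R) : Prop := IsHeatKernel {
  heat_kernel_ge0 : forall t x, 0 < t -> 0 <= h t x ;
  heat_kernel_periodic : forall t, 0 < t -> torus_periodic (h t) ;
  heat_kernel_continuous : forall t, 0 < t -> continuous (h t) ;
  heat_kernel_forward : forall phi, torus_C2 phi -> forall t : R, 0 < t ->
    is_derive t 1 (fun s => torus_integral (fun u => h s u * phi u))
      (torus_integral (fun u => h t u * (2^-1 * laplacian phi u))) ;
  heat_kernel_init : forall phi, torus_C2 phi ->
    torus_integral (fun u => h t u * phi u) @[t --> 0^'+] --> phi 0
}.

End torus_functions.

(* The discrete torus (Z/NZ)^d is ['rV['Z_N]_d], where 1 < N is assumed since
   ['Z_N] is not Z/NZ otherwise. *)
Section discrete_torus.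
Context (R : realType) (d N : nat).
Local Notation T := 'rV['Z_N]_d.
Implicit Types (x y z : T) (f : T -> R).

(* Nearest neighbours: graph distance 1. *)
Definition adj x y : bool :=
  [exists i : 'I_d, (y == x + delta_mx 0 i) || (x == y + delta_mx 0 i)].

Definition edges : {set {set T}} :=
  [set e | [exists x, exists y, adj x y && (e == [set x; y]%SET)]]%SET.

Definition unif : T -> R := fun=> (N%:R ^+ d)^-1.

Definition dnorm (p : R) f : R := (\sum_x unif x * `|f x| `^ p) `^ p^-1.

Definition dirac_mass x : T -> R := fun z => (z == x)%:R.

Definition average x y f : T -> R :=
  fun z => if (z == x) || (z == y) then (f x + f y) / 2 else f z.

End discrete_torus.

Section clocks.
Context d (Omega : measurableType d) (R : realType) (P : probability Omega R).

(* Rate-1 Poisson (counting) process. The truncated subtractions are harmless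
   since the paths are almost surely nondecreasing. *)
Record poisson_process (K : R -> Omega -> nat) : Prop := PoissonProcess {
  poisson_measurable : forall t, 0 <= t -> measurable_fun setT (K t) ;
  poisson_path : {ae P, forall w, [/\ K 0 w = 0%N,
    forall s t, 0 <= s -> s <= t -> (K s w <= K t w)%N
    & forall t, 0 <= t -> \forall s \near t^'+, K s w = K t w]} ;
  poisson_increment : forall s t, 0 <= s -> s < t -> forall k : nat,
    P [set w | (K t w - K s w)%N = k] = (poisson_pmf (t - s) k)%:E ;
  poisson_indep_increments : forall (n : nat) (t : nat -> R),
    0 <= t 0 -> {homo t : i j / (i <= j)%N >-> i <= j} ->
    forall B : 'I_n -> set nat,
    P [set w | forall k : 'I_n, B k (K (t k.+1) w - K (t k) w)%N] =
    (\prod_(k < n) P [set w | B k (K (t k.+1) w - K (t k) w)%N])%E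
}.

(* Mutual independence of the processes (K e), e in A: their joint
   finite-dimensional distributions factorize. Proper subfamilies are covered by
   taking [B e = setT]. *)
Definition independent_processes (I : finType) (A : {set I})
    (K : I -> R -> Omega -> nat) : Prop :=
  forall (n : nat) (t : 'I_n -> R), (forall k, 0 <= t k) ->
  forall B : I -> 'I_n -> set nat,
  P [set w | forall e, e \in A -> forall k, B e k (K e (t k) w)] =
  (\prod_(e in A) P [set w | forall k, B e k (K e (t k) w)])%E.

End clocks.

Section averaging_process.
Context dO (Omega : measurableType dO) (R : realType) (P : probability Omega R).
Context (d N : nat).
Local Notation T := 'rV['Z_N]_d.

(* [eta] evolves along the clocks [K]: it does not change during ]s, t] when no
   clock rings, and it is averaged over x and y when exactly one ring occurs
   during ]s, t], that of the pair {x, y}. As almost surely there are finitely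
   many rings in bounded time, at distinct times, this determines [eta]. *)
Definition driven_by (K : {set T} -> R -> nat) (eta : R -> T -> R) : Prop :=
  forall s t : R, 0 <= s -> s < t ->
  ((forall e, e \in edges d N -> K e t = K e s) -> eta t =1 eta s) /\
  (forall x y, adj x y ->
    K [set x; y]%SET t = (K [set x; y]%SET s).+1 ->
    (forall e, e \in edges d N -> e != [set x; y]%SET -> K e t = K e s) ->
    eta t =1 average x y (eta s)).

Definition is_averaging_process (eta0 : T -> R) (eta : R -> Omega -> T -> R) :
    Prop :=
  (forall t x, 0 <= t -> measurable_fun setT (fun w => eta t w x)) /\
  exists K : {set T} -> R -> Omega -> nat,
  [/\ forall e, e \in edges d N -> poisson_process P (K e),
      independent_processes P (edges d N) K
    & {ae P, forall w, eta 0 w =1 eta0 /\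
        driven_by (fun e t => K e t w) (fun t => eta t w)}].

End averaging_process.

(* Main.v *)
Require Import Defs.
From mathcomp Require Import all_boot all_order all_algebra.
From mathcomp Require Import all_classical all_reals all_analysis.
From mathcomp Require Import measurable_realfun.
From mathcomp Require Import ring lra zify.

Set Implicit Arguments.
Unset Strict Implicit.
Unset Printing Implicit Defensive.

Import Order.TTheory GRing.Theory Num.Theory.
Import numFieldNormedType.Exports.

Local Open Scope classical_set_scope.
Local Open Scope ring_scope.

(* With c_t(z) = E[sum_x eta_t(x) eta_t(x + z)] one has E|eta_t|^2 = c_t(0), and
   c solves a closed linear equation whose generator [pairgen] differs from that
   of two independent walks only near the origin. By Duhamel's formula, the excess
   of c_t(0) over |E eta_t|^2 is an integral of -c'(0) against the heat-kernel
   gradient; self-adjointness makes -c'(0) nonincreasing, and the resulting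
   renewal inequality, iterated over geometric scales, bounds the variance by
   C N^(-d-2) at times of order N^2. To avoid stochastic calculus, the clocks are
   observed on a grid of mesh T/n, where with probability 1 - O(1/n) each cell
   contains at most one ring, and n tends to infinity.
   The mean is a product of one-dimensional lattice heat kernels, compared term
   by term in Fourier space with the Cesaro means of the Fourier series of h_t;
   the latter are identified by testing the forward equation on trigonometric
   products, and converge to h_t by Korovkin's argument.
   Finally eta and h are coupled on the product of Omega with the torus: an L^2
   bound r for the difference gives the L^p bound 2 r, and Minkowski's inequality
   in L^p concludes. *)

(** * Fourier analysis on the cyclic group *)

(** Dividing by [pi] multiplies masses by N^d, so the squared L^2 distance of the rescaled density
    from its mean is N^d times the summed variance. An error 1/N thus needs a variance of order
    N^(-d-2), a factor N^(-2) below |E eta|^2 itself. Duhamel's formula does not give this by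
    itself, since its source is unknown. The sum is cut at half time: early sources have total mass
    at most 1 and meet a small gradient; late ones meet a gradient kernel of total mass at most 1,
    and are bounded by c(0) at an earlier time divided by the elapsed time. Each round gains a
    factor N^(-2) over the trivial bound 1 and costs a factor 8 in time, whence the d + 1 scales and
    the powers of 8 in the constants. The dynamics is specified only across intervals with at most
    one ring, so nothing is known of eta on the exceptional event of a grid. For bounded observables
    that event costs O(1/n), and n tends to infinity with N fixed; this is why the variance is
    estimated for a discrete-time chain. *)

Section cyclic_cosine.
Context {R : realType}.
Implicit Types (N k j : nat) (x : R).

Lemma cosD_natmul2pi x n : cos (x + 2 * pi * n%:R) = cos x.
Proof. by rewrite mulr_natr mulr_natl (periodicn (@cosD2pi R)). Qed.

Lemma sinD_natmul2pi x n : sin (x + 2 * pi * n%:R) = sin x.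
Proof. by rewrite mulr_natr mulr_natl (periodicn (@sinD2pi R)). Qed.

(** Real part of the k-th character of Z/NZ. The frequency sums below are symmetric under k -> N -
    k, so that the sine parts would cancel and complex numbers are avoided. *)
Definition ccos N k j : R := cos (2 * pi * (k * j)%:R / N%:R).

Lemma ccos0 N k : ccos N k 0 = 1.
Proof. by rewrite /ccos muln0 mulr0 mul0r cos0. Qed.

Lemma ccosC N k j : ccos N k j = ccos N j k.
Proof. by rewrite /ccos mulnC. Qed.

Lemma ccos_mod N k j : ccos N k (j %% N) = ccos N k j.
Proof.
case: N => [|n]; first by rewrite /ccos modn0.
rewrite /ccos -[LHS](cosD_natmul2pi _ (k * (j %/ n.+1))); congr cos.
rewrite [in RHS](divn_eq j n.+1) mulnDr natrD mulnA [in RHS]natrM.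
have : n.+1%:R != 0 :> R by rewrite pnatr_eq0.
by move: (_%:R) (_%:R) (_%:R) => u v w w0; field.
Qed.

Lemma ccos_step N k j :
  ccos N k j.+2 + ccos N k j = 2 * ccos N k 1 * ccos N k j.+1.
Proof.
rewrite /ccos muln1.
have -> : 2 * pi * (k * j.+2)%:R / N%:R =
  2 * pi * (k * j.+1)%:R / N%:R + 2 * pi * k%:R / N%:R :> R.
  by rewrite mulnS natrD; ring.
have -> : 2 * pi * (k * j)%:R / N%:R =
  2 * pi * (k * j.+1)%:R / N%:R - 2 * pi * k%:R / N%:R :> R.
  by rewrite mulnS natrD; ring.
by rewrite cosD cosB; ring.
Qed.

Lemma cos_sum_telescope x (c : R) n :
  2 * sin (x / 2) * \sum_(k < n) cos (x * k%:R + c)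
  = sin (x * n%:R - x / 2 + c) + sin (x / 2 - c).
Proof.
elim: n => [|n IH].
  have -> : x * 0%:R - x / 2 + c = - (x / 2 - c) by ring.
  by rewrite big_ord0 mulr0 sinN addNr.
rewrite big_ord_recr /= mulrDr IH.
have -> : x * n.+1%:R - x / 2 + c = (x * n%:R + c) + x / 2 by rewrite -natr1; field.
have -> : x * n%:R - x / 2 + c = (x * n%:R + c) - x / 2 by ring.
by rewrite (sinB _ (x / 2)) (sinD _ (x / 2)); ring.
Qed.

(** In [cos_sum_telescope] the right-hand side vanishes because N steps of length x make j full
    turns; [0 < j < N] keeps sin (pi j / N) nonzero, so that this factor cancels. The phase [c]
    allows shifted lattices, as in [avg_cos]. *)
Lemma sum_cos_phase N j (c : R) : (0 < j < N)%N ->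
  \sum_(k < N) cos (2 * pi * j%:R / N%:R * k%:R + c) = 0.
Proof.
move=> /andP[j0 jN]; have N0 : N%:R != 0 :> R.
  by rewrite pnatr_eq0 -lt0n (ltn_trans j0).
set x : R := 2 * pi * j%:R / N%:R.
have xE : x / 2 = pi * (j%:R / N%:R) by rewrite /x; field.
have sx : sin (x / 2) != 0.
  rewrite gt_eqF// sin_gt0_pi// xE mulr_gt0 ?pi_gt0 ?divr_gt0 ?ltr0n//=.
    by rewrite gtr_pMr ?pi_gt0// ltr_pdivrMr ?ltr0n ?(ltn_trans j0)// mul1r ltr_nat.
  exact: ltn_trans jN.
have := cos_sum_telescope x c N.
have -> : x * N%:R - x / 2 + c = - (x / 2 - c) + 2 * pi * j%:R by rewrite /x; field.
rewrite sinD_natmul2pi sinN addNr => /eqP.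
by rewrite !mulf_eq0 (negbTE sx) pnatr_eq0 /= => /eqP.
Qed.

Lemma sum_ccos N j : (0 < j < N)%N -> \sum_(k < N) ccos N k j = 0.
Proof.
move=> jN; rewrite -[RHS](sum_cos_phase 0 jN); apply: eq_bigr => k _.
by rewrite /ccos addr0 natrM; congr cos; ring.
Qed.

Definition freq N k : R := 1 - ccos N k 1.

Lemma freq_ge0 N k : 0 <= freq N k.
Proof. by rewrite subr_ge0 cos_le1. Qed.

Lemma freq_le2 N k : freq N k <= 2.
Proof. by rewrite /freq lerBlDr -lerBlDl; have := cos_geN1 (2 * pi * (k * 1)%:R / N%:R : R); rewrite /ccos; lra. Qed.

End cyclic_cosine.

(** * The autocorrelation equation *)

Section linear_maps.
Context {R : realType} {T : Type}.
Implicit Types (A B : (T -> R) -> T -> R) (f g : T -> R).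

(** The type [T] stays arbitrary because the predicate is used both for operators on functions on
    the torus and for [chain], which acts on functionals of configurations. *)
Definition lin A := forall (a : R) f g x,
  A (fun z => a * f z + g z) x = a * A f x + A g x.

Lemma lin_ext A f g : f =1 g -> A f =1 A g.
Proof. by move=> fg; rewrite (funext fg). Qed.

Lemma lin0 A : lin A -> forall x, A (fun=> 0) x = 0.
Proof.
move=> lA x; have := lA (-1) (fun=> 0) (fun=> 0) x.
rewrite (@lin_ext A _ (fun=> 0)) => [->|z]; last by rewrite mulr0 addr0.
by rewrite mulN1r addNr.
Qed.

Lemma lin_sum A (I : Type) (r : seq I) (a : I -> R) (F : I -> T -> R) :
  lin A -> forall x, A (fun z => \sum_(i <- r) a i * F i z) x =
    \sum_(i <- r) a i * A (F i) x.
Proof.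
move=> lA x; elim: r => [|i r IH].
  by rewrite big_nil -[RHS](lin0 lA x); apply: lin_ext => z; rewrite big_nil.
rewrite big_cons -IH -lA; apply: lin_ext => z; by rewrite big_cons.
Qed.

Lemma linD A f g : lin A -> forall x, A (fun z => f z + g z) x = A f x + A g x.
Proof.
move=> lA x; rewrite -[A f x]mul1r -lA; apply: lin_ext => z.
by rewrite mul1r.
Qed.

Lemma linZ A a f : lin A -> forall x, A (fun z => a * f z) x = a * A f x.
Proof.
move=> lA x; rewrite -[RHS]addr0 -(lin0 lA x) -lA; apply: lin_ext => z.
by rewrite addr0.
Qed.

Lemma lin_iter A n : lin A -> lin (iter n A).
Proof.
move=> lA; elim: n => [//|n IH] a f g x /=.
rewrite -lA; exact/lin_ext/IH.
Qed.

Lemma iter_eigen A (a : R) f : lin A -> (forall x, A f x = a * f x) ->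
  forall n x, iter n A f x = a ^+ n * f x.
Proof.
move=> lA Af; elim=> [|n IH] x; first by rewrite expr0 mul1r.
by rewrite iterS (lin_ext _ IH) linZ// Af mulrA -exprSr.
Qed.

End linear_maps.

Section discrete_torus.
Context {R : realType} {d N : nat}.
Local Notation T := 'rV['Z_N]_d.
Implicit Types (x y z xi : T) (f g c : T -> R) (i j : 'I_d) (n m k : nat).

Definition unitv i : T := delta_mx 0 i.

Lemma unitvE i j : unitv i 0 j = (j == i)%:R.
Proof. by rewrite mxE eqxx. Qed.

Lemma unitv_neq0 i : unitv i != 0.
Proof.
apply/eqP => /matrixP /(_ 0 i) /eqP; by rewrite unitvE eqxx mxE oner_eq0.
Qed.

Definition lap f x : R :=
  \sum_i (f (x + unitv i) + f (x - unitv i) - 2 * f x).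

(** Autocorrelation of a difference of two Dirac masses at neighbours in direction [i], and also
    minus the second difference of [origin] in that direction. *)
Definition dipole i z : R :=
  2 * (z == 0)%:R - (z == unitv i)%:R - (z == - unitv i)%:R.

Definition origin : T -> R := fun z => (z == 0)%:R.

(* Generator of the autocorrelation [z |-> \sum_x eta x * eta (x + z)] of the
   averaging process: at 0 and next to 0 it differs from the generator [lap] of
   the difference of two independent walks, since there the two walks may share
   an edge. *)
Definition pairgen c z : R :=
  lap c z + \sum_i (c 0 - c (unitv i)) / 2 * dipole i z.

Definition step (A : (T -> R) -> T -> R) (e : R) f z : R := f z + e * A f z.

Lemma lin_lap : lin lap.
Proof.
move=> a f g x; rewrite /lap mulr_sumr -big_split /=.
by apply: eq_bigr => i _; ring.
Qed.

Lemma lin_pairgen : lin pairgen.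
Proof.
move=> a f g x; rewrite /pairgen lin_lap mulrDr addrACA; congr (_ + _).
rewrite mulr_sumr -big_split /=.
by apply: eq_bigr => i _; field.
Qed.

Lemma lin_step A e : lin A -> lin (step A e).
Proof. by move=> lA a f g x; rewrite /step lA; ring. Qed.

Lemma sum_shift f y : \sum_x f (x + y) = \sum_x f x.
Proof.
rewrite [RHS](reindex_inj (addIr y)) /=; exact: eq_bigr.
Qed.

Lemma sum_origin f : \sum_z origin z * f z = f 0.
Proof.
rewrite (bigD1 0) //= /origin eqxx mul1r big1 ?addr0// => z /negbTE ->.
by rewrite mul0r.
Qed.

Lemma sum_point f y : \sum_z (z == y)%:R * f z = f y.
Proof.
rewrite (bigD1 y) //= eqxx mul1r big1 ?addr0// => z /negbTE ->.
by rewrite mul0r.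
Qed.

Lemma lap_sym f g : \sum_z f z * lap g z = \sum_z lap f z * g z.
Proof.
rewrite /lap; under eq_bigr do rewrite mulr_sumr.
under [RHS]eq_bigr do rewrite mulr_suml.
rewrite exchange_big [RHS]exchange_big /=; apply: eq_bigr => i _.
rewrite (eq_bigr (fun z => f z * g (z + unitv i) +
  (f z * g (z - unitv i) - f z * (2 * g z)))); last by move=> z _; ring.
rewrite [RHS](eq_bigr (fun z => f (z - unitv i) * g z +
  (f (z + unitv i) * g z - f z * (2 * g z)))); last by move=> z _; ring.
rewrite !big_split /=; congr (_ + (_ + _)).
  rewrite -[RHS](sum_shift _ (unitv i)); apply: eq_bigr => z _.
  by rewrite addrK.
rewrite -[RHS](sum_shift _ (- unitv i)); apply: eq_bigr => z _.
by rewrite subrK.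
Qed.

Definition evenf f := forall z, f (- z) = f z.

Lemma sum_dipole f i : evenf f ->
  \sum_z f z * dipole i z = 2 * (f 0 - f (unitv i)).
Proof.
move=> ef; rewrite (eq_bigr (fun z => 2 * ((z == 0)%:R * f z) +
  (- ((z == unitv i)%:R * f z) + - ((z == - unitv i)%:R * f z)))); last first.
  by move=> z _; rewrite /dipole; ring.
rewrite big_split big_split /= -mulr_sumr !sumrN !sum_point ef; ring.
Qed.

(** Against even functions the correction at the origin is a symmetric, nonnegative form. Symmetry
    gives [pairgen_sym]; nonnegativity lets the lower bound for [lap] carry over in
    [step_pairgen_psd]. *)
Lemma sum_pairgen f g : evenf f -> \sum_z f z * pairgen g z =
  \sum_z f z * lap g z + \sum_i (f 0 - f (unitv i)) * (g 0 - g (unitv i)).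
Proof.
move=> ef; rewrite /pairgen; under eq_bigr do rewrite mulrDr mulr_sumr.
rewrite big_split exchange_big /=; congr (_ + _); apply: eq_bigr => i _.
transitivity ((g 0 - g (unitv i)) / 2 * \sum_z f z * dipole i z).
  by rewrite mulr_sumr; apply: eq_bigr => z _; ring.
by rewrite sum_dipole//; field.
Qed.

Lemma pairgen_sym f g : evenf f -> evenf g ->
  \sum_z f z * pairgen g z = \sum_z pairgen f z * g z.
Proof.
move=> ef eg; rewrite sum_pairgen// lap_sym.
under [RHS]eq_bigr do rewrite mulrC.
rewrite sum_pairgen//; congr (_ + _); apply: eq_bigr => z _; exact: mulrC.
Qed.

Lemma sum_lap_ge f : - (4 * d%:R) * (\sum_z f z ^+ 2) <= \sum_z f z * lap f z.
Proof.
under [leRHS]eq_bigr do rewrite mulr_sumr.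
rewrite exchange_big /=.
have -> : - (4 * d%:R) * (\sum_z f z ^+ 2) =
    \sum_(i < d) (- 4 * \sum_z f z ^+ 2).
  by rewrite sumr_const card_ord -mulr_natl; ring.
apply: ler_sum => i _.
have h (y : T) : - \sum_z f z ^+ 2 <= \sum_z f z * f (z + y).
  have -> : - \sum_z f z ^+ 2 =
      - \sum_z (f z ^+ 2 / 2) + - \sum_z (f (z + y) ^+ 2 / 2).
    rewrite (sum_shift (fun z => f z ^+ 2 / 2)) -!mulr_suml; by field.
  rewrite -opprD lerNl -big_split /= -sumrN; apply: ler_sum => z _.
  by have := sqr_ge0 (f z + f (z + y)); nra.
rewrite [leRHS](eq_bigr (fun z => f z * f (z + unitv i) +
  (f z * f (z - unitv i) + (- 2) * f z ^+ 2))); last by move=> z _; ring.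
rewrite !big_split /= -mulr_sumr.
by have := h (unitv i); have := h (- unitv i); lra.
Qed.

Lemma step_pairgen_psd f e : evenf f -> 0 <= e -> e * (4 * d%:R) <= 1 ->
  0 <= \sum_z f z * step pairgen e f z.
Proof.
move=> ef e0 e1.
have -> : \sum_z f z * step pairgen e f z =
    \sum_z f z ^+ 2 + e * \sum_z f z * pairgen f z.
  rewrite mulr_sumr -big_split; apply: eq_bigr => z _ /=.
  by rewrite /step; ring.
rewrite sum_pairgen//.
have h1 := sum_lap_ge f.
have h2 : 0 <= \sum_i (f 0 - f (unitv i)) * (f 0 - f (unitv i)).
  by apply: sumr_ge0 => i _; rewrite -expr2 sqr_ge0.
have h3 : 0 <= \sum_z f z ^+ 2 by apply: sumr_ge0 => z _; exact: sqr_ge0.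
apply: (@le_trans _ _ (\sum_z f z ^+ 2 + e * (- (4 * d%:R) * \sum_z f z ^+ 2))).
  by rewrite mulrA mulrN mulNr -[X in X - _]mul1r -mulrBl mulr_ge0// subr_ge0.
rewrite lerD2l ler_wpM2l//; lra.
Qed.

Lemma even_lap f : evenf f -> evenf (lap f).
Proof.
move=> ef z; rewrite /lap; apply: eq_bigr => i _.
have h y : f (- z + y) = f (z - y) by rewrite -[RHS]ef opprB addrC.
by rewrite !h opprK ef; ring.
Qed.

Lemma even_dipole i : evenf (dipole i).
Proof.
by move=> z; rewrite /dipole eqr_opp eqr_oppLR oppr0 [- z == unitv i]eqr_oppLR; ring.
Qed.

Lemma even_pairgen f : evenf f -> evenf (pairgen f).
Proof.
move=> ef z; rewrite /pairgen even_lap//; congr (_ + _).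
by apply: eq_bigr => i _; rewrite even_dipole.
Qed.

Lemma even_step e f : evenf f -> evenf (step pairgen e f).
Proof. by move=> ef z; rewrite /step ef even_pairgen. Qed.

Lemma even_iter_step e n f : evenf f -> evenf (iter n (step pairgen e) f).
Proof. by move=> ef; elim: n => [//|n IH]; exact: even_step. Qed.

Lemma even_origin : evenf origin.
Proof. by move=> z; rewrite /origin oppr_eq0. Qed.

Definition corr e n : T -> R := iter n (step pairgen e) origin.
(** Half the expected sum of the squared differences of the configuration in direction [i] (see
    [sum_grad2]). It is both the dissipation of [corr e n 0], in [corr_decr], and the source in
    [corr_duhamel]. *)
Definition incr e n i : R := corr e n 0 - corr e n (unitv i).

Lemma even_corr e n : evenf (corr e n).
Proof. exact/even_iter_step/even_origin. Qed.

Lemma dipole_diff f i : evenf f ->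
  (f (0 + unitv i) + f (0 - unitv i) - 2 * f 0) +
  (f 0 - f (unitv i)) / 2 * dipole i 0 = - (f 0 - f (unitv i)).
Proof.
move=> ef; rewrite add0r sub0r ef /dipole eqxx eq_sym (negbTE (unitv_neq0 i)).
by rewrite eq_sym oppr_eq0 (negbTE (unitv_neq0 i)) /=; field.
Qed.

Lemma pairgen0 f : evenf f -> pairgen f 0 = - \sum_i (f 0 - f (unitv i)).
Proof.
move=> ef; rewrite /pairgen /lap -big_split /= -sumrN.
by apply: eq_bigr => i _; rewrite dipole_diff.
Qed.

Lemma corr_decr e n : corr e n 0 - corr e n.+1 0 = e * \sum_i incr e n i.
Proof.
rewrite {2}/corr iterS /step -/(step _ _) -/(corr _ _) pairgen0; last first.
  exact: even_corr.
by rewrite opprD addNKr mulrN opprK.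
Qed.

Lemma step_sym f g e : evenf f -> evenf g ->
  \sum_z f z * step pairgen e g z = \sum_z step pairgen e f z * g z.
Proof.
move=> ef eg; rewrite /step.
under eq_bigr do rewrite mulrDr mulrCA.
under [RHS]eq_bigr do rewrite mulrDl -mulrA.
by rewrite !big_split /= -!mulr_sumr pairgen_sym.
Qed.

(** By symmetry one factor of the step moves to the left entry, which turns the exponent n + 2 for f
    into n for the image of f; hence the induction by two, with bases 0 and 1. *)
Lemma iter_step_psd f e n : evenf f -> 0 <= e -> e * (4 * d%:R) <= 1 ->
  0 <= \sum_z f z * iter n (step pairgen e) f z.
Proof.
move=> + e0 e1; elim/ltn_ind: n f => -[|[|n]] IH f ef.
- by apply: sumr_ge0 => z _; rewrite /= -expr2 sqr_ge0.
- exact: step_pairgen_psd.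
- have -> : iter n.+2 (step pairgen e) f =
      step pairgen e (iter n (step pairgen e) (step pairgen e f)).
    by rewrite -iterSr.
  rewrite step_sym//; last exact/even_iter_step/even_step.
  by apply: IH => //; exact: even_step.
Qed.

Lemma pairgen_corr e n z : pairgen (corr e n) z =
  iter n (step pairgen e) (pairgen origin) z.
Proof.
elim: n z => [//|n IH] z; rewrite iterS /corr iterS {2}/step.
have -> : step pairgen e (iter n (step pairgen e) origin) =
  fun z => e * pairgen (corr e n) z + corr e n z.
  by apply/funext => y; rewrite /step addrC.
rewrite lin_pairgen IH addrC; congr (_ + _ * _).
by apply: lin_ext => y; rewrite IH.
Qed.

(** Convexity of [corr e n 0] in n. With L the generator and A = 1 + e L, the difference of the two
    sides is e times the pairing of [L origin] with [A^n (L origin)], nonnegative by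
    [iter_step_psd]. *)
Lemma sum_incr_anti e n : 0 <= e -> e * (4 * d%:R) <= 1 ->
  \sum_i incr e n.+1 i <= \sum_i incr e n i.
Proof.
move=> e0 e1; rewrite -subr_ge0.
have hp k : \sum_i incr e k i = - pairgen (corr e k) 0.
  by rewrite pairgen0 ?opprK//; exact: even_corr.
rewrite !hp opprK.
have -> : corr e n.+1 = fun z => e * pairgen (corr e n) z + corr e n z.
  by apply/funext => y; rewrite /corr iterS {1}/step addrC.
rewrite lin_pairgen addrCA addNr addr0 mulr_ge0//.
rewrite -(sum_origin (pairgen _)) pairgen_sym; last 2 first.
- exact: even_origin.
- exact/even_pairgen/even_corr.
under eq_bigr do rewrite pairgen_corr.
by apply: iter_step_psd => //; exact/even_pairgen/even_origin.
Qed.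

(** Variation of constants: the part of [pairgen] beyond [lap] is treated as a source on the dipoles
    and carried to time n by the free evolution. *)
Lemma corr_duhamel e n z : corr e n z = iter n (step lap e) origin z +
  \sum_(k < n) \sum_i e * incr e k i / 2 *
     iter (n - k.+1) (step lap e) (dipole i) z.
Proof.
elim: n z => [|n IH] z; first by rewrite big_ord0 addr0.
rewrite big_ord_recr [X in _ + (_ + X)]/= subnn.
have -> : corr e n.+1 z =
    step lap e (corr e n) z + \sum_i e * incr e n i / 2 * dipole i z.
  have -> : corr e n.+1 z = step pairgen e (corr e n) z by [].
  rewrite /step /pairgen mulrDr addrA mulr_sumr; congr (_ + _).
  by apply: eq_bigr => i _; rewrite -/(incr e n i); ring.
rewrite (lin_ext (step lap e) IH) linD; last exact/lin_step/lin_lap.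
rewrite [RHS]addrA; apply: (congr2 +%R) => //; apply: (congr2 +%R) => //.
transitivity (\sum_(k < n) 1 * step lap e (fun z0 => \sum_i e * incr e k i / 2 *
     iter (n - k.+1) (step lap e) (dipole i) z0) z).
  rewrite -lin_sum; last exact/lin_step/lin_lap.
  apply: lin_ext => y; by under [RHS]eq_bigr do rewrite mul1r.
apply: eq_bigr => k _; rewrite mul1r lin_sum; last exact/lin_step/lin_lap.
apply: eq_bigr => i _; by rewrite /= subSS -(subnSK (ltn_ord k)).
Qed.

End discrete_torus.

(** * Fourier representation and heat kernel bounds on the discrete torus *)

Section discrete_fourier.
Context {R : realType} {d N : nat}.
Hypothesis hN : (1 < N)%N.
Local Notation T := 'rV['Z_N]_d.
Local Notation incr := (@incr R d N).
Implicit Types (x y z xi : T) (f g c : T -> R) (i j : 'I_d) (n m k : nat).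

Lemma sum_Zp (F : nat -> R) : \sum_(k : 'Z_N) F k = \sum_(k < N) F k.
Proof. by rewrite -(big_mkord xpredT) -[RHS](big_mkord xpredT) Zp_cast. Qed.

Lemma valZpS (a : 'Z_N) : (a + 1)%R = (a.+1 %% N)%N :> nat.
Proof.
transitivity (a.+1 %% (Zp_trunc N).+2)%N; first by rewrite /= modnDmr addn1.
by congr (_ %% _)%N; exact: Zp_cast.
Qed.

(** Products of cosines are already eigenfunctions of [lap], which acts coordinate by coordinate,
    and their average over all frequencies is the Dirac mass ([originE]). *)
Definition chi xi x : R := \prod_i ccos N (xi 0 i) (x 0 i).

Lemma chi0 xi : chi xi 0 = 1.
Proof. by rewrite /chi big1// => i _; rewrite mxE ccos0. Qed.

Lemma ccos_step_Zp k (a : 'Z_N) :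
  ccos N k (a + 1)%R + ccos N k (a - 1)%R = 2 * ccos N k 1 * ccos N k a :> R.
Proof.
move: (a - 1)%R (subrK 1 a) => b <-.
rewrite !valZpS ccos_mod; have -> : ccos N k (b.+1 %% N)%N.+1 = ccos N k b.+2 :> R.
  by rewrite -ccos_mod -addn1 modnDml addn1 ccos_mod.
by rewrite ccos_mod ccos_step.
Qed.

Lemma chi_shift xi x i (a : 'Z_N) : chi xi (x + a *: unitv i) =
  ccos N (xi 0 i) (x 0 i + a)%R * \prod_(j | j != i) ccos N (xi 0 j) (x 0 j).
Proof.
rewrite /chi (bigD1 i) //=; congr (_ * _); first by rewrite !mxE !eqxx mulr1.
by apply: eq_bigr => j /negbTE ji; rewrite !mxE ji andbF mulr0 addr0.
Qed.

Lemma lap_chi xi x : lap (chi xi) x = - (2 * \sum_i freq N (xi 0 i)) * chi xi x.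
Proof.
rewrite /lap -[in RHS]mulNr mulr_sumr mulr_suml; apply: eq_bigr => i _.
have := chi_shift xi x i 1; rewrite scale1r => ->.
have := chi_shift xi x i (-1); rewrite scaleN1r => ->.
have := chi_shift xi x i 0; rewrite scale0r !addr0 => ->.
rewrite -mulrDl ccos_step_Zp /freq; ring.
Qed.

Definition rate xi : R := \sum_i freq N (xi 0 i).

Lemma rate_ge0 xi : 0 <= rate xi.
Proof. by apply: sumr_ge0 => i _; exact: freq_ge0. Qed.

Lemma rate_le xi : rate xi <= 2 * d%:R.
Proof.
apply: (@le_trans _ _ (\sum_(i < d) 2)).
  by apply: ler_sum => i _; exact: freq_le2.
by rewrite sumr_const card_ord mulr_natr.
Qed.

Definition vol : R := (N%:R ^+ d)^-1.

Lemma N_gt0 : 0 < N%:R :> R. Proof. by rewrite ltr0n (ltn_trans _ hN). Qed.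

Lemma vol_gt0 : 0 < vol.
Proof. by rewrite invr_gt0 exprn_gt0// N_gt0. Qed.

Lemma sum_prod_torus (F : 'I_d -> 'Z_N -> R) :
  \sum_(xi : T) \prod_i F i (xi 0 i) = \prod_i \sum_(k : 'Z_N) F i k.
Proof.
rewrite bigA_distr_bigA /= (reindex (fun g : {ffun 'I_d -> 'Z_N} => \row_i g i)) /=.
  by apply: eq_bigr => g _; apply: eq_bigr => i _; rewrite mxE.
exists (fun x : T => [ffun i => x 0 i]) => [g|x] _.
  by apply/ffunP => i; rewrite ffunE mxE.
by apply/rowP => i; rewrite mxE ffunE.
Qed.

Lemma originE x : origin x = vol * \sum_xi chi xi x.
Proof.
rewrite /chi (sum_prod_torus (fun i (k : 'Z_N) => ccos N k (x 0 i))).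
have -> : vol = \prod_(i < d) N%:R^-1 by rewrite prodr_const card_ord exprVn.
rewrite -big_split /=.
have N0 := N_gt0.
have h (a : 'Z_N) : N%:R^-1 * \sum_(k : 'Z_N) ccos N k a = (a == 0)%:R :> R.
  rewrite (sum_Zp (fun k => ccos N k a)); have [->|a0] := eqVneq a 0.
    rewrite (eq_bigr (fun=> 1)) => [|k _]; last by rewrite ccos0.
    by rewrite sumr_const card_ord mulVf// gt_eqF.
  rewrite sum_ccos ?mulr0//; apply/andP; split.
    by rewrite lt0n; apply: contra a0 => /eqP a0; apply/eqP/val_inj.
  by rewrite -[X in (_ < X)%N](Zp_cast hN).
under eq_bigr do rewrite h.
rewrite /origin; have [->|/eqP x0] := eqVneq x 0.
  by rewrite big1// => i _; rewrite mxE eqxx.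
have [i xi0] : exists i, x 0 i != 0.
  apply: contra_notP x0 => h0; apply/rowP => i; rewrite mxE.
  by apply/eqP/negPn/negP => hi; apply: h0; exists i.
by rewrite (bigD1 i) //= (negbTE xi0) mul0r.
Qed.

Lemma iter_step_chi e n xi x :
  iter n (step lap e) (chi xi) x = (1 - 2 * e * rate xi) ^+ n * chi xi x.
Proof.
apply: iter_eigen => [|y]; first exact/lin_step/lin_lap.
by rewrite /step lap_chi -/(rate xi); ring.
Qed.

Lemma iter_step_fourier e n (a : T -> R) x :
  iter n (step lap e) (fun z => \sum_xi a xi * chi xi z) x =
  \sum_xi a xi * ((1 - 2 * e * rate xi) ^+ n * chi xi x).
Proof.
rewrite lin_sum; last exact/lin_iter/lin_step/lin_lap.
by apply: eq_bigr => xi _; rewrite iter_step_chi.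
Qed.

Lemma iter_step_origin e n x : iter n (step lap e) origin x =
  vol * \sum_xi (1 - 2 * e * rate xi) ^+ n * chi xi x.
Proof.
rewrite mulr_sumr -iter_step_fourier; apply: lin_ext => z.
by rewrite originE mulr_sumr.
Qed.

Definition retprob e n : R := vol * \sum_(xi : T) (1 - 2 * e * rate xi) ^+ n.

(** The difference between 0 and [unitv i] of the n-step transition function of the walk with
    one-step operator [step lap e]; [retprob] is its value at 0. *)
Definition gradprob e n i : R :=
  vol * \sum_(xi : T) (1 - 2 * e * rate xi) ^+ n * freq N (xi 0 i).

Lemma iter_step_dipole e n i :
  iter n (step lap e) (dipole i) (0 : T) = 2 * gradprob e n i.
Proof.
transitivity (\sum_(xi : T) (vol * (2 * freq N (xi 0 i))) *
   ((1 - 2 * e * rate xi) ^+ n * chi xi 0)); last first.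
  by rewrite /gradprob !mulr_sumr; apply: eq_bigr => xi _; rewrite chi0; ring.
rewrite -iter_step_fourier; apply: lin_ext => z.
have -> : dipole i z = 2 * origin z - origin (z - unitv i) - origin (z + unitv i).
  by rewrite /dipole /origin subr_eq0 addr_eq0.
rewrite !originE !mulr_sumr -!sumrB; apply: eq_bigr => xi _.
have := chi_shift xi z i 1; rewrite scale1r => ->.
have := chi_shift xi z i (-1); rewrite scaleN1r => ->.
have := chi_shift xi z i 0; rewrite scale0r !addr0 => ->.
rewrite /freq; move: (\prod_(j | _) _) (ccos_step_Zp (xi 0 i) (z 0 i)) => u.
move: (ccos _ _ _) (ccos _ _ _) (ccos _ _ _) (ccos _ _ _) => p q r v.
by move=> /(canRL (addrK _)) ->; ring.
Qed.

Lemma corr_duhamel0 e n : corr e n (0 : T) = retprob e n +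
  \sum_(k < n) \sum_i e * incr e k i * gradprob e (n - k.+1) i.
Proof.
rewrite corr_duhamel iter_step_origin; congr (_ * _ + _).
  by apply: eq_bigr => xi _; rewrite chi0 mulr1.
apply: eq_bigr => k _; apply: eq_bigr => i _.
by rewrite iter_step_dipole; field.
Qed.

Lemma retprob_decr e n :
  retprob e n - retprob e n.+1 = 2 * e * \sum_i gradprob e n i.
Proof.
rewrite /retprob /gradprob -mulrBr -sumrB -mulr_sumr exchange_big /=.
rewrite mulrCA; congr (_ * _); rewrite mulr_sumr; apply: eq_bigr => xi _.
by rewrite -mulr_sumr -/(rate xi) exprS; ring.
Qed.

Lemma retprob0 e : retprob e 0 = 1.
Proof.
have := originE (0 : T); rewrite /origin eqxx => /= h; rewrite [RHS]h.
by congr (_ * _); apply: eq_bigr => xi _; rewrite chi0.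
Qed.

Lemma base_ge0 e xi : 0 <= e -> e * (4 * d%:R) <= 1 -> 0 <= 1 - 2 * e * rate xi.
Proof.
move=> e0 e1; rewrite subr_ge0 (le_trans _ e1)//.
by have := ler_wpM2l e0 (rate_le xi); lra.
Qed.

Lemma gradprob_ge0 e n i : 0 <= e -> e * (4 * d%:R) <= 1 -> 0 <= gradprob e n i.
Proof.
move=> e0 e1; rewrite mulr_ge0 ?(ltW vol_gt0)// sumr_ge0// => xi _.
by rewrite mulr_ge0 ?freq_ge0// exprn_ge0// base_ge0.
Qed.

Lemma retprob_ge0 e n : 0 <= e -> e * (4 * d%:R) <= 1 -> 0 <= retprob e n.
Proof.
move=> e0 e1; rewrite mulr_ge0 ?(ltW vol_gt0)// sumr_ge0// => xi _.
by rewrite exprn_ge0// base_ge0.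
Qed.

(** By [retprob_decr] the sum telescopes: twice the left side is [1 - retprob e n]. *)
Lemma sum_gradprob_le e n : 0 <= e -> e * (4 * d%:R) <= 1 ->
  e * \sum_(k < n) \sum_i gradprob e k i <= 1.
Proof.
move=> e0 e1.
suff h : 2 * e * \sum_(k < n) \sum_i gradprob e k i = 1 - retprob e n.
  have := retprob_ge0 n e0 e1.
  have : 0 <= e * \sum_(k < n) \sum_i gradprob e k i.
    rewrite mulr_ge0// sumr_ge0// => k _; rewrite sumr_ge0// => i _.
    exact: gradprob_ge0.
  move: h; set S := \sum_(k < n) _ => h; move: h; rewrite -mulrA.
  move: (e * S) => u; lra.
elim: n => [|n IH]; first by rewrite big_ord0 mulr0 retprob0 subrr.
rewrite big_ord_recr /= mulrDr IH -retprob_decr; ring.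
Qed.

(** Return probability at time s of the continuous-time walk with generator [lap / 2]. Unlike
    [retprob] it factorizes over the coordinates. *)
Definition trace (s : R) : R := vol * \sum_(xi : T) expR (- (rate xi * s)).

Lemma traceE s :
  trace s = (N%:R^-1 * \sum_(k < N) expR (- (freq N k * s))) ^+ d.
Proof.
rewrite /trace exprMn exprVn; congr (_ * _).
rewrite -(sum_Zp (fun k => expR (- (freq N k * s)))).
transitivity (\prod_(i < d) \sum_(k : 'Z_N) expR (- (freq N k * s))); last first.
  by rewrite prodr_const card_ord.
rewrite -sum_prod_torus; apply: eq_bigr => xi _.
by rewrite /rate mulr_suml -sumrN expR_sum.
Qed.

Lemma base_le_expR e n xi : 0 <= e -> e * (4 * d%:R) <= 1 ->
  (1 - 2 * e * rate xi) ^+ n <= expR (- (rate xi * (2 * (n%:R * e)))).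
Proof.
move=> e0 e1.
have -> : - (rate xi * (2 * (n%:R * e))) = n%:R * (- (2 * e * rate xi)).
  by ring.
rewrite expRM_natl; apply: lerXn2r; rewrite ?nnegrE ?base_ge0 ?expR_ge0//.
exact: expR_ge1Dx.
Qed.

Lemma retprob_le e n : 0 <= e -> e * (4 * d%:R) <= 1 ->
  retprob e n <= trace (2 * (n%:R * e)).
Proof.
move=> e0 e1; rewrite ler_wpM2l ?(ltW vol_gt0)//.
by apply: ler_sum => xi _; exact: base_le_expR.
Qed.

Lemma mul_expRN_le (x s : R) : 0 < s -> x * expR (- (x * s)) <= s^-1.
Proof.
move=> s0; rewrite expRN ler_pdivrMr ?expR_gt0// mulrC -ler_pdivrMr ?invr_gt0//.
rewrite invrK (le_trans _ (expR_ge1Dx _))//; lra.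
Qed.

(** The exponential at time 2 n e is split in two equal factors: one absorbs the frequency through x
    exp(- x s) <= 1 / s, the other is left as the trace. *)
Lemma gradprob_le e n i : 0 <= e -> e * (4 * d%:R) <= 1 -> 0 < n%:R * e ->
  gradprob e n i <= (n%:R * e)^-1 * trace (n%:R * e).
Proof.
move=> e0 e1 s0; rewrite /trace mulrCA ler_wpM2l ?(ltW vol_gt0)//.
rewrite mulr_sumr; apply: ler_sum => xi _.
apply: (le_trans (ler_wpM2r (freq_ge0 _ _) (base_le_expR n xi e0 e1))).
set s := n%:R * e in s0 *.
have -> : - (rate xi * (2 * s)) = - (rate xi * s) + - (rate xi * s) by ring.
rewrite expRD -mulrA mulrC ler_wpM2r ?expR_ge0//.
apply: le_trans (mul_expRN_le (freq N (xi 0 i)) s0).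
rewrite mulrC ler_wpM2l ?freq_ge0// ler_expR lerN2 ler_wpM2r ?(ltW s0)//.
rewrite /rate (bigD1 i) //= lerDl sumr_ge0// => j _; exact: freq_ge0.
Qed.

End discrete_fourier.

(** * The discrete-time averaging chain *)

Section averaging_chain.
Context {R : realType} {d N : nat}.
Local Notation T := 'rV['Z_N]_d.
Local Notation incr := (@incr R d N).
Local Notation edge := (T * 'I_d)%type.
Implicit Types (x y z : T) (f g eta : T -> R) (i j : 'I_d) (a : edge).
Implicit Types (F G : (T -> R) -> R).

(** An edge is coded by a base point and a direction, which turns sums over edges into sums over [T]
    and ['I_d]; the coding is injective once 2 < N, by [edge_set_inj]. *)
Definition avg a eta : T -> R := average a.1 (a.1 + unitv a.2) eta.

Definition autocorr eta z : R := \sum_x eta x * eta (x + z).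

(** Transition operator of the chain in which each edge is averaged with probability [e]; it
    preserves positivity when [e] times the number of edges is at most 1. *)
Definition chain (e : R) F eta : R := F eta + e * \sum_a (F (avg a eta) - F eta).

Lemma lin_chain e : lin (chain e).
Proof.
move=> r F G eta; rewrite /chain mulrDr addrACA -mulrCA -mulrDr; congr (_ + _ * _).
by rewrite mulr_sumr -big_split; apply: eq_bigr => a _ /=; ring.
Qed.

Definition grad a eta : R := (eta (a.1 + unitv a.2) - eta a.1) / 2.

Lemma avgE a eta z : avg a eta z =
  eta z + grad a eta * ((z == a.1)%:R - (z == a.1 + unitv a.2)%:R).
Proof.
case: a => x i; rewrite /avg /average /grad /=; have [->|zx] := eqVneq z x.
  rewrite [x == x + _]eq_sym -subr_eq0 addrAC subrr add0r.
  by rewrite (negbTE (unitv_neq0 i)) /=; field.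
have [->|zy] := eqVneq z (x + unitv i); first by rewrite /=; field.
by rewrite /= subrr mulr0 addr0.
Qed.

Lemma sum_pointl f y z : \sum_x (x == y)%:R * f (x + z) = f (y + z).
Proof. exact: (sum_point (fun x => f (x + z))). Qed.

Lemma sum_pointr f y z : \sum_x f x * (x + z == y)%:R = f (y - z).
Proof.
rewrite -(sum_point f); apply: eq_bigr => x _.
by rewrite mulrC eq_sym -subr_eq eq_sym.
Qed.

(** Averaging adds a multiple of the difference [w] of two Dirac masses; the bilinear expansion has
    two cross terms and the autocorrelation of [w], which is the dipole. *)
Lemma autocorr_avg a eta z : autocorr (avg a eta) z = autocorr eta z +
  grad a eta * ((eta (a.1 - z) - eta (a.1 + unitv a.2 - z)) +
    (eta (a.1 + z) - eta (a.1 + unitv a.2 + z))) +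
  grad a eta ^+ 2 * dipole a.2 z.
Proof.
pose w y : R := (y == a.1)%:R - (y == a.1 + unitv a.2)%:R.
have hl f : \sum_x w x * f (x + z) = f (a.1 + z) - f (a.1 + unitv a.2 + z).
  by rewrite -!sum_pointl -sumrB; apply: eq_bigr => x _; rewrite mulrBl.
have hr f : \sum_x f x * w (x + z) = f (a.1 - z) - f (a.1 + unitv a.2 - z).
  by rewrite -!sum_pointr -sumrB; apply: eq_bigr => x _; rewrite mulrBr.
have -> : dipole a.2 z = w (a.1 + z) - w (a.1 + unitv a.2 + z).
  have h0 (u v : T) : (u + v == u) = (v == 0).
    by rewrite -subr_eq0 addrAC subrr add0r.
  have h1 (u v v' : T) : (u + v == u + v') = (v == v') := inj_eq (addrI u) v v'.
  rewrite /w /dipole !h0 h1 -[a.1 + _ + z]addrA h0 [_ + z]addrC addr_eq0; ring.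
rewrite -hl -hr -hl /autocorr.
rewrite (eq_bigr (fun x => eta x * eta (x + z) + (grad a eta * (eta x * w (x + z))
  + grad a eta * (w x * eta (x + z)) + grad a eta ^+ 2 * (w x * w (x + z))))).
  by rewrite !big_split /= -!mulr_sumr; ring.
by move=> x _; rewrite !avgE -/(w x) -/(w (x + z)); ring.
Qed.

Lemma autocorr_even eta : evenf (autocorr eta).
Proof.
move=> z; rewrite /autocorr -[RHS](sum_shift _ (- z)); apply: eq_bigr => x _.
by rewrite /= subrK mulrC.
Qed.

Lemma autocorr_shift eta y z : \sum_x eta (x + y) * eta (x + z) =
  autocorr eta (z - y).
Proof.
rewrite /autocorr -[RHS](sum_shift _ y); apply: eq_bigr => x _.
by rewrite /= -addrA [y + _]addrC subrK.
Qed.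

Lemma sum_grad eta i y z :
  \sum_x grad (x, i) eta * (eta (x + y) - eta (x + z)) =
  (autocorr eta (y - unitv i) - autocorr eta (z - unitv i)
   - autocorr eta y + autocorr eta z) / 2.
Proof.
rewrite -!autocorr_shift.
have h y' : autocorr eta y' = \sum_x eta x * eta (x + y') by [].
rewrite !h -!sumrB -big_split mulr_suml /=; apply: eq_bigr => x _.
by rewrite /grad /=; field.
Qed.

Lemma sum_grad2 eta i : \sum_x grad (x, i) eta ^+ 2 =
  (autocorr eta 0 - autocorr eta (unitv i)) / 2.
Proof.
transitivity ((\sum_x grad (x, i) eta * (eta (x + unitv i) - eta (x + 0))) / 2).
  by rewrite mulr_suml; apply: eq_bigr => x _; rewrite addr0 /grad /=; ring.
by rewrite sum_grad subrr sub0r autocorr_even; field.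
Qed.

Lemma sum_edge (H : edge -> R) : \sum_a H a = \sum_i \sum_x H (x, i).
Proof.
by rewrite exchange_big pair_big /=; apply: eq_bigr => -[].
Qed.

(** The equation closes: summed over x, the products of gradients with [eta] and the squared
    gradients are again autocorrelations, by [sum_grad] and [sum_grad2]. *)
Lemma sum_autocorr_avg eta z :
  \sum_a (autocorr (avg a eta) z - autocorr eta z) = pairgen (autocorr eta) z.
Proof.
rewrite sum_edge /pairgen /lap -big_split /=; apply: eq_bigr => i _.
transitivity (\sum_x (grad (x, i) eta * (eta (x - z) - eta (x + (unitv i - z)))
   + grad (x, i) eta * (eta (x + z) - eta (x + (unitv i + z)))
   + grad (x, i) eta ^+ 2 * dipole i z)).
  by apply: eq_bigr => x _; rewrite autocorr_avg /= !addrA; ring.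
rewrite !big_split /= -mulr_suml !sum_grad sum_grad2.
have ev := autocorr_even eta.
have -> : unitv i - z - unitv i = - z by rewrite addrAC subrr sub0r.
have -> : - z - unitv i = - (z + unitv i) by rewrite opprD.
have -> : unitv i - z = - (z - unitv i) by rewrite opprB.
by rewrite [unitv i + z]addrC addrK !ev; field.
Qed.

Lemma sum_avg eta z : \sum_a (avg a eta z - eta z) = lap eta z / 2.
Proof.
rewrite sum_edge /lap mulr_suml; apply: eq_bigr => i _.
transitivity (\sum_x ((x == z)%:R * grad (x, i) eta -
   (x == z - unitv i)%:R * grad (x, i) eta)).
  apply: eq_bigr => x _; rewrite avgE /= addrC addKr.
  have -> : (z == x + unitv i) = (x == z - unitv i) by rewrite [RHS]eq_sym subr_eq.
  by rewrite eq_sym; ring.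
by rewrite sumrB !sum_point /grad /= subrK; field.
Qed.

(** Duality: when the drift of the observables [H eta y] is linear in them, iterating the chain
    amounts to iterating [A]. It is used for the autocorrelation and for the configuration itself,
    where [A] is [lap / 2]; hence the [e / 2] in [mean]. *)
Lemma iter_chain_lin e n (A : (T -> R) -> T -> R) (H : (T -> R) -> T -> R) z :
  lin A -> (forall eta y, \sum_a (H (avg a eta) y - H eta y) = A (H eta) y) ->
  forall eta, iter n (chain e) (fun eta => H eta z) eta =
    iter n (step A e) (H eta) z.
Proof.
move=> lA HA; elim: n => [//|n IH] eta.
rewrite iterS (lin_ext (chain e) IH) iterSr /chain.
have lU : lin (iter n (step A e)) by exact/lin_iter/lin_step.
rewrite [RHS](@lin_ext _ _ _ _ (fun y => e * (\sum_a
   1 * (-1 * H eta y + H (avg a eta) y)) + H eta y)); last first.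
  move=> y; rewrite /step -HA addrC; congr (_ * _ + _).
  by apply: eq_bigr => a _; ring.
rewrite lU addrC lin_sum//; congr (_ * _ + _).
by apply: eq_bigr => a _; rewrite lU; ring.
Qed.

Lemma chain_autocorr e n eta z :
  iter n (chain e) (fun eta => autocorr eta z) eta =
  iter n (step pairgen e) (autocorr eta) z.
Proof. by apply: iter_chain_lin; [exact: lin_pairgen|exact: sum_autocorr_avg]. Qed.

Lemma chain_mean e n eta z :
  iter n (chain e) (fun eta => eta z) eta = iter n (step lap (e / 2)) eta z.
Proof.
rewrite (@iter_chain_lin e n (fun f z => lap f z / 2) id); last 2 first.
- by move=> r f g x; rewrite lin_lap; field.
- exact: sum_avg.
by elim: n z => [//|n IH] z /=; rewrite (funext IH) /step; field.
Qed.

Lemma autocorr_origin : autocorr origin =1 origin.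
Proof.
by move=> z; rewrite /autocorr (sum_origin (fun x => origin (x + z))) add0r.
Qed.

Lemma chain_corr e n z :
  iter n (chain e) (fun eta => autocorr eta z) origin = corr e n z.
Proof. by rewrite chain_autocorr (funext autocorr_origin). Qed.

Lemma chain_ge0 e n F : 0 <= e -> e * #|{: edge}|%:R <= 1 ->
  (forall eta, 0 <= F eta) -> forall eta, 0 <= iter n (chain e) F eta.
Proof.
move=> e0 e1 F0; elim: n => [//|n IH] eta; rewrite iterS /chain sumrB sumr_const.
rewrite -mulr_natr.
have -> (x S K : R) : x + e * (S - x * K) = (1 - e * K) * x + e * S by ring.
by rewrite addr_ge0// mulr_ge0 ?sumr_ge0// subr_ge0.
Qed.

Lemma incr_ge0 e n i : 0 <= e -> e * #|{: edge}|%:R <= 1 ->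
  0 <= incr e n i.
Proof.
move=> e0 e1; rewrite /incr -!chain_corr.
have lQ := lin_iter n (lin_chain e).
rewrite -mulN1r addrC -lQ; apply: chain_ge0 => // eta.
have : 0 <= \sum_x grad (x, i) eta ^+ 2 by apply: sumr_ge0 => x _; exact: sqr_ge0.
by rewrite sum_grad2; lra.
Qed.

Lemma sum_sqr_dist eta g : \sum_x (eta x - g x) ^+ 2 =
  autocorr eta 0 + (- 2 * (\sum_x g x * eta x) + \sum_x g x ^+ 2).
Proof.
rewrite /autocorr mulr_sumr -!big_split /=; apply: eq_bigr => x _.
by rewrite addr0; ring.
Qed.

Lemma chain_cst e n (r : R) eta : iter n (chain e) (fun=> r) eta = r.
Proof.
elim: n eta => [//|n IH] eta; rewrite iterS /chain IH big1 ?mulr0 ?addr0// => a _.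
by rewrite IH subrr.
Qed.

Definition mean e n : T -> R := iter n (step lap (e / 2)) origin.

(** Bias and variance: the first bracket is the summed variance of the chain started from [origin],
    the second term the squared bias of its mean relative to [g]. *)
Lemma chain_sqr_dist e n g :
  iter n (chain e) (fun eta => \sum_x (eta x - g x) ^+ 2) origin =
  (corr e n (0 : T) - \sum_x mean e n x ^+ 2) + \sum_x (mean e n x - g x) ^+ 2.
Proof.
have lQ := lin_iter n (lin_chain e).
rewrite (lin_ext _ (fun eta => sum_sqr_dist eta g)).
rewrite (linD (fun eta => autocorr eta 0)
  (fun eta => - 2 * (\sum_x g x * eta x) + \sum_x g x ^+ 2) lQ).
rewrite chain_corr lQ chain_cst (lin_sum _ _ (fun x eta => eta x) lQ).
rewrite -addrA; congr (_ + _).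
rewrite (eq_bigr (fun x => g x * mean e n x)); last first.
  by move=> x _; rewrite chain_mean.
rewrite -sumrN mulr_sumr -!big_split /=; apply: eq_bigr => x _; ring.
Qed.

End averaging_chain.

(** * The renewal inequality and the variance of the chain *)

Section variance_bound.
Context {R : realType} {d N : nat}.
Hypothesis hN : (1 < N)%N.
Local Notation T := 'rV['Z_N]_d.
Local Notation edge := (T * 'I_d)%type.
Local Notation incr := (@incr R d N).
Local Notation retprob := (@retprob R d N).
Local Notation gradprob := (@gradprob R d N).
Local Notation trace := (@trace R d N).
Local Notation vol := (@vol R d N).
Local Notation mean := (@mean R d N).
Implicit Types (i : 'I_d) (n m k : nat).

Lemma step_lap_sym e (f g : T -> R) :
  \sum_z f z * step lap e g z = \sum_z step lap e f z * g z.
Proof.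
rewrite /step.
under eq_bigr do rewrite mulrDr mulrCA.
under [RHS]eq_bigr do rewrite mulrDl -mulrA.
by rewrite !big_split /= -!mulr_sumr lap_sym.
Qed.

Lemma iter_step_lap_sym e n (f g : T -> R) :
  \sum_z f z * iter n (step lap e) g z = \sum_z iter n (step lap e) f z * g z.
Proof.
elim: n f => [//|n IH] f; rewrite iterS step_lap_sym IH.
by rewrite -iterSr.
Qed.

(** By symmetry of the one-step operator, the squared norm of the n-step kernel is the return
    probability after 2 n steps. *)
Lemma sum_mean_sqr e n : \sum_x mean e n x ^+ 2 =
  vol * \sum_(xi : T) (1 - e * rate xi) ^+ (n + n).
Proof.
transitivity (iter (n + n) (step lap (e / 2)) (origin : T -> R) 0).
  rewrite iterD -sum_origin iter_step_lap_sym.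
  by apply: eq_bigr => x _; rewrite expr2.
rewrite iter_step_origin//; congr (_ * _); apply: eq_bigr => xi _.
by rewrite chi0 mulr1; congr (_ ^+ _); field.
Qed.

(** Termwise 1 - 2 e mu <= (1 - e mu)^2. The variance is therefore at most the excess of [corr] over
    [retprob], which is the Duhamel sum. *)
Lemma retprob_le_mean e n : 0 <= e -> e * (4 * d%:R) <= 1 ->
  retprob e n <= \sum_x mean e n x ^+ 2.
Proof.
move=> e0 e1; rewrite sum_mean_sqr ler_wpM2l ?(ltW (vol_gt0 hN))//.
apply: ler_sum => xi _; rewrite addnn -mul2n exprM.
apply: lerXn2r; rewrite ?nnegrE ?base_ge0 ?sqr_ge0//.
by have := sqr_ge0 (e * rate xi); nra.
Qed.

Variable e : R.
Hypotheses (e0 : 0 < e) (e1 : e * (4 * d%:R) <= 1)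
  (e2 : e * #|{: edge}|%:R <= 1).

Local Notation q n := (corr e n (0 : T)).

Lemma corr_ge0 n : 0 <= q n.
Proof.
rewrite -chain_corr; apply: chain_ge0 => //; first exact: ltW.
by move=> eta; apply: sumr_ge0 => x _; rewrite addr0 -expr2 sqr_ge0.
Qed.

Lemma sum_incr_ge0 n : 0 <= \sum_i incr e n i.
Proof. by apply: sumr_ge0 => i _; apply: incr_ge0 => //; exact: ltW. Qed.

Lemma sum_incr_le n m : (n <= m)%N -> \sum_i incr e m i <= \sum_i incr e n i.
Proof.
move=> /subnK <-; elim: (m - n)%N => [//|k IH]; apply: le_trans IH.
by apply: sum_incr_anti => //; exact: ltW.
Qed.

Lemma sum_incr_corr h l : (l <= h)%N ->
  e * l%:R * \sum_i incr e h i <= q (h - l).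
Proof.
move=> lh.
suff : e * l%:R * \sum_i incr e h i <= q (h - l) - q h.
  by have := corr_ge0 h; lra.
elim: l lh => [|l IH] lh; first by rewrite subn0 subrr mulr0 mul0r.
rewrite -natr1 mulrDr mulr1 mulrDl.
have -> : q (h - l.+1) - q h = (q (h - l) - q h) + (q (h - l.+1) - q (h - l)) by ring.
apply: lerD; first by apply: IH; exact: ltnW.
rewrite -(subnSK lh) corr_decr ler_wpM2l ?(ltW e0)//.
by apply: sum_incr_le; rewrite leq_subr.
Qed.

Lemma corr_renewal n A : (4 <= n)%N -> 0 <= A ->
  (forall m i, (n <= m.*2)%N -> gradprob e m i <= A) ->
  exists2 k, (n <= 8 * k)%N &
    q n <= retprob e n + A + 8 / (n%:R * e) * q k.
Proof.
(* The sum is cut at h, about n / 2, and the dissipation at h is averaged over the l steps before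
   it, l about n / 4. The rounding is absorbed in n <= 8 l and n <= 8 (h - l), valid since 4 <=
   n. *)
move=> n4 A0 hA; pose h := n./2; pose l := h./2.
have [[n2h nh nl nhl lh] hn] : [/\ (h.*2 <= n)%N, (n <= h.*2.+1)%N, (n <= 8 * l)%N,
    (n <= 8 * (h - l))%N & (l <= h)%N] /\ (h <= n)%N.
  by rewrite /l /h; split; [split|]; lia.
exists (h - l)%N => //.
rewrite corr_duhamel0// -addrA lerD2l.
rewrite -(big_mkord xpredT (fun k => \sum_i e * incr e k i * gradprob e (n - k.+1) i)).
rewrite (big_cat_nat (leq0n h) hn) //=; apply: lerD.
  (* Early sources: the gradient is at most [A], and the dissipations telescope to [q 0 - q h], at
     most 1. *)
  apply: (@le_trans _ _ (A * (q 0 - q h))); last first.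
    rewrite ler_piMr// {1}/corr /= /origin eqxx lerBlDl lerDr corr_ge0//.
  rewrite big_nat.
  apply: (@le_trans _ _ (\sum_(0 <= k < h | (0 <= k < h)%N) A * (e * \sum_i incr e k i))).
    apply: ler_sum => k /andP[_ kh].
    rewrite mulr_sumr mulr_sumr; apply: ler_sum => i _; rewrite mulrC ler_wpM2r//.
      by rewrite mulr_ge0 ?(ltW e0)//; apply: incr_ge0 => //; exact: ltW.
    by apply: hA; lia.
  rewrite -big_nat -mulr_sumr ler_wpM2l//.
  rewrite (eq_bigr (fun k => q k - q k.+1)) => [|k _]; last by rewrite corr_decr.
  rewrite (@telescope_sumr_eq _ _ _ (fun k => - q k)) ?leq0n//.
    by rewrite opprK addrC lexx.
  by move=> k _; rewrite opprK addrC.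
(* Late sources: each is at most the total dissipation at time h, by monotonicity, and the gradients
   have total mass at most 1. Then [sum_incr_corr] trades this dissipation for [q (h - l)]. *)
apply: (@le_trans _ _ (\sum_i incr e h i)).
  apply: (@le_trans _ _ ((\sum_i incr e h i) *
      (e * \sum_(k < n - h) \sum_i gradprob e k i))); last first.
    rewrite ler_piMr ?sum_incr_ge0// sum_gradprob_le//; exact: ltW.
  rewrite -(big_mkord xpredT (fun k => \sum_i gradprob e k i)).
  rewrite [X in _ <= _ * (_ * X)]big_nat_rev /= add0n.
  rewrite -{1}[h]add0n big_addn !mulr_sumr !big_nat.
  apply: ler_sum => k /andP[_ kh].
  have -> : (n - h - k.+1 = n - (k + h).+1)%N by lia.
  rewrite !mulr_sumr; apply: ler_sum => i _.
  rewrite mulrA ler_wpM2r//; first by apply: gradprob_ge0 => //; exact: ltW.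
  rewrite mulrC ler_wpM2r ?(ltW e0)//.
  apply: (@le_trans _ _ (\sum_i incr e (k + h) i)).
    rewrite (bigD1 i) //= lerDl sumr_ge0// => j _.
    by apply: incr_ge0 => //; exact: ltW.
  by apply: sum_incr_le; rewrite leq_addl.
have n0 : 0 < n%:R :> R by rewrite ltr0n; lia.
rewrite mulrAC ler_pdivlMr ?mulr_gt0//.
apply: le_trans (ler_wpM2l _ (sum_incr_corr lh)); last by [].
have : n%:R <= 8 * l%:R :> R by rewrite -natrM ler_nat.
have := sum_incr_ge0 h; move: (\sum_i _) => b b0 nl'.
have -> : b * (n%:R * e) = n%:R * (e * b) by ring.
have -> : 8 * (e * l%:R * b) = 8 * l%:R * (e * b) by ring.
by rewrite ler_wpM2r// mulr_ge0// ltW.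
Qed.

Variables (K s : R).
Hypotheses (hd : (0 < d)%N) (K0 : 0 <= K) (s1 : 1 <= s)
  (hs : forall t, s <= t -> trace t <= K * vol).

Let e_le1 : e <= 1.
Proof.
have : 1 <= d%:R :> R by rewrite ler1n.
by move: e0 e1; nra.
Qed.

Lemma gradprob_bound n m i : 2 * s <= n%:R * e -> (n <= m.*2)%N ->
  gradprob e m i <= K * vol / s.
Proof.
move=> ns nm.
have ms : s <= m%:R * e.
  have : n%:R <= 2 * m%:R :> R by rewrite -natrM ler_nat mul2n.
  by move: e0; nra.
have s0 : 0 < s by exact: lt_le_trans s1.
have me0 : 0 < m%:R * e by exact: lt_le_trans ms.
apply: (le_trans (gradprob_le hN i (ltW e0) e1 me0)).
rewrite mulrC ler_pM ?invr_ge0 ?(ltW me0)//.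
- by rewrite mulr_ge0 ?(ltW (vol_gt0 hN))// sumr_ge0// => xi _; exact: expR_ge0.
- exact: hs.
- by rewrite lef_pV2.
Qed.

Lemma corr_renewal_bound n J : 8 ^+ J.+1 * (2 * s) <= n%:R * e ->
  exists2 k, 8 ^+ J * (2 * s) <= k%:R * e &
   q n <= retprob e n + K * vol / s + 8 / s * q k.
Proof.
move=> hn; have s0 : 0 < s by exact: lt_le_trans s1.
have J1 : 1 <= 8 ^+ J :> R by rewrite exprn_ege1// ler1n.
have ns : 16 * s <= n%:R * e by apply: le_trans hn; rewrite exprS; nra.
have n4 : (4 <= n)%N.
  rewrite -(ler_nat R) -subr_ge0; move: e0 e_le1 s1 ns; nra.
have A0 : 0 <= K * vol / s by rewrite !mulr_ge0 ?invr_ge0 ?(ltW s0)// (ltW (vol_gt0 hN)).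
have hA m i : (n <= m.*2)%N -> gradprob e m i <= K * vol / s.
  by apply: gradprob_bound; lra.
have [k nk qk] := corr_renewal n4 A0 hA.
exists k.
  have : n%:R <= 8 * k%:R :> R by rewrite -natrM ler_nat.
  by move: hn; rewrite exprS; move: e0; nra.
apply: (le_trans qk); rewrite lerD2l ler_wpM2r ?corr_ge0//.
rewrite ler_wpM2l// lef_pV2 ?posrE//; lra.
Qed.

(** Constants of the induction in [corr_boot]: one [K] bounds the return probability, the other the
    early sources, and 8 is the renewal factor. *)
Fixpoint boot_const J : R := if J is J'.+1 then 2 * K + 8 * boot_const J' else 1.

Lemma boot_const_ge0 J : 0 <= boot_const J.
Proof. by elim: J => [|J IH] /=; [|move: K0; lra]. Qed.

(** Starting from the trivial bound 1, each round multiplies the remainder by 1 / s and uses up one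
    factor 8 of the available time. *)
Lemma corr_boot J n : 8 ^+ J * (2 * s) <= n%:R * e ->
  q n <= boot_const J * (vol + s^-1 ^+ J).
Proof.
have v0 := vol_gt0 hN : 0 < vol.
have s0 : 0 < s by exact: lt_le_trans s1.
have si1 : s^-1 <= 1 by rewrite invf_le1.
have si0 : 0 < s^-1 by rewrite invr_gt0.
elim: J n => [|J IH] n hn /=.
  rewrite mul1r expr0 (@le_trans _ _ 1)//; last by move: v0; lra.
  have -> : 1 = q 0 by rewrite /corr /= /origin eqxx.
  elim: n {hn} => [//|n]; apply: le_trans.
  by rewrite -subr_ge0 corr_decr mulr_ge0 ?(ltW e0) ?sum_incr_ge0.
have [k hk qn] := corr_renewal_bound hn.
have rn : retprob e n <= K * vol.
  apply: (le_trans (retprob_le hN n (ltW e0) e1)); apply: hs.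
  have : 1 <= 8 ^+ J.+1 :> R by rewrite exprn_ege1// ler1n.
  by move: hn s1; nra.
apply: (le_trans qn); rewrite exprS.
have {hk} := IH _ hk; have := boot_const_ge0 J.
have u0 : 0 <= s^-1 ^+ J by rewrite exprn_ge0// ltW.
move: (boot_const J) (q k) u0 => c p; move: (s^-1 ^+ J) si1 si0 => u.
move: (s^-1) => r r1 r0 u0 c0 pc.
have h1 : K * vol * r <= K * vol by rewrite ler_piMr// mulr_ge0// ltW.
have h2 : 8 * r * p <= 8 * r * (c * (vol + u)) by rewrite ler_wpM2l// mulr_ge0// ltW.
have h3 : 8 * r * (c * vol) <= 8 * (c * vol).
  by rewrite ler_wpM2r ?mulr_ge0// ?(ltW v0)//; lra.
have h4 : 0 <= K * (r * u) by rewrite !mulr_ge0// ltW.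
move: rn h1 h2 h3 h4; lra.
Qed.

(** A last application of the renewal inequality: once the return probability is subtracted, every
    remaining term carries a factor 1 / s. *)
Lemma variance_bound J n : 8 ^+ J.+1 * (2 * s) <= n%:R * e ->
  q n - \sum_x mean e n x ^+ 2 <=
  (K * vol + 8 * (boot_const J * (vol + s^-1 ^+ J))) / s.
Proof.
move=> hn; have [k hk qn] := corr_renewal_bound hn.
have := retprob_le_mean n (ltW e0) e1; have := corr_boot hk.
have s0 : 0 < s by exact: lt_le_trans s1.
have si0 : 0 < s^-1 by rewrite invr_gt0.
move: (q k) (q n) (boot_const J * _) qn => p r c.
by move: (s^-1) si0 => u u0 rn pc; nra.
Qed.

End variance_bound.

(** * Comparison of lattice and continuous heat kernels *)

Section elementary_bounds.
Context {R : realType}.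
Implicit Types (x y : R).

Lemma ge0_derive_ge (f df : R -> R) x : 0 <= x ->
  (forall y, is_derive y 1 f (df y)) -> (forall y, 0 <= y -> 0 <= df y) ->
  f 0 <= f x.
Proof.
move=> x0 fdf df0.
have cf : {within `[0, x], continuous f}.
  apply: continuous_subspaceT => y; apply/differentiable_continuous.
  by apply/derivable1_diffP; case: (fdf y).
have [c /[!in_itv]/= /andP[c0 _] fc] := MVT_segment x0 (fun y _ => fdf y) cf.
by rewrite -subr_ge0 fc mulr_ge0 ?df0// subr0.
Qed.

Lemma sin_le_id x : 0 <= x -> sin x <= x.
Proof.
move=> x0; rewrite -subr_ge0.
have := @ge0_derive_ge (fun y => y - sin y) (fun y => 1 - cos y) x x0.
rewrite /= sin0 subr0; apply => y _; by rewrite subr_ge0 cos_le1.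
Qed.

Lemma cos_ge x : 1 - x ^+ 2 / 2 <= cos x.
Proof.
wlog x0 : x / 0 <= x.
  move=> h; have [/h//|x0] := leP 0 x.
  by rewrite -cosN -sqrrN h// oppr_ge0 ltW.
have -> : cos x = 1 - 2 * sin (x / 2) ^+ 2.
  have {1}-> : x = (x / 2) *+ 2 by rewrite -mulr_natr; field.
  by rewrite cos_mulr2n cos2sin2; ring.
have h1 : sin (x / 2) <= x / 2 by apply: sin_le_id; lra.
have h2 : - (x / 2) <= sin (x / 2).
  have [x2|x2] := leP (x / 2) 2; last first.
    by have := sin_geN1 (x / 2); lra.
  have [->|xn0] := eqVneq (x / 2) 0; first by rewrite sin0 oppr0.
  have [->|x2n] := eqVneq (x / 2) 2; first by have := sin_geN1 (2 : R); lra.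
  have : 0 < sin (x / 2).
    by apply: sin2_gt0; rewrite !lt_neqAle x2 x2n eq_sym xn0 /=; lra.
  lra.
nra.
Qed.

Lemma sin_ge x : 0 <= x -> x - x ^+ 3 / 6 <= sin x.
Proof.
move=> x0; rewrite -subr_ge0.
have := @ge0_derive_ge (fun y => sin y - (y - y ^+ 3 / 6))
  (fun y => cos y - (1 - y ^+ 2 / 2)) x x0.
rewrite /= sin0 expr0n /= mul0r !subr0; apply => [y|y _]; last first.
  by rewrite subr_ge0 cos_ge.
apply: is_deriveB; apply: is_deriveB.
apply: is_derive_eq.
by rewrite /GRing.scale /=; field.
Qed.

Lemma expRN_pow m y : 0 <= y -> y ^+ m * expR (- y) <= m%:R ^+ m.
Proof.
move=> y0; case: m => [|m].
  by rewrite !expr0 mul1r -expR0 ler_expR oppr_le0.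
rewrite expRN ler_pdivrMr ?expR_gt0//.
have m0 : 0 < m.+1%:R :> R by [].
have -> : expR y = expR (y / m.+1%:R) ^+ m.+1.
  by rewrite -expRM_natl; congr expR; field; rewrite ?gt_eqF//.
rewrite -exprMn; apply: lerXn2r; rewrite ?nnegrE// ?mulr_ge0 ?expR_ge0//.
by rewrite mulrC -ler_pdivrMr// (le_trans _ (expR_ge1Dx _))// lerDr.
Qed.

Lemma expRB_le x y z : z <= x -> z <= y ->
  `|expR (- x) - expR (- y)| <= `|x - y| * expR (- z).
Proof.
wlog xy : x y / x <= y.
  move=> h zx zy; have [xy|/ltW xy] := leP x y; first exact: h.
  by rewrite distrC [`|x - y|]distrC h.
move=> zx zy; rewrite ger0_norm; last by rewrite subr_ge0 ler_expR lerN2.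
rewrite ler0_norm ?subr_le0// opprB.
apply: (@le_trans _ _ ((y - x) * expR (- x))); last first.
  by rewrite ler_wpM2l ?subr_ge0// ler_expR lerN2.
have -> : - y = - x + - (y - x) by ring.
rewrite expRD; have := expR_ge1Dx (- (y - x)); have := expR_gt0 (- x).
by move: (expR _) (expR _) => u v; nra.
Qed.

Lemma cos_lip x y : `|cos x - cos y| <= `|x - y|.
Proof.
wlog xy : x y / x <= y.
  move=> h; have [xy|/ltW xy] := leP x y; first exact: h.
  by rewrite distrC [`|x - y|]distrC h.
have cf : {within `[x, y], continuous (@cos R)}.
  by apply: continuous_subspaceT => z; exact: continuous_cos.
have [c _ h] := MVT_segment xy (fun z _ => is_derive_cos z) cf.
rewrite distrC h normrM [`|x - y|]distrC ler_piMl// normrN; exact: sin_max.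
Qed.

Lemma pi_le4 : pi <= 4 :> R.
Proof. by have := @pihalf_lt2 R; lra. Qed.

Section freq_bounds.
Variables (N k : nat).
Hypotheses (kN : (k.*2 <= N)%N) (N0 : 0 < N%:R :> R).

Let y : R := pi * k%:R / N%:R.

Lemma freq_sin : freq N k = 2 * sin y ^+ 2.
Proof.
rewrite /freq /ccos muln1.
have -> : 2 * pi * k%:R / N%:R = y *+ 2 by rewrite /y -mulr_natr; ring.
by rewrite cos_mulr2n cos2sin2; ring.
Qed.

Let y0 : 0 <= y.
Proof. by rewrite /y !mulr_ge0 ?pi_ge0 ?invr_ge0. Qed.

Let y2 : y <= 2.
Proof.
rewrite /y ler_pdivrMr//.
have : 2 * k%:R <= N%:R :> R by rewrite -natrM ler_nat mul2n.
have := pi_le4; have := @pi_ge0 R.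
have : 0 <= k%:R :> R by [].
move: (k%:R) (N%:R) (pi : R) => u v p; nra.
Qed.

(** For frequencies up to N / 2 the angle y = pi k / N stays in [0, 2], where [sin_ge] gives sin y
    >= y / 3. The resulting Gaussian decay in k is uniform in N. *)
Lemma freq_lower : k%:R ^+ 2 / 2 <= N%:R ^+ 2 * freq N k :> R.
Proof.
rewrite freq_sin.
have h : y / 3 <= sin y by apply: le_trans (sin_ge y0); move: y0 y2; nra.
have h2 : (y / 3) ^+ 2 <= sin y ^+ 2.
  by apply: lerXn2r => //; rewrite nnegrE; [|apply: le_trans h]; move: y0; lra.
apply: (@le_trans _ _ (N%:R ^+ 2 * (2 * (y / 3) ^+ 2))); last first.
  by rewrite ler_wpM2l ?sqr_ge0// ler_wpM2l.
have -> : N%:R ^+ 2 * (2 * (y / 3) ^+ 2) = 2 / 9 * pi ^+ 2 * k%:R ^+ 2.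
  by rewrite /y; field; rewrite gt_eqF.
have p4 : 4 <= pi ^+ 2 :> R by have := @pi_ge2 R; nra.
have : 0 <= k%:R ^+ 2 :> R by exact: sqr_ge0.
nra.
Qed.

Lemma freq_taylor :
  `|N%:R ^+ 2 * freq N k - 2 * pi ^+ 2 * k%:R ^+ 2| <= 171 * k%:R ^+ 4 / N%:R ^+ 2 :> R.
Proof.
rewrite freq_sin.
have -> : 2 * pi ^+ 2 * k%:R ^+ 2 = N%:R ^+ 2 * (2 * y ^+ 2).
  by rewrite /y; field; rewrite gt_eqF.
have h1 := sin_le_id y0; have h2 := sin_ge y0.
have h3 : sin y ^+ 2 <= y ^+ 2.
  have : 0 <= sin y by apply: le_trans h2; move: y0 y2; nra.
  by move: h1; nra.
have h4 : y ^+ 2 - y ^+ 4 / 3 <= sin y ^+ 2.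
  have h : 0 <= y - y ^+ 3 / 6 by move: y0 y2; nra.
  apply: (@le_trans _ _ ((y - y ^+ 3 / 6) ^+ 2)).
    have -> : (y - y ^+ 3 / 6) ^+ 2 = y ^+ 2 - y ^+ 4 / 3 + (y ^+ 3 / 6) ^+ 2.
      by field.
    by rewrite lerDl sqr_ge0.
  by apply: lerXn2r => //; rewrite nnegrE// (le_trans h).
rewrite -mulrBr normrM ger0_norm ?sqr_ge0// -mulrBr normrM ger0_norm//.
rewrite ler0_norm ?subr_le0// opprB.
apply: (@le_trans _ _ (N%:R ^+ 2 * (2 * (y ^+ 4 / 3)))).
  by rewrite ler_wpM2l ?sqr_ge0// ler_wpM2l//; lra.
have -> : N%:R ^+ 2 * (2 * (y ^+ 4 / 3)) = 2 / 3 * pi ^+ 4 * k%:R ^+ 4 / N%:R ^+ 2.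
  by rewrite /y; field; rewrite gt_eqF.
rewrite ler_wpM2r ?invr_ge0 ?sqr_ge0// ler_wpM2r ?exprn_ge0//.
(* The constant 171 is an upper bound for 2/3 * 4^4. *)
have : pi ^+ 4 <= 4 ^+ 4 :> R by apply: lerXn2r; rewrite ?nnegrE ?pi_ge0 ?pi_le4.
lra.
Qed.

End freq_bounds.
End elementary_bounds.

Section kernel_comparison.
Context {R : realType}.
Implicit Types (N k j n M L : nat) (t v r : R).

Lemma sum_inv_sqr n : \sum_(1 <= k < n.+2) (k%:R ^+ 2)^-1 <= 2 - n.+1%:R^-1 :> R.
Proof.
elim: n => [|n IH]; first by rewrite big_nat1 expr1n invr1; lra.
rewrite big_nat_recr //= (le_trans (lerD IH (lexx _)))//.
have n0 : 0 < n.+1%:R :> R by [].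
rewrite -[n.+2%:R]natr1; move: (n.+1%:R) n0 => x x0.
suff : ((x + 1) ^+ 2)^-1 <= x^-1 - (x + 1)^-1 by lra.
have -> : x^-1 - (x + 1)^-1 = (x * (x + 1))^-1 by field; rewrite !gt_eqF ?addr_gt0.
by rewrite lef_pV2 ?posrE ?exprn_gt0 ?mulr_gt0 ?addr_gt0//; nra.
Qed.

Lemma sum_inv_sqr_le2 n : \sum_(1 <= k < n) (k%:R ^+ 2)^-1 <= 2 :> R.
Proof.
case: n => [|[|n]]; try by rewrite big_geq.
by apply: le_trans (sum_inv_sqr n) _; rewrite lerBlDr lerDl.
Qed.

(** N times the one-dimensional lattice heat kernel at time t N^2, for the walk jumping to each
    neighbour at rate 1/2. *)
Definition dkern N t j : R :=
  \sum_(k < N) expR (- (freq N k * (t * N%:R ^+ 2))) * ccos N k j.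

Definition hmode t v r : R :=
  expR (- (2 * pi ^+ 2 * r ^+ 2 * t)) * cos (2 * pi * r * v).

(** Cesaro mean of the one-dimensional Fourier series. The double sum over p and q shows positivity
    of the kernel and expands over coordinates; grouping by p - q, in [toeplitz_sum], gives the
    usual weights 1 - k / n. The frequency of [hmode] is real so that differences of indices can be
    inserted. *)
Definition fejer n t v : R :=
  n%:R^-1 * \sum_(p < n) \sum_(q < n) hmode t v (p%:R - q%:R).

Lemma hmode_even t v r : hmode t v (- r) = hmode t v r.
Proof. by rewrite /hmode sqrrN mulrN mulNr cosN. Qed.

Lemma toeplitz_sum (f : R -> R) n : (forall r, f (- r) = f r) ->
  \sum_(p < n) \sum_(q < n) f (p%:R - q%:R) =
  n%:R * f 0 + 2 * \sum_(1 <= k < n) (n%:R - k%:R) * f k%:R.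
Proof.
move=> fe; elim: n => [|n IH].
  by rewrite big_ord0 big_geq// mul0r mulr0 addr0.
rewrite big_ord_recr /=; under eq_bigr do rewrite big_ord_recr /=.
rewrite big_split /= IH big_ord_recr /= subrr.
have hs : \sum_(q < n) f (n%:R - q%:R) = \sum_(1 <= k < n.+1) f k%:R.
  rewrite -(big_mkord xpredT (fun q => f (n%:R - q%:R))) big_nat_rev /= add0n.
  rewrite big_add1 /= !big_nat; apply: eq_bigr => k /andP[_ kn].
  by rewrite -natrB ?leq_subr// subKn.
have -> : \sum_(p < n) f (p%:R - n%:R) = \sum_(1 <= k < n.+1) f k%:R.
  by rewrite -hs; apply: eq_bigr => p _; rewrite -fe opprB.
rewrite hs -!natr1.
have -> : \sum_(1 <= k < n.+1) (n%:R + 1 - k%:R) * f k%:R =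
    \sum_(1 <= k < n) (n%:R - k%:R) * f k%:R + \sum_(1 <= k < n.+1) f k%:R.
  have -> : \sum_(1 <= k < n) (n%:R - k%:R) * f k%:R =
      \sum_(1 <= k < n.+1) (n%:R - k%:R) * f k%:R.
    case: n {IH hs} => [|n]; first by rewrite !big_geq.
    by rewrite [RHS]big_nat_recr //= subrr mul0r addr0.
  by rewrite -big_split; apply: eq_bigr => k _ /=; ring.
ring.
Qed.

Lemma fejerE n t v : (0 < n)%N -> fejer n t v =
  1 + 2 * \sum_(1 <= k < n) (1 - k%:R / n%:R) * hmode t v k%:R.
Proof.
move=> n0; have nn : n%:R != 0 :> R by rewrite pnatr_eq0 -lt0n.
rewrite /fejer toeplitz_sum; last exact: hmode_even.
have -> : hmode t v 0 = 1.
  by rewrite /hmode expr0n /= !(mulr0, mul0r) oppr0 expR0 cos0 mulr1.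
rewrite mulr1 mulrDr mulVf//; congr (1 + _).
rewrite mulrCA; congr (2 * _); rewrite mulr_sumr.
by apply: eq_bigr => k _; field.
Qed.

Lemma freq_rev N k : (k <= N)%N -> freq N (N - k) = freq N k :> R.
Proof.
case: N => [|N] kN; first by rewrite leqn0 in kN; rewrite (eqP kN) subn0.
congr (1 - _); rewrite /ccos !muln1 natrB//.
have -> : 2 * pi * (N.+1%:R - k%:R) / N.+1%:R =
    - (2 * pi * k%:R / N.+1%:R) + 2 * pi * 1%:R :> R by field.
by rewrite cosD_natmul2pi cosN.
Qed.

Lemma ccos_rev N k j : (k <= N)%N -> ccos N (N - k) j = ccos N k j :> R.
Proof.
case: N => [|N] kN; first by rewrite leqn0 in kN; rewrite (eqP kN) subn0.
rewrite /ccos mulnBl natrB ?leq_mul// natrM.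
have -> : 2 * pi * (N.+1%:R * j%:R - (k * j)%:R) / N.+1%:R =
    - (2 * pi * (k * j)%:R / N.+1%:R) + 2 * pi * j%:R :> R by field.
by rewrite cosD_natmul2pi cosN.
Qed.

Definition dmode N t j k : R :=
  expR (- (freq N k * (t * N%:R ^+ 2))) * ccos N k j.

(** Frequencies above N / 2 are folded by k -> N - k, so that [freq_lower] applies to every mode.
    The second range stops at (N - 1) / 2, hence for even N the frequency N / 2 is counted once. *)
Lemma dkernE N t j : (0 < N)%N -> dkern N t j =
  1 + \sum_(1 <= k < (N./2).+1) dmode N t j k
    + \sum_(1 <= k < (N.-1./2).+1) dmode N t j k.
Proof.
move=> N0; rewrite /dkern -(big_mkord xpredT (dmode N t j)).
have d0 : dmode N t j 0 = 1.
  have f0 : freq N 0 = 0 :> R by rewrite /freq ccosC ccos0 subrr.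
  by rewrite /dmode f0 mul0r oppr0 expR0 ccosC ccos0 mulr1.
rewrite big_ltn// d0 -addrA; congr (1 + _).
have m1 : (1 <= (N./2).+1)%N by [].
have mN : ((N./2).+1 <= N)%N || (N == 1)%N by lia.
case/orP: mN => [mN|/eqP ->]; last by rewrite !big_geq// addr0.
rewrite (big_cat_nat m1 mN) /=; congr (_ + _).
have shift (G : nat -> R) : \sum_((N./2).+1 <= k < N) G k =
    \sum_(1 <= k < (N.-1./2).+1) G (k + N./2)%N.
  rewrite -[(N./2).+1]add1n big_addn.
  by have -> : (N - N./2 = (N.-1./2).+1)%N by lia.
rewrite big_nat_rev /= shift.
rewrite !big_nat; apply: eq_bigr => k /andP[k1 kN].
have -> : ((N./2).+1 + N - (k + N./2).+1 = N - k)%N by lia.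
rewrite /dmode freq_rev ?ccos_rev//; lia.
Qed.

Lemma mode_const_le (b u w z x : R) : 0 <= b -> 0 <= u -> 0 <= w -> 0 <= z ->
  x <= 171 * b * u * z + 8 * u * z + w * z -> x <= (171 * b + 10) * (u + w) * z.
Proof.
move=> b0 u0 w0 z0 /le_trans; apply; rewrite -subr_ge0.
have -> : (171 * b + 10) * (u + w) * z - (171 * b * u * z + 8 * u * z + w * z) =
  171 * (b * w * z) + 2 * (u * z) + 9 * (w * z) by ring.
by rewrite !addr_ge0 ?[0 <= _ * (_ * _)]mulr_ge0 ?ler0n ?mulr_ge0.
Qed.

Lemma prod_diff_le d (u w : 'I_d -> R) B e : 1 <= B -> 0 <= e ->
  (forall i, `|u i| <= B) -> (forall i, `|w i| <= B) ->
  (forall i, `|u i - w i| <= e) ->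
  `|\prod_i u i - \prod_i w i| <= d%:R * B ^+ d * e.
Proof.
move=> B1 e0; have B0 : 0 <= B by exact: le_trans B1.
elim: d u w => [|d IH] u w hu hw huw.
  by rewrite !big_ord0 subrr normr0 !mul0r.
rewrite !big_ord_recl; set U := \prod_(i < d) _; set W := \prod_(i < d) w _.
have -> : u ord0 * U - w ord0 * W = (u ord0 - w ord0) * U + w ord0 * (U - W).
  by ring.
have hU : `|U| <= B ^+ d.
  rewrite normr_prod -[d in leRHS]card_ord -prodr_const.
  by apply: ler_prod => i _; rewrite normr_ge0 hu.
have {}IH : `|U - W| <= d%:R * B ^+ d * e by apply: IH.
apply: (le_trans (ler_normD _ _)); rewrite !normrM.
have Bd : B ^+ d <= B ^+ d.+1 by rewrite ler_weXn2l.
have h1 : `|u ord0 - w ord0| * `|U| <= e * B ^+ d.+1.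
  by apply: ler_pM => //; exact: le_trans Bd.
have h2 : `|w ord0| * `|U - W| <= B * (d%:R * B ^+ d * e) by apply: ler_pM.
apply: (le_trans (lerD h1 h2)).
by rewrite -natr1 exprS; lra.
Qed.

Variable a : R.
Hypothesis a0 : 0 < a.

(** From y^3 exp(- y) <= 3^3 at y = a k^2 / 2: four powers of k are absorbed and k^(-2) remains for
    summation. *)
Definition decay : R := 27 * (2 / a) ^+ 3.

Lemma decay_ge0 : 0 <= decay.
Proof. by rewrite /decay mulr_ge0// exprn_ge0// divr_ge0// ltW. Qed.

Lemma expR_decay k : (0 < k)%N ->
  k%:R ^+ 4 * expR (- (a * (k%:R ^+ 2 / 2))) <= decay / k%:R ^+ 2.
Proof.
move=> k0; have kR : 0 < k%:R :> R by rewrite ltr0n.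
rewrite ler_pdivlMr ?exprn_gt0//.
have := @expRN_pow R 3 (a * (k%:R ^+ 2 / 2)).
have -> : 3%:R ^+ 3 = 27 :> R by ring.
have h : 0 <= a * (k%:R ^+ 2 / 2) by rewrite mulr_ge0 ?(ltW a0)// divr_ge0// sqr_ge0.
move=> /(_ h); set E := expR _ => hE.
have -> : k%:R ^+ 4 * E * k%:R ^+ 2 = (2 / a) ^+ 3 * ((a * (k%:R ^+ 2 / 2)) ^+ 3 * E).
  by field; rewrite gt_eqF.
by rewrite mulrC ler_wpM2r// exprn_ge0// divr_ge0// ltW.
Qed.

Lemma hmode_exp_le t k : a <= t ->
  expR (- (2 * pi ^+ 2 * k%:R ^+ 2 * t)) <= expR (- (a * (k%:R ^+ 2 / 2))).
Proof.
move=> at_; rewrite ler_expR lerN2.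
have p4 : 4 <= pi ^+ 2 :> R by have := @pi_ge2 R; nra.
have k2 : 0 <= k%:R ^+ 2 :> R by exact: sqr_ge0.
apply: (@le_trans _ _ (t * (k%:R ^+ 2 / 2))); first by rewrite ler_wpM2r// divr_ge0.
rewrite mulrC ler_wpM2r ?(le_trans (ltW a0))//.
nra.
Qed.

Lemma freq_exp_arg N t k : a <= t -> (0 < N)%N -> (k.*2 <= N)%N ->
  a * (k%:R ^+ 2 / 2) <= freq N k * (t * N%:R ^+ 2).
Proof.
move=> at_ N0 kN; have NR : 0 < N%:R :> R by rewrite ltr0n.
have -> : freq N k * (t * N%:R ^+ 2) = t * (N%:R ^+ 2 * freq N k) by ring.
by apply: ler_pM; rewrite ?(ltW a0) ?divr_ge0 ?sqr_ge0 ?freq_lower.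
Qed.

Lemma dmode_le N t j k : a <= t -> (0 < N)%N -> (k.*2 <= N)%N -> (0 < k)%N ->
  `|dmode N t j k| <= decay / k%:R ^+ 2.
Proof.
move=> at_ N0 kN k0; apply: le_trans (expR_decay k0).
rewrite /dmode normrM ger0_norm ?expR_ge0//.
rewrite mulrC ler_pM ?expR_ge0//.
  by apply: le_trans (cos_max _) _; rewrite exprn_ege1// ler1n.
by rewrite ler_expR lerN2 freq_exp_arg.
Qed.

Lemma hmode_le t v k : a <= t -> (0 < k)%N ->
  `|hmode t v k%:R| <= decay / k%:R ^+ 2.
Proof.
move=> at_ k0; apply: le_trans (expR_decay k0).
rewrite /hmode normrM ger0_norm ?expR_ge0//.
rewrite mulrC ler_pM ?expR_ge0//.
  by apply: le_trans (cos_max _) _; rewrite exprn_ege1// ler1n.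
exact: hmode_exp_le.
Qed.

Definition kern_bound : R := 1 + 4 * decay.

Lemma kern_bound_ge1 : 1 <= kern_bound.
Proof. by rewrite /kern_bound; have := decay_ge0; lra. Qed.

Lemma dkern_le N t j : a <= t -> (0 < N)%N -> `|dkern N t j| <= kern_bound.
Proof.
move=> at_ N0; rewrite dkernE//.
have h M : (M.*2 <= N)%N -> `|\sum_(1 <= k < M.+1) dmode N t j k| <= 2 * decay.
  move=> MN; apply: (le_trans (ler_norm_sum _ _ _)).
  apply: (@le_trans _ _ (\sum_(1 <= k < M.+1) decay * (k%:R ^+ 2)^-1)).
    rewrite !big_nat; apply: ler_sum => k /andP[k1 kM].
    by apply: dmode_le => //; lia.
  by rewrite -mulr_sumr mulrC ler_wpM2r ?decay_ge0// sum_inv_sqr_le2.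
apply: (le_trans (ler_normD _ _)).
apply: (le_trans (lerD (ler_normD _ _) (lexx _))).
have := h N./2 ltac:(lia); have := h (N.-1)./2 ltac:(lia).
rewrite normr1 /kern_bound; move: `|_| `|_| => u w; lra.
Qed.

Lemma fejer_le n t v : a <= t -> (0 < n)%N -> `|fejer n t v| <= kern_bound.
Proof.
move=> at_ n0; rewrite fejerE//; apply: (le_trans (ler_normD _ _)).
rewrite normr1 normrM ger0_norm// /kern_bound lerD2l.
suff : `|\sum_(1 <= k < n) (1 - k%:R / n%:R) * hmode t v k%:R| <= decay * 2.
  by move: `|_| => u; lra.
apply: (le_trans (ler_norm_sum _ _ _)).
apply: (@le_trans _ _ (\sum_(1 <= k < n) decay * (k%:R ^+ 2)^-1)).
  rewrite !big_nat; apply: ler_sum => k /andP[k1 kn].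
  rewrite normrM; apply: le_trans (hmode_le v at_ k1).
  rewrite ler_piMl// ger0_norm.
    by rewrite gerBl divr_ge0.
  by rewrite subr_ge0 ler_pdivrMr ?ltr0n// mul1r ler_nat ltnW.
by rewrite -mulr_sumr ler_wpM2l ?decay_ge0// sum_inv_sqr_le2.
Qed.

Variable b : R.
Hypothesis ab : a <= b.

Definition mode_const : R := (171 * b + 10) * decay.

Lemma mode_const_ge0 : 0 <= mode_const.
Proof. by rewrite mulr_ge0 ?decay_ge0//; move: a0 ab; lra. Qed.

(** When both modes are present there are three errors: the eigenvalue (171 b / N), the phase (8 /
    N) and the Cesaro weight (1 / n), each times at most k^4. A mode present on one side only is of
    the same order, since k > M gives 1 <= 2 k / N and k >= n gives 1 <= k / n. The Gaussian factor
    absorbs k^4. *)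
Lemma mode_diff N M n t v j k : a <= t <= b -> (0 < N)%N -> (0 < n)%N ->
  (M.*2 <= N)%N -> (N <= M.*2.+2)%N -> `|v - j%:R / N%:R| <= N%:R^-1 ->
  (0 < k)%N ->
  `|(if (k <= M)%N then dmode N t j k else 0) -
    (if (k < n)%N then (1 - k%:R / n%:R) * hmode t v k%:R else 0)|
  <= mode_const * (N%:R^-1 + n%:R^-1) * (k%:R ^+ 2)^-1.
Proof.
move=> /andP[at_ tb] N0 n0 MN NM vj k0.
have kM_le : (k <= M -> k.*2 <= N)%N by clear -MN; lia.
have kM_gt : (M < k -> N <= 2 * k)%N by clear -NM; lia.
have b0 : 0 < b by exact: lt_le_trans ab.
have c0 : 0 <= 171 * b + 10 by rewrite addr_ge0 ?mulr_ge0 ?ler0n ?(ltW b0).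
have NR : 0 < N%:R :> R by rewrite ltr0n.
have nR : 0 < n%:R :> R by rewrite ltr0n.
have kR : 1 <= k%:R :> R by rewrite ler1n.
have Ni1 : N%:R^-1 <= 1 :> R by rewrite invf_le1// ler1n.
have Ni0 : 0 < N%:R^-1 :> R by rewrite invr_gt0.
have ni0 : 0 < n%:R^-1 :> R by rewrite invr_gt0.
have k4 : 1 <= k%:R ^+ 4 :> R by rewrite exprn_ege1.
have k14 : k%:R <= k%:R ^+ 4 :> R by rewrite ler_eXnr.
set E := expR (- (a * (k%:R ^+ 2 / 2))).
have E0 : 0 <= E by exact: expR_ge0.
have hE := expR_decay k0; rewrite -/E in hE.
suff h : `|(if (k <= M)%N then dmode N t j k else 0) -
    (if (k < n)%N then (1 - k%:R / n%:R) * hmode t v k%:R else 0)|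
    <= (171 * b + 10) * (N%:R^-1 + n%:R^-1) * (k%:R ^+ 4 * E).
  apply: (le_trans h); rewrite /mode_const.
  have -> : (171 * b + 10) * decay * (N%:R^-1 + n%:R^-1) * (k%:R ^+ 2)^-1 =
     (171 * b + 10) * (N%:R^-1 + n%:R^-1) * (decay / k%:R ^+ 2) by ring.
  by rewrite ler_wpM2l// mulr_ge0// addr_ge0// ltW.
have hh : `|hmode t v k%:R| <= E.
  rewrite /hmode normrM ger0_norm ?expR_ge0//.
  by rewrite (le_trans (ler_piMr _ (cos_max _))) ?expR_ge0// hmode_exp_le.
have w1 : (1 - k%:R / n%:R) * hmode t v k%:R =
    hmode t v k%:R - k%:R / n%:R * hmode t v k%:R by ring.
have k4E : 0 <= k%:R ^+ 4 * E by rewrite mulr_ge0// exprn_ge0.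
have kE : k%:R * E <= k%:R ^+ 4 * E by rewrite ler_wpM2r.
case: (leqP k M) => kM; last first.
  case: (ltnP k n) => kn; last first.
    by rewrite subrr normr0 mulr_ge0// mulr_ge0// addr_ge0// ltW.
  rewrite sub0r normrN normrM.
  have h1 : `|1 - k%:R / n%:R| <= 1 :> R.
    have : 0 <= k%:R / n%:R :> R by rewrite divr_ge0.
    have : k%:R / n%:R <= 1 :> R by rewrite ler_pdivrMr// mul1r ler_nat ltnW.
    by move=> h1 h2; rewrite ger0_norm ?subr_ge0// gerBl.
  apply: (@le_trans _ _ E).
    by rewrite -[leRHS]mul1r ler_pM.
  have h2 : 1 <= 2 * k%:R * N%:R^-1 :> R.
    by rewrite ler_pdivlMr// mul1r -natrM ler_nat kM_gt.
  have h3 : 1 <= 2 * k%:R ^+ 4 * N%:R^-1 :> R.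
    by apply: (le_trans h2); rewrite ler_wpM2r ?(ltW Ni0)// ler_wpM2l.
  apply: mode_const_le => //; rewrite ?(ltW b0) ?(ltW Ni0) ?(ltW ni0)//.
  apply: (@le_trans _ _ (8 * N%:R^-1 * (k%:R ^+ 4 * E))); last first.
    rewrite addrAC lerDr addr_ge0 ?[0 <= _ * (_ * _)]mulr_ge0 ?ler0n ?(ltW Ni0) ?(ltW ni0)//.
    by rewrite mulr_ge0 ?mulr_ge0 ?ler0n ?(ltW b0) ?(ltW Ni0).
  have -> : 8 * N%:R^-1 * (k%:R ^+ 4 * E) = 8 * k%:R ^+ 4 * N%:R^-1 * E by ring.
  rewrite ler_peMl// (le_trans h3)// ler_wpM2r ?(ltW Ni0)// ler_wpM2r//.
  by rewrite ler_nat.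
case: (ltnP k n) => kn; last first.
  rewrite subr0.
  have kMN := kM_le kM.
  have hd : `|dmode N t j k| <= E.
    rewrite /dmode normrM ger0_norm ?expR_ge0//.
    rewrite (le_trans (ler_piMr _ (cos_max _))) ?expR_ge0//.
    by rewrite ler_expR lerN2 freq_exp_arg.
  apply: (le_trans hd).
  have h2 : 1 <= k%:R * n%:R^-1 :> R by rewrite ler_pdivlMr// mul1r ler_nat.
  have h3 : 1 <= k%:R ^+ 4 * n%:R^-1 :> R.
    by apply: (le_trans h2); rewrite ler_wpM2r ?(ltW ni0).
  apply: mode_const_le => //; rewrite ?(ltW b0) ?(ltW Ni0) ?(ltW ni0)//.
  apply: (@le_trans _ _ (n%:R^-1 * (k%:R ^+ 4 * E))).
    by rewrite mulrA [n%:R^-1 * _]mulrC ler_peMl.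
  by rewrite lerDr addr_ge0 ?mulr_ge0 ?mulr_ge0 ?ler0n ?(ltW b0) ?(ltW Ni0).
have kMN := kM_le kM.
pose eA := expR (- (freq N k * (t * N%:R ^+ 2))).
pose eB := expR (- (2 * pi ^+ 2 * k%:R ^+ 2 * t)).
have dE : dmode N t j k - (1 - k%:R / n%:R) * hmode t v k%:R =
    (eA - eB) * ccos N k j + eB * (ccos N k j - cos (2 * pi * k%:R * v)) +
    k%:R / n%:R * hmode t v k%:R.
  by rewrite /dmode /hmode -/eA -/eB; ring.
rewrite dE.
have h1 : `|(eA - eB) * ccos N k j| <= 171 * b * N%:R^-1 * (k%:R ^+ 4 * E).
  rewrite normrM (le_trans (ler_piMr _ (cos_max _)))//.
  apply: (le_trans (expRB_le (z := a * (k%:R ^+ 2 / 2)) _ _)).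
  - exact: freq_exp_arg.
  - by rewrite -lerN2 -ler_expR hmode_exp_le.
  rewrite -/E [leRHS]mulrA ler_wpM2r//.
  have -> : freq N k * (t * N%:R ^+ 2) - 2 * pi ^+ 2 * k%:R ^+ 2 * t =
    t * (N%:R ^+ 2 * freq N k - 2 * pi ^+ 2 * k%:R ^+ 2) by ring.
  rewrite normrM ger0_norm; last by apply: le_trans at_; exact: ltW.
  apply: (@le_trans _ _ (b * (171 * k%:R ^+ 4 / N%:R ^+ 2))).
    by apply: ler_pM => //; [apply: le_trans at_; exact: ltW|exact: freq_taylor].
  have -> : b * (171 * k%:R ^+ 4 / N%:R ^+ 2) =
      171 * b * N%:R^-1 * k%:R ^+ 4 * N%:R^-1 by field; rewrite gt_eqF.
  by rewrite ler_piMr// 3?mulr_ge0 ?ler0n ?(ltW b0) ?(ltW Ni0) ?exprn_ge0.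
have h2 : `|eB * (ccos N k j - cos (2 * pi * k%:R * v))| <=
    8 * N%:R^-1 * (k%:R ^+ 4 * E).
  rewrite normrM ger0_norm ?expR_ge0//.
  have hc : `|ccos N k j - cos (2 * pi * k%:R * v)| <= 8 * N%:R^-1 * k%:R ^+ 4.
    rewrite /ccos; apply: (le_trans (cos_lip _ _)).
    have -> : 2 * pi * (k * j)%:R / N%:R - 2 * pi * k%:R * v =
       - (2 * pi * k%:R * (v - j%:R / N%:R)) by rewrite natrM; ring.
    rewrite normrN normrM ger0_norm; last by rewrite !mulr_ge0 ?pi_ge0.
    have p4 := @pi_le4 R; have p0 := @pi_ge0 R.
    apply: (@le_trans _ _ (8 * k%:R ^+ 4 * N%:R^-1)); last by rewrite mulrAC.
    apply: ler_pM => //; first by rewrite !mulr_ge0.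
    by rewrite ler_pM// ?mulr_ge0//; lra.
  have -> : 8 * N%:R^-1 * (k%:R ^+ 4 * E) = E * (8 * N%:R^-1 * k%:R ^+ 4) by ring.
  by apply: ler_pM => //; [exact: expR_ge0|exact: hmode_exp_le].
have h3 : `|k%:R / n%:R * hmode t v k%:R| <= n%:R^-1 * (k%:R ^+ 4 * E).
  rewrite normrM ger0_norm; last by rewrite divr_ge0.
  rewrite mulrAC mulrC ler_wpM2l ?(ltW ni0)//.
  by apply: ler_pM.
apply: (le_trans (ler_normD _ _)); apply: (le_trans (lerD (ler_normD _ _) h3)).
apply: (le_trans (lerD (lerD h1 h2) (lexx _))).
by apply: mode_const_le => //; exact: ltW.
Qed.

Lemma half_sum_diff N M n t v j : a <= t <= b -> (0 < N)%N -> (0 < n)%N ->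
  (M.*2 <= N)%N -> (N <= M.*2.+2)%N -> `|v - j%:R / N%:R| <= N%:R^-1 ->
  `|\sum_(1 <= k < M.+1) dmode N t j k -
    \sum_(1 <= k < n) (1 - k%:R / n%:R) * hmode t v k%:R|
  <= 2 * mode_const * (N%:R^-1 + n%:R^-1).
Proof.
move=> tab N0 n0 MN NM vj; pose L := maxn M.+1 n.
rewrite (big_nat_widen 1 M.+1 L) ?leq_maxl// (big_nat_widen 1 n L) ?leq_maxr//.
rewrite [X in X - _]big_mkcond [X in _ - X]big_mkcond -sumrB.
apply: (le_trans (ler_norm_sum _ _ _)).
have h : 0 <= mode_const * (N%:R^-1 + n%:R^-1).
  by rewrite mulr_ge0 ?mode_const_ge0// addr_ge0// invr_ge0.
apply: (@le_trans _ _ (\sum_(1 <= k < L)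
    mode_const * (N%:R^-1 + n%:R^-1) * (k%:R ^+ 2)^-1)).
  rewrite !big_nat; apply: ler_sum => k /andP[k1 _].
  by rewrite ltnS; exact: mode_diff.
by rewrite -mulr_sumr -[leRHS]mulrA [leRHS]mulrC ler_wpM2l// sum_inv_sqr_le2.
Qed.

Lemma dkern_fejer N n t v j : a <= t <= b -> (0 < N)%N -> (0 < n)%N ->
  `|v - j%:R / N%:R| <= N%:R^-1 ->
  `|dkern N t j - fejer n t v| <= 4 * mode_const * (N%:R^-1 + n%:R^-1).
Proof.
move=> tab N0 n0 vj; rewrite dkernE// fejerE//.
have h1 := @half_sum_diff N N./2 n t v j tab N0 n0 ltac:(lia) ltac:(lia) vj.
have h2 := @half_sum_diff N (N.-1)./2 n t v j tab N0 n0 ltac:(lia) ltac:(lia) vj.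
move: h1 h2; set S := \sum_(1 <= k < n) _; set S1 := \sum_(1 <= k < (N./2).+1) _.
set S2 := \sum_(1 <= k < _) dmode _ _ _ _ => h1 h2.
have -> : 1 + S1 + S2 - (1 + 2 * S) = (S1 - S) + (S2 - S) by ring.
by apply: (le_trans (ler_normD _ _)); move: h1 h2; lra.
Qed.

End kernel_comparison.

(** * From Poisson clocks to the chain *)

Section probability_tools.
Context dO (Omega : measurableType dO) (R : realType) (P : probability Omega R).

Lemma probability_ae_eq (A B : set Omega) : measurable A -> measurable B ->
  {ae P, forall w, A w <-> B w} -> P A = P B.
Proof.
move=> mA mB AB; rewrite -[A]setIT -[B]setIT -!integral_indic//.
apply: ge0_ae_eq_integral => //=.
- by apply/measurable_EFinP; exact: measurable_indic.
- by apply/measurable_EFinP; exact: measurable_indic.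
apply: filterS AB => w ABw _; congr EFin.
by rewrite !indicE; congr ((_ : bool)%:R); apply/idP/idP; rewrite !inE => /ABw.
Qed.

Lemma integral_sum_indic (I : finType) (A : I -> set Omega) (v p : I -> R) :
  (forall i, measurable (A i)) -> (forall i, P (A i) = (p i)%:E) ->
  (\int[P]_w (\sum_i v i * \1_(A i) w)%:E = (\sum_i v i * p i)%:E)%E.
Proof.
move=> mA PA; under eq_integral do rewrite -sumEFin.
have iA i : P.-integrable setT (fun w => (\1_(A i) w)%:E).
  exact: integrable_indic.
under eq_integral => w _ do under eq_bigr => i _ do rewrite EFinM.
rewrite integral_sum//=; last by move=> i; apply: integrableZl.
rewrite -sumEFin; apply: eq_bigr => i _.
rewrite integralZl// integral_indic// setIT EFinM; congr (_ * _)%E.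
exact: PA.
Qed.

(** Off the disjoint events only G <= S is known. The pointwise comparison is arranged as G + S *
    sum 1_(A i) <= S + sum v_i 1_(A i), which keeps all integrands nonnegative. *)
Lemma integral_le_partition (I : finType) (A : I -> set Omega) (p v : I -> R)
    (G : Omega -> R) (S : R) :
  (forall i, measurable (A i)) -> (forall i, P (A i) = (p i)%:E) ->
  (forall i j w, A i w -> A j w -> i = j) ->
  measurable_fun setT G -> (forall w, 0 <= G w <= S) -> (forall i, 0 <= v i) ->
  {ae P, forall w i, A i w -> G w = v i} ->
  (\int[P]_w (G w)%:E <= (\sum_i v i * p i + S * (1 - \sum_i p i))%:E)%E.
Proof.
move=> mA PA dA mG G0 v0 GA.
have S0 : 0 <= S by have /andP[] := G0 point; exact: le_trans.
have mI (u : I -> R) : measurable_fun setT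
    (fun w : Omega => (\sum_i u i * \1_(A i) w)%:E).
  apply/measurable_EFinP; apply: measurable_sum => i.
  exact: measurable_funM.
have -> : \sum_i v i * p i + S * (1 - \sum_i p i) =
    (S + \sum_i v i * p i) - \sum_i S * p i by rewrite -mulr_sumr; ring.
rewrite EFinB leeBrDr//.
rewrite -(integral_sum_indic (fun=> S) mA PA) -ge0_integralD//=; last 3 first.
- by move=> w _; rewrite lee_fin; have /andP[] := G0 w.
- exact/measurable_EFinP.
- by move=> w _; rewrite lee_fin sumr_ge0// => i _; rewrite mulr_ge0.
rewrite EFinD -(integral_sum_indic v mA PA).
have -> : S%:E = (\int[P]_w (cst S%:E w))%E.
  rewrite integral_cst// -[LHS]mule1; congr (_ * _)%E.
  by apply/esym; exact: probability_setT.
rewrite -ge0_integralD//=; last 1 first.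
- by move=> w _; rewrite lee_fin sumr_ge0// => i _; rewrite mulr_ge0.
apply: ae_ge0_le_integral => //=.
- move=> w _; rewrite -EFinD lee_fin addr_ge0//; first by have /andP[] := G0 w.
  by rewrite sumr_ge0// => i _; rewrite mulr_ge0.
- apply: emeasurable_funD; [exact/measurable_EFinP|exact: mI].
- move=> w _; rewrite -EFinD lee_fin addr_ge0//.
  by rewrite sumr_ge0// => i _; rewrite mulr_ge0.
- by apply: emeasurable_funD => //; exact: mI.
apply: filterS GA => w GA _; rewrite -!EFinD lee_fin.
have [[i Ai]|nA] := pselect (exists i, A i w); last first.
  rewrite !big1 => [|i _|i _]; first by rewrite !addr0; have /andP[] := G0 w.
    by rewrite indicE memNset ?mulr0// => Ai; apply: nA; exists i.
  by rewrite indicE memNset ?mulr0// => Ai; apply: nA; exists i.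
have h (u : I -> R) : \sum_j u j * \1_(A j) w = u i.
  rewrite (bigD1 i) //= indicE mem_set// mulr1 big1 ?addr0// => j ji.
  rewrite indicE memNset ?mulr0// => Aj; move/eqP: ji; apply.
  exact: dA Aj Ai.
by rewrite !h (GA _ Ai) addrC.
Qed.

Lemma measurable_nat_eq (K : Omega -> nat) k : measurable_fun setT K ->
  measurable [set w | K w = k].
Proof. by move=> mK; rewrite -[X in measurable X]setTI; exact: (mK measurableT [set k]). Qed.

Lemma measurable_nat_subn_eq (K L : Omega -> nat) k :
  measurable_fun setT K -> measurable_fun setT L ->
  measurable [set w | (K w - L w)%N = k].
Proof.
move=> mK mL.
have -> : [set w | (K w - L w)%N = k] =
    \bigcup_m ([set w | L w = m] `&` \bigcup_(l in [set l | (l - m)%N = k]) [set w | K w = l]).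
  apply/seteqP; split => w /=.
    by move=> kw; exists (L w) => //; split => //; exists (K w).
  by move=> [m _ [<- [l /= <- ->]]].
apply: bigcup_measurable => m _; apply: measurableI; first exact: measurable_nat_eq.
by apply: bigcup_measurable => l _; exact: measurable_nat_eq.
Qed.

Lemma measurable_forall_ord n (A : 'I_n -> set Omega) :
  (forall k, measurable (A k)) -> measurable [set w | forall k, A k w].
Proof.
move=> mA; have -> : [set w | forall k, A k w] = \bigcap_(k in [set: 'I_n]) A k.
  by apply/seteqP; split => [w h k _|w h k]; exact: h.
by apply: fin_bigcap_measurable => //; exact: finite_finset.
Qed.

Lemma measurable_forall_fin (I : finType) (A : I -> set Omega) :
  (forall k, measurable (A k)) -> measurable [set w | forall k, A k w].
Proof.
move=> mA; have -> : [set w | forall k, A k w] = \bigcap_(k in [set: I]) A k.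
  by apply/seteqP; split => [w h k _|w h k]; exact: h.
by apply: fin_bigcap_measurable => //; exact: finite_finset.
Qed.

(** The law is expressed through values at grid times, as [independent_processes] requires. Values
    and truncated increments determine each other almost surely, because paths start at 0 and are
    nondecreasing. *)
Lemma poisson_grid (K : R -> Omega -> nat) (delta : R) n (b : nat -> nat) :
  poisson_process P K -> 0 < delta ->
  P [set w | forall k : 'I_n.+1, K (k%:R * delta) w = (\sum_(j < k) b j)%N] =
  (\prod_(k < n) poisson_pmf delta (b k))%:E.
Proof.
move=> [mK pK iK indK] d0.
have t0 k : 0 <= k%:R * delta by rewrite mulr_ge0// ltW.
have step k : k.+1%:R * delta - k%:R * delta = delta by rewrite -natr1; ring.
have incrE (k : 'I_n) : P [set w | (K (k.+1%:R * delta)%R w - K (k%:R * delta)%R w)%N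
    = b k] = (poisson_pmf delta (b k))%:E.
  by rewrite iK ?t0// ?step// ltr_pM2r// ltr_nat.
rewrite -prodEFin; under eq_bigr do rewrite -incrE.
have := @indK n (fun k => k%:R * delta) (t0 0%N) _ (fun k => [set b k]).
move=> <- //=; last by move=> i j ij; rewrite ler_wpM2r ?(ltW d0)// ler_nat.
apply: probability_ae_eq.
- by apply: measurable_forall_ord => k; apply: measurable_nat_eq; exact: mK.
- apply: measurable_forall_ord => k.
  by apply: measurable_nat_subn_eq; exact: mK.
apply: filterS pK => w [K0 Kle _]; split.
  move=> h k.
  have := h (lift ord0 k); rewrite lift0 => ->.
  by have := h (widen_ord (leqnSn n) k) => /= ->; rewrite big_ord_recr /= addKn.
move=> h [k kn] /=; elim: k kn => [|k IH] kn.
  by rewrite mul0r K0 big_ord0.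
rewrite big_ord_recr /= -(IH (ltnW kn)).
have := h (Ordinal (kn : (k < n)%N)) => /= <-.
rewrite subnKC// Kle// ler_wpM2r ?(ltW d0)// ler_nat.
exact: leqnSn.
Qed.

End probability_tools.

Section sum_over_codes.
Context {R : realType}.

Lemma sum_tupleS (X : finType) n (G : n.+1.-tuple X -> R) :
  \sum_c G c = \sum_x \sum_(c : n.-tuple X) G [tuple of x :: c].
Proof.
rewrite pair_big /= (reindex (fun p : X * n.-tuple X => [tuple of p.1 :: p.2])) /=.
  by apply: eq_bigr => -[].
exists (fun c : n.+1.-tuple X => (thead c, [tuple of behead c])) => [[x c]|c] _ /=.
  by rewrite theadE; congr pair; apply: val_inj.
by rewrite -tuple_eta.
Qed.

Lemma sum_option (X : finType) (G : option X -> R) :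
  \sum_o G o = G None + \sum_a G (Some a).
Proof.
rewrite (bigD1 None) //=; congr (_ + _).
rewrite (reindex_omap Some id) => [|[a|]//].
by apply: eq_bigl => a; rewrite eqxx.
Qed.

End sum_over_codes.

Section driven_process.
Context {R : realType} {d N : nat}.
Hypothesis hN3 : (2 < N)%N.
Local Notation T := 'rV['Z_N]_d.
Local Notation edge := (T * 'I_d)%type.
Implicit Types (a : edge) (x y : T) (eta : T -> R).

Let one_neq0 : (1 : 'Z_N) != 0 := oner_neq0 _.

Let two_neq0 : (1 + 1 : 'Z_N) != 0.
Proof.
apply/eqP => /(congr1 val) /=.
have -> : (Zp_trunc N).+2 = N by apply: Zp_cast; exact: ltnW.
by rewrite !modn_small//; exact: ltnW.
Qed.

Definition edge_set a : {set T} := [set a.1; a.1 + unitv a.2]%SET.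

Lemma unitv_inj : injective (@unitv d N).
Proof.
move=> i j /matrixP /(_ 0 i); rewrite !unitvE eqxx.
by case: eqP => // _ /eqP; rewrite (negbTE one_neq0).
Qed.

Lemma unitvD_neq0 i j : (unitv i + unitv j : T) != 0.
Proof.
apply/eqP => /matrixP /(_ 0 i); rewrite mxE !unitvE eqxx mxE.
case: eqP => _ /eqP; first by rewrite (negbTE two_neq0).
by rewrite addr0 (negbTE one_neq0).
Qed.

(** This is where 2 < N enters: for N = 2 the codes of an edge read from its two endpoints have the
    same direction and would give the same pair twice. *)
Lemma edge_set_inj : injective edge_set.
Proof.
move=> [x i] [y j] /setP xy; rewrite /edge_set /= in xy.
have {}xy z : (z == x) || (z == x + unitv i) = (z == y) || (z == y + unitv j).
  by have := xy z; rewrite !inE.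
have := xy x; rewrite eqxx /= => /esym /orP[/eqP xEy|/eqP xEy].
  subst y; have := xy (x + unitv i); rewrite eqxx orbT => /esym /orP[|].
    rewrite -subr_eq0 addrAC subrr add0r => /eqP h.
    by have := @unitv_neq0 d N i; rewrite h eqxx.
  by move=> /eqP /addrI /unitv_inj ->.
have := xy y; rewrite eqxx xEy /= => /orP[|].
  rewrite eq_sym -subr_eq0 addrAC subrr add0r => /eqP h.
  by have := @unitv_neq0 d N j; rewrite h eqxx.
rewrite eq_sym -addrA -subr_eq0 addrAC subrr add0r => /eqP h.
by have := unitvD_neq0 j i; rewrite h eqxx.
Qed.

Lemma edgesP (e : {set T}) : reflect (exists a, e = edge_set a) (e \in edges d N).
Proof.
rewrite inE; apply: (iffP existsP) => [[x /existsP[y /andP[/existsP[i xy] /eqP ->]]]|[[x i] ->]].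
  case/orP: xy => /eqP ->; first by exists (x, i).
  by exists (y, i); rewrite /edge_set /= finset.setUC.
exists x; apply/existsP; exists (x + unitv i); rewrite eqxx andbT.
by apply/existsP; exists i; rewrite eqxx.
Qed.

Lemma edges_imset : edges d N = [set edge_set a | a in [set: edge]]%SET.
Proof.
apply/setP => e; apply/edgesP/imsetP => [[a ->]|[a _ ->]]; last by exists a.
by exists a; rewrite ?inE.
Qed.

Lemma prod_edges (G : {set T} -> R) :
  \prod_(e in edges d N) G e = \prod_(a : edge) G (edge_set a).
Proof.
rewrite edges_imset big_imset /=; last by move=> a b _ _; exact: edge_set_inj.
by apply: eq_bigl => a; rewrite inE.
Qed.

Definition ostep eta (o : option edge) : T -> R :=
  if o is Some a then avg a eta else eta.

Definition run eta (c : seq (option edge)) : T -> R := foldl ostep eta c.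

(** Probability that in a grid cell exactly the clock named by [o] rings, once, or none if [o] is
    [None]. *)
Definition wgt (delta : R) (o : option edge) : R :=
  expR (- delta) ^+ #|{: edge}| * (if o is Some _ then delta else 1).

(** Conditional probability that a given edge rings in a cell, given that at most one ring occurs
    there. With this normalization [sum_wgt] is an exact identity. *)
Definition chain_rate (delta : R) : R := delta / (1 + #|{: edge}|%:R * delta).

Lemma sum_wgt delta (F : (T -> R) -> R) n eta : 0 < delta ->
  \sum_(c : n.-tuple (option edge)) F (run eta c) * \prod_(o <- c) wgt delta o =
  (expR (- delta) ^+ #|{: edge}| * (1 + #|{: edge}|%:R * delta)) ^+ n *
  iter n (chain (chain_rate delta)) F eta.
Proof.
move=> d0; set E := #|{: edge}|.
have p0 : 0 < 1 + E%:R * delta by rewrite ltr_pwDl// mulr_ge0// ltW.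
elim: n eta => [|n IH] eta.
  rewrite (eq_bigr (fun=> F eta)) => [|c _]; last first.
    by rewrite [c]tuple0 big_nil mulr1.
  by rewrite sumr_const card_tuple expn0 mul1r.
rewrite sum_tupleS sum_option.
have hS (o : option edge) : \sum_(c : n.-tuple (option edge))
    F (run eta [tuple of o :: c]) * \prod_(o' <- [tuple of o :: c]) wgt delta o' =
    wgt delta o * ((expR (- delta) ^+ E * (1 + E%:R * delta)) ^+ n *
      iter n (chain (chain_rate delta)) F (ostep eta o)).
  rewrite -IH mulr_sumr; apply: eq_bigr => c _.
  by rewrite big_cons /= mulrCA.
rewrite hS; under eq_bigr do rewrite hS.
have -> : iter n.+1 (chain (chain_rate delta)) F eta =
    iter n (chain (chain_rate delta)) F eta + chain_rate delta *
    (\sum_a iter n (chain (chain_rate delta)) F (avg a eta) -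
     iter n (chain (chain_rate delta)) F eta * E%:R).
  by rewrite iterS {1}/chain sumrB sumr_const mulr_natr.
rewrite /wgt /ostep -/E -mulr_sumr -mulr_sumr exprS.
move: (expR (- delta) ^+ E) => x; move: ((x * (1 + E%:R * delta)) ^+ n) => k.
move: (\sum_a _) (iter n _ F eta) => s f.
by rewrite /chain_rate -/E; field; rewrite gt_eqF.
Qed.

Context dO (Omega : measurableType dO) (P : probability Omega R).
Variables (K : {set T} -> R -> Omega -> nat) (eta0 : T -> R)
  (eta : R -> Omega -> T -> R).
Hypotheses (poissonK : forall e, e \in edges d N -> poisson_process P (K e))
  (indepK : independent_processes P (edges d N) K)
  (driven : {ae P, forall w, eta 0 w =1 eta0 /\
     driven_by (fun e t => K e t w) (fun t => eta t w)}).

Definition ring_at (c : seq (option edge)) (e : {set T}) j : nat :=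
  omap edge_set (nth None c j) == Some e.

(** Letter j of the code names the edge ringing in the j-th cell, if any. On such an event the
    configuration at the final time is [run eta0 c]. *)
Definition ring_event delta n (c : n.-tuple (option edge)) : set Omega :=
  [set w | forall e, e \in edges d N -> forall k : 'I_n.+1,
    K e (k%:R * delta) w = (\sum_(j < k) ring_at c e j)%N].

Lemma prob_ring_event delta n (c : n.-tuple (option edge)) : 0 < delta ->
  P (ring_event delta c) = (\prod_(o <- c) wgt delta o)%:E.
Proof.
move=> d0; rewrite /ring_event.
have t0 (k : 'I_n.+1) : 0 <= k%:R * delta by rewrite mulr_ge0// ltW.
have /= -> := indepK t0 (fun e k => [set (\sum_(j < k) ring_at c e j)%N]).
under eq_bigr => e eE do rewrite (poisson_grid n (ring_at c e) (poissonK eE) d0).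
rewrite prodEFin prod_edges exchange_big /= (big_nth None) size_tuple big_mkord.
congr EFin; apply: eq_bigr => j _; rewrite /wgt.
have pmfE (b : bool) : poisson_pmf delta b = (if b then delta else 1) * expR (- delta).
  by rewrite /poisson_pmf d0; case: b; rewrite /= invr1 mulr1.
under eq_bigr do rewrite /ring_at pmfE.
rewrite big_split /= prodr_const mulrC; congr (_ * _).
case: (nth None c j) => [a|] /=; last by rewrite big1.
rewrite (bigD1 a) //= eqxx big1 ?mulr1// => a' /negbTE aa'.
by rewrite (inj_eq Some_inj) (inj_eq edge_set_inj) eq_sym aa'.
Qed.

Lemma measurable_ring_event delta n (c : n.-tuple (option edge)) : 0 < delta ->
  measurable (ring_event delta c).
Proof.
move=> d0.
have -> : ring_event delta c = [set w | forall a (k : 'I_n.+1),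
    K (edge_set a) (k%:R * delta) w = (\sum_(j < k) ring_at c (edge_set a) j)%N].
  apply/seteqP; split => [w h a k|w h e /edgesP[a ->] k]; last exact: h.
  by apply: h; apply/edgesP; exists a.
apply: measurable_forall_fin => a; apply: measurable_forall_ord => k.
apply: measurable_nat_eq.
apply: (poisson_measurable (poissonK _)); first by apply/edgesP; exists a.
by rewrite mulr_ge0// ltW.
Qed.

Lemma ring_event_incr delta n (c : n.-tuple (option edge)) w e j :
  ring_event delta c w -> e \in edges d N -> (j < n)%N ->
  K e (j.+1%:R * delta) w = (K e (j%:R * delta) w + ring_at c e j)%N.
Proof.
move=> h eE jn.
have := h e eE (Ordinal (jn : (j.+1 < n.+1)%N)).
have := h e eE (Ordinal (ltnW jn : (j < n.+1)%N)).
by move=> /= -> ->; rewrite big_ord_recr.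
Qed.

Lemma ring_event_disjoint delta n (c c' : n.-tuple (option edge)) w :
  ring_event delta c w -> ring_event delta c' w -> c = c'.
Proof.
move=> h h'; apply: val_inj; apply: (@eq_from_nth _ None); rewrite ?size_tuple//.
move=> j jn.
have eqr e : e \in edges d N -> ring_at c e j = ring_at c' e j.
  move=> eE; apply/eqP; rewrite -(eqn_add2l (K e (j%:R * delta) w)).
  by rewrite -!(ring_event_incr (delta := delta))//; apply/eqP.
have mem a : edge_set a \in edges d N by apply/edgesP; exists a.
have sn (o o' : option edge) : (forall e, e \in edges d N ->
    (omap edge_set o == Some e) = (omap edge_set o' == Some e) :> nat) ->
    o = o'.
  case: o => [a|]; case: o' => [a'|] //= heq.
  - have := heq _ (mem a); rewrite eqxx.
    by case: eqP => // -[/edge_set_inj ->].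
  - by have := heq _ (mem a); rewrite eqxx.
  - by have := heq _ (mem a'); rewrite eqxx.
by apply: sn => e eE; exact: eqr.
Qed.

Lemma run_ring_event delta n (c : n.-tuple (option edge)) w : 0 < delta ->
  eta 0 w =1 eta0 -> driven_by (fun e t => K e t w) (fun t => eta t w) ->
  ring_event delta c w -> eta (n%:R * delta) w =1 run eta0 c.
Proof.
move=> d0 h0 dr h; rewrite -[in run _ _](take_size c) size_tuple.
suff : forall j, (j <= n)%N -> eta (j%:R * delta) w =1 run eta0 (take j c).
  exact.
elim=> [|j IH] jn; first by rewrite mul0r take0.
have t0 : 0 <= j%:R * delta by rewrite mulr_ge0// ltW.
have tt : j%:R * delta < j.+1%:R * delta by rewrite ltr_pM2r// ltr_nat.
have [none one] := dr _ _ t0 tt.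
rewrite (take_nth None) ?size_tuple// /run -cats1 foldl_cat -/(run eta0 _) /=.
have /funext runE := IH (ltnW jn); rewrite -runE.
have := fun e eE => ring_event_incr (j := j) (e := e) h eE jn.
rewrite /ring_at; case: (nth None c j) => [[x i]|] /= hK; last first.
  by apply: none => e eE; rewrite hK// addn0.
rewrite /avg /=; apply: one.
- by apply/existsP; exists i; rewrite eqxx.
- by rewrite (hK (edge_set (x, i))) ?eqxx ?addn1//; apply/edgesP; exists (x, i).
- by move=> e eE ne; rewrite hK// (inj_eq Some_inj) eq_sym (negbTE ne) addn0.
Qed.

Variable Tf : R.
Hypothesis Tf0 : 0 < Tf.

Lemma one_minus_kappa n : (0 < n)%N ->
  let delta := Tf / n%:R in
  let kappa := expR (- delta) ^+ #|{: edge}| * (1 + #|{: edge}|%:R * delta) in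
  0 <= kappa ^+ n <= 1 /\ 1 - kappa ^+ n <= (#|{: edge}|%:R * Tf) ^+ 2 / n%:R.
Proof.
move=> n0 delta kappa; set E := #|{: edge}|.
have nR : 0 < n%:R :> R by rewrite ltr0n.
have d0 : 0 < delta by rewrite divr_gt0.
pose x := E%:R * delta.
have x0 : 0 <= x by rewrite mulr_ge0// ltW.
have kE : kappa = expR (- x) * (1 + x).
  by rewrite /kappa -/E -expRM_natl mulrN.
have k0 : 0 <= kappa by rewrite kE mulr_ge0 ?expR_ge0// addr_ge0.
have k1 : kappa <= 1.
  by rewrite kE expRN mulrC ler_pdivrMr ?expR_gt0// mul1r expR_ge1Dx.
have kx : 1 - x ^+ 2 <= kappa.
  rewrite kE; have := expR_ge1Dx (- x); move: (expR _) => u hu.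
  apply: (@le_trans _ _ ((1 - x) * (1 + x))); first by rewrite le_eqVlt; apply/orP; left; apply/eqP; ring.
  by rewrite ler_wpM2r// addr_ge0.
split; first by rewrite exprn_ge0//= exprn_ile1.
have bern m : 1 - kappa ^+ m <= m%:R * x ^+ 2.
  elim: m => [|m IH]; first by rewrite expr0 subrr mul0r.
  have -> : 1 - kappa ^+ m.+1 = (1 - kappa) + kappa * (1 - kappa ^+ m).
    by rewrite exprS; ring.
  rewrite -natr1 mulrDl mul1r addrC; apply: lerD; last by rewrite lerBlDl -lerBlDr.
  apply: le_trans IH; rewrite ler_piMl// subr_ge0 exprn_ile1//.
apply: (le_trans (bern n)); rewrite /x /delta.
by rewrite le_eqVlt; apply/orP; left; apply/eqP; field; rewrite gt_eqF.
Qed.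

Lemma grid_integral_le n (G : Omega -> R) (H : (T -> R) -> R) (S : R) :
  (0 < n)%N -> measurable_fun setT G -> (forall w, 0 <= G w <= S) ->
  (forall c, 0 <= H (run eta0 c)) ->
  (forall w c, eta Tf w =1 run eta0 c -> G w = H (run eta0 c)) ->
  0 <= iter n (chain (chain_rate (Tf / n%:R))) H eta0 ->
  (\int[P]_w (G w)%:E <= (iter n (chain (chain_rate (Tf / n%:R))) H eta0 +
     S * ((#|{: edge}|%:R * Tf) ^+ 2 / n%:R))%:E)%E.
Proof.
move=> n0 mG GS H0 GH it0; pose delta := Tf / n%:R.
have nR : 0 < n%:R :> R by rewrite ltr0n.
have d0 : 0 < delta by rewrite divr_gt0.
have TE : n%:R * delta = Tf by rewrite mulrC divfK// gt_eqF.
have [/andP[k0 k1] k2] := one_minus_kappa n0; move: k0 k1 k2 => /=.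
set kn := (_ * _) ^+ n => k0 k1 k2.
have sp : \sum_(c : n.-tuple (option edge)) \prod_(o <- c) wgt delta o = kn.
  have := sum_wgt (fun=> 1) n eta0 d0; rewrite chain_cst mulr1 => h; rewrite /kn -h.
  by apply: eq_bigr => c _; rewrite mul1r.
have S0 : 0 <= S by have /andP[] := GS point; exact: le_trans.
apply: le_trans (integral_le_partition (A := fun c => ring_event delta c)
  (p := fun c : n.-tuple (option edge) => \prod_(o <- c) wgt delta o)
  (v := fun c : n.-tuple (option edge) => H (run eta0 c)) (S := S) _ _ _ mG GS _ _) _.
- by move=> c; exact: measurable_ring_event.
- by move=> c; exact: prob_ring_event.
- by move=> c c' w; exact: ring_event_disjoint.
- by move=> c; exact: H0.
- apply: filterS driven => w [h0 dr] c Ac; apply: GH.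
  by rewrite -TE; exact: run_ring_event.
rewrite lee_fin sum_wgt// sp -/kn lerD//; first by rewrite ler_piMl.
by rewrite ler_wpM2l.
Qed.

(** [S] bounds [F] only on configurations reachable by averaging, while [grid_integral_le] asks for
    a bound everywhere. So [F] is first shown to be almost surely at most [S], then replaced by its
    minimum with [S]. *)
Lemma expect_le n (F : (T -> R) -> R) (S : R) :
  (0 < n)%N -> measurable_fun setT (fun w => F (eta Tf w)) ->
  (forall f, 0 <= F f) -> (forall c, F (run eta0 c) <= S) ->
  0 <= iter n (chain (chain_rate (Tf / n%:R))) F eta0 ->
  (\int[P]_w (F (eta Tf w))%:E <= (iter n (chain (chain_rate (Tf / n%:R))) F eta0 +
     S * ((#|{: edge}|%:R * Tf) ^+ 2 / n%:R))%:E)%E.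
Proof.
move=> n0 mF F0 FS it0.
have S0 : 0 <= S by apply: le_trans (FS [::]).
pose Bad := [set w | S < F (eta Tf w)].
have mBad : measurable Bad.
  rewrite [X in measurable X](_ : _ = (fun w => F (eta Tf w)) @^-1` `]S, +oo[).
    by rewrite -[X in measurable X]setTI; exact: mF.
  by apply/seteqP; split => w /=; rewrite in_itv /= andbT.
(* The grid estimate applied to the indicator of [Bad], which vanishes at every reachable
   configuration: the probability is at most C / m for every m. *)
have PBad : P Bad = 0%E.
  apply/eqP; rewrite eq_le measure_ge0 andbT.
  apply/lee_addgt0Pr => e e0; rewrite add0e.
  pose C := (#|{: edge}|%:R * Tf) ^+ 2.
  have C0 : 0 <= C by exact: sqr_ge0.
  pose m := (Num.bound (C / e)).+1.
  have me : C / m%:R <= e.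
    rewrite ler_pdivrMr ?ltr0n// mulrC -ler_pdivrMr//.
    apply: (le_trans (ltW (archi_boundP _))); first by rewrite divr_ge0// ltW.
    by rewrite ler_nat.
  have := @grid_integral_le m (\1_Bad) (fun=> 0) 1 isT _ _ _ _ _.
  rewrite integral_indic// setIT chain_cst add0r mul1r => h.
  apply: le_trans (h _ _ _ _ _) _ => //.
  - by move=> w; rewrite indicE; case: (_ \in _); rewrite /= ?lexx ?ler01.
  - move=> w c wc; rewrite indicE memNset//= /Bad /=.
    by rewrite (funext wc); apply/negP; rewrite -leNgt.
have -> : (\int[P]_w (F (eta Tf w))%:E = \int[P]_w (Num.min (F (eta Tf w)) S)%:E)%E.
  apply: ge0_ae_eq_integral => //=.
  - exact/measurable_EFinP.
  - by apply/measurable_EFinP; exact: measurable_minr.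
  - by move=> w _; rewrite lee_fin.
  - by move=> w _; rewrite lee_fin le_min F0.
  exists Bad; split => // w /=; apply: contra_notP => nb _.
  by congr EFin; apply/esym/min_idPl; rewrite leNgt; apply/negP.
apply: grid_integral_le => //.
- exact: measurable_minr.
- by move=> w; rewrite le_min F0 S0 ge_min lexx orbT.
- by move=> w c wc; rewrite (funext wc); apply/min_idPl.
Qed.

End driven_process.

(** * Convergence of the mean of the chain to the lattice heat kernel *)

Section mean_limit.
Context {R : realType} {d N : nat}.
Hypothesis hN : (1 < N)%N.
Local Notation T := 'rV['Z_N]_d.
Local Notation edge := (T * 'I_d)%type.
Local Notation vol := (@vol R d N).
Local Notation mean := (@mean R d N).
Implicit Types (x : T) (n : nat).

Lemma card_torus : #|{: T}|%:R = N%:R ^+ d :> R.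
Proof. by rewrite card_mx mul1n card_ord Zp_cast// natrX. Qed.

Definition limit_kern (t : R) x : R := vol * \prod_i dkern N t (x 0 i).

Lemma limit_kernE t x : limit_kern t x =
  vol * \sum_(xi : T) expR (- (rate xi * (t * N%:R ^+ 2))) * chi xi x.
Proof.
rewrite /limit_kern; congr (_ * _).
transitivity (\prod_(i < d) \sum_(k : 'Z_N)
    expR (- (freq N k * (t * N%:R ^+ 2))) * ccos N k (x 0 i)).
  apply: eq_bigr => i _.
  by rewrite (sum_Zp hN (fun k => expR (- (freq N k * (t * N%:R ^+ 2))) * ccos N k (x 0 i))).
rewrite -(sum_prod_torus (fun i (k : 'Z_N) => expR (- (freq N k * (t * N%:R ^+ 2))) *
   ccos N k (x 0 i))).
apply: eq_bigr => xi _; rewrite big_split /=; congr (_ * _).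
by rewrite /rate mulr_suml -sumrN expR_sum.
Qed.

Lemma chi_le1 xi x : `|chi xi x| <= 1 :> R.
Proof.
rewrite /chi normr_prod.
apply: (@le_trans _ _ (\prod_(i < d) 1)); last by rewrite big1.
by apply: ler_prod => i _; rewrite normr_ge0 cos_max.
Qed.

Lemma exprB_le (u w : R) n : 0 <= u <= 1 -> 0 <= w <= 1 ->
  `|u ^+ n - w ^+ n| <= n%:R * `|u - w|.
Proof.
move=> /andP[u0 u1] /andP[w0 w1]; elim: n => [|n IH].
  by rewrite subrr normr0 mul0r.
have -> : u ^+ n.+1 - w ^+ n.+1 = u * (u ^+ n - w ^+ n) + (u - w) * w ^+ n.
  by rewrite !exprS; ring.
apply: (le_trans (ler_normD _ _)); rewrite -natr1 [leRHS]mulrDl mul1r.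
apply: lerD; rewrite normrM.
  by apply: le_trans IH; rewrite ler_piMl// ger0_norm.
by rewrite ler_piMr// ger0_norm ?exprn_ge0// exprn_ile1.
Qed.

Lemma expRN_taylor (x : R) : 0 <= x -> `|1 - x - expR (- x)| <= x ^+ 2.
Proof.
move=> x0; rewrite distrC ger0_norm; last by rewrite subr_ge0 expR_ge1Dx.
have : expR (- x) <= (1 + x)^-1.
  by rewrite expRN lef_pV2 ?posrE ?expR_gt0 ?ltr_pwDl// expR_ge1Dx.
have : (1 + x)^-1 <= 1 - x + x ^+ 2.
  rewrite -div1r ler_pdivrMr ?ltr_pwDl//.
  by have := exprn_ge0 3 x0; nra.
lra.
Qed.

(** Two errors are added: (1 - x)^n against exp(- n x), and the missing time Tf - n e, since
    [chain_rate] is at most Tf / n. *)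
Lemma power_expR (e mu Tf : R) n : 0 <= e -> 0 <= mu -> e * mu <= 1 ->
  0 <= Tf -> n%:R * e <= Tf ->
  `|(1 - e * mu) ^+ n - expR (- (mu * Tf))| <=
    n%:R * (e * mu) ^+ 2 + mu * (Tf - n%:R * e).
Proof.
move=> e0 mu0 emu T0 neT.
have em0 : 0 <= e * mu by rewrite mulr_ge0.
have -> : (1 - e * mu) ^+ n - expR (- (mu * Tf)) =
   ((1 - e * mu) ^+ n - expR (- (e * mu)) ^+ n) +
   (expR (- (mu * (n%:R * e))) - expR (- (mu * Tf))).
  have -> : - (mu * (n%:R * e)) = n%:R * (- (e * mu)) by ring.
  by rewrite expRM_natl; ring.
apply: (le_trans (ler_normD _ _)); apply: lerD.
  apply: (le_trans (exprB_le _ _ _)).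
  - by rewrite subr_ge0 emu gerBl.
  - by rewrite expR_ge0 -expR0 ler_expR oppr_le0.
  by rewrite ler_wpM2l// expRN_taylor.
have ne0 : 0 <= mu * (n%:R * e) by rewrite mulr_ge0// mulr_ge0.
apply: (le_trans (expRB_le (z := 0) _ _)) => //; first by rewrite mulr_ge0.
by rewrite oppr0 expR0 mulr1 distrC -mulrBr normrM ger0_norm// ger0_norm// subr_ge0.
Qed.

Definition mean_const (Tf : R) : R :=
  (2 * d%:R) ^+ 2 * Tf ^+ 2 + 2 * d%:R * #|{: edge}|%:R * Tf ^+ 2.

Lemma chain_rate_bounds (Tf : R) n : 0 < Tf -> (0 < n)%N ->
  let e := @chain_rate R d N (Tf / n%:R) in
  [/\ 0 < e, n%:R * e <= Tf, e * #|{: edge}|%:R <= 1 &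
     Tf - n%:R * e <= #|{: edge}|%:R * Tf ^+ 2 / n%:R].
Proof.
move=> T0 n0 e; have nR : 0 < n%:R :> R by rewrite ltr0n.
rewrite /e /chain_rate; set E := #|_|; set D := Tf / n%:R.
have D0 : 0 < D by rewrite divr_gt0.
have ED0 : 0 <= E%:R * D by rewrite mulr_ge0// ltW.
have ED1 : 0 < 1 + E%:R * D by rewrite ltr_pwDl.
have nD : n%:R * (D / (1 + E%:R * D)) = Tf / (1 + E%:R * D).
  by rewrite mulrA [n%:R * D]mulrC divfK// gt_eqF.
rewrite nD; split.
- by rewrite divr_gt0.
- by rewrite ler_pdivrMr// ler_peMr ?(ltW T0)// lerDl.
- by rewrite mulrAC ler_pdivrMr// mul1r mulrC lerDr.
have -> : E%:R * Tf ^+ 2 / n%:R = Tf * (E%:R * D).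
  by rewrite /D; field; rewrite gt_eqF.
rewrite lerBlDr -lerBlDl -[X in X - _]mulr1 -mulrBr ler_wpM2l ?(ltW T0)//.
rewrite -[leRHS]mul1r ler_pdivlMr//.
by move: (E%:R * D) ED0 => u u0; nra.
Qed.

Lemma mean_limit t n x : 0 < t -> (0 < n)%N -> let Tf := t * N%:R ^+ 2 in
  Tf * (4 * d%:R) <= n%:R ->
  `|mean (@chain_rate R d N (Tf / n%:R)) n x - limit_kern t x| <=
    mean_const Tf / n%:R.
Proof.
move=> t0 n0 Tf nT; have nR : 0 < n%:R :> R by rewrite ltr0n.
have T0 : 0 < Tf by rewrite mulr_gt0// exprn_gt0// ltr0n (ltn_trans _ hN).
have /= [] := chain_rate_bounds T0 n0; set e := chain_rate _ => e0 neT _ Tne.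
have eTn : e <= Tf / n%:R by rewrite ler_pdivlMr// mulrC.
rewrite /mean iter_step_origin// limit_kernE -mulrBr normrM ger0_norm; last first.
  exact/ltW/vol_gt0.
rewrite -sumrB; apply: (@le_trans _ _ (vol * \sum_(xi : T) mean_const Tf / n%:R)).
  rewrite ler_wpM2l ?(ltW (vol_gt0 hN))//.
  apply: (le_trans (ler_norm_sum _ _ _)); apply: ler_sum => xi _.
  rewrite -mulrBl normrM (le_trans (ler_piMr _ (chi_le1 _ _)))//.
  have -> : 1 - 2 * (e / 2) * rate xi = 1 - e * rate xi by field.
  have mu0 : 0 <= rate xi :> R by exact: rate_ge0.
  have mud : rate xi <= 2 * d%:R :> R by exact: rate_le.
  have emu : e * rate xi <= 1.
    apply: (@le_trans _ _ (Tf / n%:R * (4 * d%:R))).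
      apply: ler_pM => //; first exact: ltW.
      by apply: (le_trans mud); rewrite ler_wpM2r// ler_nat.
    by rewrite mulrAC ler_pdivrMr// mul1r.
  apply: (le_trans (power_expR (ltW e0) mu0 emu (ltW T0) neT)).
  rewrite /mean_const mulrDl; apply: lerD.
    rewrite exprMn mulrA.
    have -> : (2 * d%:R) ^+ 2 * Tf ^+ 2 / n%:R = n%:R * (Tf / n%:R) ^+ 2 * (2 * d%:R) ^+ 2.
      by field; rewrite gt_eqF.
    apply: ler_pM; [by rewrite mulr_ge0 ?sqr_ge0|exact: sqr_ge0| |].
      by rewrite ler_wpM2l// lerXn2r ?nnegrE ?(ltW e0)// divr_ge0 ?ltW.
    by rewrite lerXn2r ?nnegrE// mulr_ge0.
  have -> : 2 * d%:R * #|{: edge}|%:R * Tf ^+ 2 / n%:R =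
      2 * d%:R * (#|{: edge}|%:R * Tf ^+ 2 / n%:R) by ring.
  by apply: ler_pM => //; rewrite subr_ge0.
rewrite sumr_const -[_ *+ _]mulr_natr card_torus mulrCA /vol mulVf ?mulr1//.
by rewrite expf_neq0// pnatr_eq0 -lt0n (ltn_trans _ hN).
Qed.

End mean_limit.

(** * The variance at diffusive times *)

Section averaging_variance.
Context {R : realType} (d : nat).
Hypothesis hd : (0 < d)%N.
Variables (a b : R).
Hypotheses (a0 : 0 < a).

(** Chosen so that for s = tau N^2 the d + 1 scales of ratio 8 above 2 s end at a N^2 / 2, which the
    time n e of the chain, at least Tf / 2, has reached. *)
Let tau : R := a / (4 * 8 ^+ d.+1).
Let K : R := kern_bound tau ^+ d.

Definition variance_const : R :=
  (K + 8 * (boot_const K d * (1 + tau^-1 ^+ d))) / tau.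

Let tau0 : 0 < tau.
Proof. by rewrite divr_gt0// mulr_gt0// exprn_gt0. Qed.

Let K0 : 0 <= K.
Proof. by rewrite exprn_ge0// (le_trans ler01)// kern_bound_ge1. Qed.

Lemma variance_const_ge0 : 0 <= variance_const.
Proof.
rewrite divr_ge0 ?(ltW tau0)// addr_ge0// mulr_ge0// mulr_ge0 ?boot_const_ge0//.
by rewrite addr_ge0// exprn_ge0// invr_ge0 ltW.
Qed.

Lemma trace_bound N (s : R) : (1 < N)%N -> tau * N%:R ^+ 2 <= s ->
  @trace R d N s <= K * @vol R d N.
Proof.
move=> hN hs; have N0 : 0 < N%:R :> R by rewrite ltr0n (ltn_trans _ hN).
rewrite traceE// /K /vol -exprVn -exprMn.
have s0 : 0 <= \sum_(k < N) expR (- (freq N k * s)) :> R.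
  by apply: sumr_ge0 => k _; exact: expR_ge0.
apply: lerXn2r; rewrite ?nnegrE ?mulr_ge0 ?invr_ge0 ?(ltW N0)//.
  by rewrite (le_trans ler01)// kern_bound_ge1.
rewrite mulrC ler_wpM2r ?invr_ge0 ?(ltW N0)//.
have := dkern_le tau0 0 (lexx tau) (ltnW hN); apply: le_trans.
apply: le_trans (ler_norm _); apply: ler_sum => k _.
by rewrite ccos0 mulr1 ler_expR lerN2 ler_wpM2l// freq_ge0.
Qed.

(** [variance_bound] with J = d and s = tau N^2: s^(-d) is of order N^(-2d), hence at most a
    constant times [vol], and the prefactor 1 / s supplies N^(-2). *)
Lemma chain_variance N n t : (1 < N)%N -> 1 <= tau * N%:R ^+ 2 -> a <= t ->
  let Tf := t * N%:R ^+ 2 in let e := @chain_rate R d N (Tf / n%:R) in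
  (0 < n)%N -> Tf * (4 * d%:R) <= n%:R ->
  #|{: 'rV['Z_N]_d * 'I_d}|%:R * Tf <= n%:R ->
  corr e n (0 : 'rV['Z_N]_d) - \sum_x @mean R d N e n x ^+ 2 <=
  variance_const * @vol R d N / N%:R ^+ 2.
Proof.
move=> hN s1 at_ Tf e n0 n1 n2; have nR : 0 < n%:R :> R by rewrite ltr0n.
have N1 : 1 <= N%:R :> R by rewrite ler1n ltnW.
have N0 : 0 < N%:R :> R by exact: lt_le_trans N1.
have T0 : 0 < Tf by rewrite mulr_gt0 ?exprn_gt0// (lt_le_trans a0).
have /= [] := @chain_rate_bounds R d N Tf n T0 n0; rewrite -/e => e0 neT eE Tne.
have e4d : e * (4 * d%:R) <= 1.
  apply: (@le_trans _ _ (Tf / n%:R * (4 * d%:R))).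
    by rewrite ler_wpM2r ?mulr_ge0// ler_pdivlMr// mulrC.
  by rewrite mulrAC ler_pdivrMr// mul1r.
have neT2 : Tf / 2 <= n%:R * e.
  rewrite /e /chain_rate; set E := #|_|%:R in n2 *.
  have -> : n%:R * (Tf / n%:R / (1 + E * (Tf / n%:R))) = Tf / (1 + E * (Tf / n%:R)).
    by rewrite mulrA [n%:R * _]mulrC divfK// gt_eqF.
  rewrite ler_wpM2l ?(ltW T0)//.
  have h : E * (Tf / n%:R) <= 1 by rewrite mulrA ler_pdivrMr// mul1r.
  have h' : 0 <= E * (Tf / n%:R) by rewrite mulr_ge0// divr_ge0// ltW.
  rewrite lef_pV2 ?posrE ?ltr_pwDl//; move: h; lra.
have hT : 8 ^+ d.+1 * (2 * (tau * N%:R ^+ 2)) <= n%:R * e.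
  apply: le_trans neT2.
  have -> : 8 ^+ d.+1 * (2 * (tau * N%:R ^+ 2)) = a * N%:R ^+ 2 / 2.
    by rewrite /tau; field; rewrite expf_neq0.
  by rewrite ler_wpM2r// ler_wpM2r// sqr_ge0.
have hs u : tau * N%:R ^+ 2 <= u -> trace (d := d) (N := N) u <= K * @vol R d N.
  exact: trace_bound.
apply: (le_trans (variance_bound hN e0 e4d eE hd K0 s1 hs hT)).
set v := @vol R d N; have v0 : 0 < v by exact: vol_gt0.
have hv : (tau * N%:R ^+ 2)^-1 ^+ d <= tau^-1 ^+ d * v.
  rewrite invfM exprMn ler_wpM2l ?exprn_ge0 ?invr_ge0 ?(ltW tau0)//.
  rewrite /v /vol exprVn lef_pV2 ?posrE ?exprn_gt0// -exprM.
  by apply: ler_weXn2l => //; rewrite leq_pmull.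
have -> : variance_const * v / N%:R ^+ 2 =
  (K * v + 8 * (boot_const K d * (v + tau^-1 ^+ d * v))) / (tau * N%:R ^+ 2).
  rewrite /variance_const; move: (boot_const _ _) (tau^-1 ^+ d) => u w.
  by field; rewrite !gt_eqF.
have tN0 : 0 <= (tau * N%:R ^+ 2)^-1.
  by rewrite invr_ge0; apply: mulr_ge0; [exact: ltW|exact: sqr_ge0].
rewrite ler_wpM2r//.
rewrite lerD2l ler_wpM2l// ler_wpM2l ?boot_const_ge0//.
by rewrite lerD2l.
Qed.

End averaging_variance.

Section averaging_l2.
Context {R : realType} {d N : nat}.
Hypotheses (hd : (0 < d)%N) (hN : (2 < N)%N).
Local Notation T := 'rV['Z_N]_d.
Local Notation edge := (T * 'I_d)%type.
Local Notation vol := (@vol R d N).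

Let hN1 : (1 < N)%N := ltnW hN.

Lemma run_bounded (eta : T -> R) (c : seq (option edge)) :
  (forall x, 0 <= eta x <= 1) -> forall x, 0 <= run eta c x <= 1.
Proof.
elim: c eta => [//|o c IH] eta h; apply: IH; case: o => [[y i]|] //= x.
rewrite /avg /average /=; case: ifP => // _.
by have /andP[] := h y; have /andP[] := h (y + unitv i); lra.
Qed.

Lemma sqr_dist_run_le (g : T -> R) (c : seq (option edge)) :
  \sum_x (run (origin : T -> R) c x - g x) ^+ 2 <= \sum_x (1 + `|g x|) ^+ 2.
Proof.
apply: ler_sum => x _.
have /andP[r0 r1] : 0 <= run (origin : T -> R) c x <= 1.
  by apply: run_bounded => y; rewrite /origin; case: (_ == _); rewrite /= ?lexx ?ler01.
rewrite -(ger0_norm (sqr_ge0 _)) normrX lerXn2r ?nnegrE ?addr_ge0//.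
by apply: (le_trans (ler_normB _ _)); rewrite lerD2r ger0_norm.
Qed.

Context dO (Omega : measurableType dO) (P : probability Omega R).
Variable eta : R -> Omega -> T -> R.
Hypothesis etaP : is_averaging_process P (dirac_mass R 0) eta.
Variables (a t : R).
Hypotheses (a0 : 0 < a) (at_ : a <= t)
  (tauN : 1 <= a / (4 * 8 ^+ d.+1) * N%:R ^+ 2).

Lemma averaging_l2 :
  (\int[P]_w (\sum_x (eta (t * N%:R ^+ 2) w x - limit_kern t x) ^+ 2)%:E <=
   (variance_const d a * vol / N%:R ^+ 2)%:E)%E.
Proof.
have [meta [K [Kp Ki Ka]]] := etaP.
have t0 : 0 < t by exact: lt_le_trans at_.
have N0 : 0 < N%:R :> R by rewrite ltr0n (ltn_trans _ hN).
pose Tf := t * N%:R ^+ 2.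
have Tf0 : 0 < Tf by rewrite mulr_gt0// exprn_gt0.
pose F (f : T -> R) := \sum_x (f x - limit_kern t x) ^+ 2.
pose S := \sum_(x : T) (1 + `|limit_kern t x|) ^+ 2.
(* B / n bounds the two errors that vanish with the mesh: the squared bias of the discrete mean
   relative to [limit_kern], and the grid error of [expect_le]. *)
pose B := #|{: T}|%:R * (@mean_const R d N Tf) ^+ 2 + S * (#|{: edge}|%:R * Tf) ^+ 2.
have S0 : 0 <= S by apply: sumr_ge0 => x _; exact: sqr_ge0.
have B0 : 0 <= B by rewrite addr_ge0// mulr_ge0// sqr_ge0.
have mF : measurable_fun setT (fun w => F (eta Tf w)).
  apply: measurable_sum => x; apply: (measurable_funX 2).
  by apply: measurable_funB => //; apply: meta; exact: ltW.
have F0 f : 0 <= F f by apply: sumr_ge0 => x _; exact: sqr_ge0.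
apply/lee_addgt0Pr => e e0.
pose Q := B / e + Tf * (4 * d%:R) + #|{: edge}|%:R * Tf.
have Q1 : 0 <= B / e by rewrite divr_ge0// ltW.
have Q2 : 0 <= Tf * (4 * d%:R) by rewrite mulr_ge0 ?mulr_ge0// ltW.
have Q3 : 0 <= #|{: edge}|%:R * Tf by rewrite mulr_ge0// ltW.
pose n := (Num.bound Q).+1.
have nQ : Q <= n%:R.
  apply: (le_trans (ltW (archi_boundP _))); last by rewrite ler_nat.
  by rewrite /Q !addr_ge0.
have n0 : (0 < n)%N by [].
have nR : 1 <= n%:R :> R by rewrite ler1n.
have nR0 : 0 < n%:R :> R by exact: lt_le_trans nR.
have nT : Tf * (4 * d%:R) <= n%:R by apply: le_trans nQ; rewrite /Q; lra.
have nE : #|{: edge}|%:R * Tf <= n%:R by apply: le_trans nQ; rewrite /Q; lra.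
have nB : B / n%:R <= e.
  rewrite ler_pdivrMr// mulrC -ler_pdivrMr//.
  by apply: le_trans nQ; rewrite /Q; lra.
have /= [ce0 _ ceE _] := @chain_rate_bounds R d N Tf n Tf0 n0.
have it0 : 0 <= iter n (chain (@chain_rate R d N (Tf / n%:R))) F origin.
  by apply: chain_ge0 => //; exact: ltW.
apply: (le_trans (expect_le hN Kp Ki Ka Tf0 n0 mF F0 (S := S) _ it0)).
  by move=> c; exact: sqr_dist_run_le.
rewrite -EFinD lee_fin chain_sqr_dist -addrA; apply: lerD.
  by apply: chain_variance.
apply: le_trans nB; rewrite /B mulrDl; apply: lerD; last by rewrite mulrA.
apply: (@le_trans _ _ (\sum_(x : T) ((@mean_const R d N Tf) ^+ 2 / n%:R))).
  apply: ler_sum => x _.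
  apply: (@le_trans _ _ ((@mean_const R d N Tf / n%:R) ^+ 2)).
    rewrite -(ger0_norm (sqr_ge0 _)) normrX lerXn2r ?nnegrE//.
      rewrite divr_ge0// /mean_const.
      by rewrite addr_ge0 ?[0 <= _ * Tf ^+ 2]mulr_ge0 ?sqr_ge0 ?mulr_ge0.
    exact: mean_limit.
  rewrite exprMn ler_wpM2l ?sqr_ge0// expr2 ler_piMl ?invr_ge0 ?(ltW nR0)//.
  by rewrite invf_le1.
by rewrite sumr_const -[leLHS]mulr_natl mulrA lexx.
Qed.

End averaging_l2.

(** * Integration on the torus *)

Section cells.
Context {R : realType}.
Variable N : nat.
Hypothesis hN : (1 < N)%N.

(** Index modulo N of the interval of length 1 / N containing [v]. The remainder is below N, so the
    default value of [inord] does not occur when 1 < N. *)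
Definition cell (v : R) : 'Z_N :=
  inord `|(Num.floor (N%:R * v) %% N%:Z)%Z|.

Lemma cell_floor v : Num.floor (N%:R * v) =
  (Num.floor (N%:R * v) %/ N%:Z)%Z * N%:Z + (cell v)%:Z.
Proof.
have N0 : N%:Z != 0 by rewrite eqz_nat -lt0n ltnW.
rewrite {1}(divz_eq (Num.floor (N%:R * v)) N%:Z); congr (_ + _).
have h : (0 <= (Num.floor (N%:R * v) %% N%:Z)%Z) by apply: modz_ge0.
rewrite /cell inordK; first by rewrite gez0_abs.
rewrite Zp_cast// -ltz_nat gez0_abs//.
by have := ltz_mod (Num.floor (N%:R * v)) N0.
Qed.

Let NR : 0 < N%:R :> R. Proof. by rewrite ltr0n ltnW. Qed.

Definition shift_itv (k : 'Z_N) (m : int) : set R :=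
  `[(m%:~R * N%:R + k%:R) / N%:R, (m%:~R * N%:R + k%:R + 1) / N%:R[.

Lemma shift_itvP k m v : shift_itv k m v <->
  Num.floor (N%:R * v) = m * N%:Z + (k : nat)%:Z.
Proof.
have -> : shift_itv k m v <->
    (m * N%:Z + (k : nat)%:Z)%:~R <= N%:R * v < (m * N%:Z + (k : nat)%:Z + 1)%:~R.
  rewrite /shift_itv /= in_itv /= ler_pdivrMr// ltr_pdivlMr// [v * _]mulrC.
  by rewrite !(rmorphD, rmorphM) /=.
split => [h|<-]; last exact: floor_itv.
exact: floor_def.
Qed.

Lemma cell_preimage k : [set v | cell v = k] =
  \bigcup_(n : nat) (shift_itv k n%:Z `|` shift_itv k (- n%:Z)).
Proof.
apply/seteqP; split => [v /= <-|v [n _ hv]] /=.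
  have [m hm] : exists m, shift_itv (cell v) m v.
    exists (Num.floor (N%:R * v) %/ N%:Z)%Z; apply/shift_itvP; exact: cell_floor.
  exists `|m|%N => //; have [m0|m0] := leP 0 m; [left|right].
    by rewrite gez0_abs.
  by rewrite ltz0_abs// opprK.
have kN : (k < N)%N by rewrite -[X in (_ < X)%N](Zp_cast hN).
have [m /shift_itvP hm] : exists m, shift_itv k m v.
  by case: hv => hv; [exists n%:Z|exists (- n%:Z)].
rewrite /cell hm modzMDl modz_small ?absz_nat; first by rewrite inord_val.
by rewrite /= ltz_nat.
Qed.

Lemma measurable_cell k : measurable [set v | cell v = k].
Proof.
rewrite cell_preimage; apply: bigcup_measurable => n _.
by apply: measurableU; exact: measurable_itv.
Qed.

Let k_lt (k : 'Z_N) : (k < N)%N. Proof. by rewrite -[X in (_ < X)%N](Zp_cast hN). Qed.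

Lemma cell_unit k v : cell v = k -> 0 <= v <= 1 ->
  k%:R / N%:R <= v < (k%:R + 1) / N%:R \/ v = 1.
Proof.
move=> vk /andP[v0]; rewrite le_eqVlt => /predU1P[->|v1]; [by right|left].
have : shift_itv k (Num.floor (N%:R * v) %/ N%:Z)%Z v.
  by apply/shift_itvP; rewrite -vk; exact: cell_floor.
have -> : (Num.floor (N%:R * v) %/ N%:Z)%Z = 0.
  apply: divz_small; apply/andP; split.
    by rewrite floor_ge0 mulr_ge0// ltW.
  by rewrite floor_lt_int /= gtr_pMr.
by rewrite /shift_itv /= in_itv /= mul0r add0r.
Qed.

(** The fundamental domain is closed, so its endpoint 1 lies in cell 0 although it is not in [0, 1 /
    N[; it only adds a null set. *)
Lemma uniform_cell k :
  uniform_prob (@ltr01 R) [set v | cell v = k] = (N%:R^-1)%:E.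
Proof.
rewrite /uniform_prob integral_uniform_pdf.
rewrite (eq_integral (cst 1%:E)); last first.
  move=> v; rewrite inE /= in_itv /= => -[_ v01].
  by rewrite /uniform_pdf v01 subr0 invr1.
have mA : measurable ([set v : R | cell v = k] `&` `[0, 1]).
  by apply: measurableI; [exact: measurable_cell|exact: measurable_itv].
rewrite integral_cst// mul1e.
have hI : lebesgue_measure (`[k%:R / N%:R, (k%:R + 1) / N%:R[ : set R) = (N%:R^-1)%:E.
  rewrite lebesgue_measure_itv /= lte_fin ltr_pM2r ?invr_gt0// ltrDl ltr01.
  by rewrite -EFinD; congr EFin; field; rewrite gt_eqF.
apply/eqP; rewrite eq_le; apply/andP; split.
  apply: (@le_trans _ _ (lebesgue_measure
     ((`[k%:R / N%:R, (k%:R + 1) / N%:R[ : set R) `|` [set 1]))).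
    apply: le_measure; rewrite ?inE//.
      by apply: measurableU; [exact: measurable_itv|exact: measurable_set1].
    move=> v /= [vk]; rewrite in_itv /= => v01.
    by case: (cell_unit vk v01) => [h|->]; [left; rewrite /= in_itv|right].
  rewrite -hI -[leRHS]adde0 -(lebesgue_measure_set1 (1 : R)).
  by apply: measureU2; [exact: measurable_itv|exact: measurable_set1].
rewrite -hI; apply: le_measure; rewrite ?inE//.
move=> v /=; rewrite in_itv /= => /andP[kv vk]; split; last first.
  rewrite in_itv /=; apply/andP; split.
    by apply: le_trans kv; rewrite divr_ge0// ltW.
  apply: (le_trans (ltW vk)); rewrite ler_pdivrMr// mul1r natr1 ler_nat.
  exact: k_lt.
have /shift_itvP h : shift_itv k 0 v.
  by rewrite /shift_itv /= in_itv /= mul0r add0r kv vk.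
by rewrite /cell h mul0r add0r modz_small ?absz_nat ?inord_val//= ltz_nat k_lt.
Qed.

End cells.

Section torus_cells.
Context {R : realType} {N : nat}.
Hypothesis hN : (1 < N)%N.
Local Notation mu d := (@torus_lebesgue R d).
Local Notation tup d := (d.-tuple (measurableTypeR R)).

Definition cellv d (u : d.-tuple R) : 'rV['Z_N]_d := \row_i cell N (tnth u i).

Lemma cellv_eq d (u : d.-tuple R) x :
  cellv u = x <-> forall i, cell N (tnth u i) = x 0 i.
Proof.
split => [<- i|h]; first by rewrite mxE.
by apply/rowP => i; rewrite mxE.
Qed.

Lemma measurable_cellv d x : measurable [set u : tup d | cellv u = x].
Proof.
have -> : [set u : tup d | cellv u = x] =
    [set u | forall i, [set u : tup d | cell N (tnth u i) = x 0 i] u].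
  by apply/seteqP; split => u /cellv_eq.
apply: measurable_forall_ord => i.
have mt := measurable_tnth (T := measurableTypeR R) (n := d) i.
have := mt measurableT _ (measurable_cell hN (x 0 i)).
by rewrite setTI.
Qed.

Lemma torus_cellv d x : mu d [set u | cellv u = x] = (@vol R d N)%:E.
Proof.
have NR : 0 < N%:R :> R by rewrite ltr0n ltnW.
elim: d x => [|d IH] x.
  rewrite /= diracE /vol expr0 invr1 mem_set//= /cellv.
  by apply/rowP => -[].
rewrite /= /distribution /pushforward.
have -> : @tuple_cons _ (measurableTypeR R) d @^-1` [set u | cellv u = x] =
    [set v | cell N v = x 0 ord0] `*` [set u | cellv u = (\row_i x 0 (lift ord0 i))].
  apply/seteqP; split => [[v u]|[v u]] /=.
    move/cellv_eq => h; split; first by have := h ord0; rewrite tnth0.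
    by apply/cellv_eq => i; have := h (lift ord0 i); rewrite mxE tnthS.
  move=> [hv /cellv_eq hu]; apply/cellv_eq => i.
  case: (unliftP ord0 i) => [j ->|->]; last by rewrite tnth0.
  by rewrite tnthS hu mxE.
rewrite /product_prob product_measure1E; last 2 first.
- exact: measurable_cell.
- exact: measurable_cellv.
transitivity ((N%:R^-1)%:E * (@vol R d N)%:E)%E.
  by congr (_ * _)%E; [exact: uniform_cell|exact: IH].
by rewrite -EFinM /vol exprS invfM.
Qed.

End torus_cells.

Section riemann_sums.
Context {R : realType} {d : nat}.
Local Notation mu := (@torus_lebesgue R d).
Local Notation tup := (d.-tuple (measurableTypeR R)).
Implicit Types (phi : 'rV[R]_d -> R) (u : tup) (N : nat).

Lemma periodic_int phi (m : 'I_d -> int) x : torus_periodic phi ->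
  phi (x + \row_i (m i)%:~R) = phi x.
Proof.
move=> per.
have nat_per i n y : phi (y + basis_vec R i *+ n) = phi y.
  by elim: n y => [|n IH] y; rewrite ?mulr0n ?addr0// mulrS addrA IH per.
have int_per i (k : int) y : phi (y + k%:~R *: basis_vec R i) = phi y.
  case: k => n; first by rewrite -pmulrn scaler_nat nat_per.
  rewrite NegzE mulrNz scaleNr -pmulrn scaler_nat.
  by rewrite -[in RHS](subrK (basis_vec R i *+ n.+1) y) nat_per.
have -> : \row_i (m i)%:~R = \sum_(i <- enum 'I_d) (m i)%:~R *: basis_vec R i.
  rewrite big_enum [LHS]row_sum_delta; apply: eq_bigr => i _.
  by rewrite mxE.
elim: (enum _) x => [|i s IH] x; first by rewrite big_nil addr0.
by rewrite big_cons addrA IH int_per.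
Qed.

Lemma continuous_entries phi (x : 'rV[R]_d) (e : R) : continuous phi -> 0 < e ->
  exists2 delta, 0 < delta &
    forall y : 'rV[R]_d, (forall i, `|x 0 i - y 0 i| < delta) -> `|phi x - phi y| < e.
Proof.
move=> cphi e0; have /cvgrPdist_lt /(_ _ e0) := cphi x.
move=> /nbhs_ballP[delta /= delta0 h]; exists delta => // y xy.
apply: h; rewrite /ball /= /mx_ball; split=> // i j.
by rewrite [i]ord1 /ball /=; exact: xy.
Qed.

Definition lat N (x : 'rV['Z_N]_d) : 'rV[R]_d := \row_i ((x 0 i)%:R / N%:R).

Definition riemann N phi : R := @vol R d N * \sum_(x : 'rV['Z_N]_d) phi (lat x).

(* [v] is a translate of [u] by an integer vector, in the cell of [cellv u]. *)
Lemma lat_cellv N u : (1 < N)%N -> exists2 v : 'rV[R]_d,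
  forall phi, torus_periodic phi -> phi v = phi (row_of_tuple u) &
  forall i, 0 <= v 0 i - lat (cellv u : 'rV['Z_N]_d) 0 i <= N%:R^-1.
Proof.
move=> hN; have N0 : 0 < N%:R :> R by rewrite ltr0n ltnW.
pose m (i : 'I_d) : int := (Num.floor (N%:R * tnth u i : R) %/ N%:Z)%Z.
exists (row_of_tuple u - \row_i (m i)%:~R).
  move=> phi per; rewrite -(periodic_int m (_ - _) per).
  by rewrite subrK.
move=> i; rewrite !mxE.
have := cell_floor hN (tnth u i); rewrite -/(m i) => fl.
have /andP[] := floor_itv (N%:R * tnth u i : R).
rewrite fl !(rmorphD, rmorphM) /= => h1 h2.
have -> : tnth u i - (m i)%:~R - (cell N (tnth u i))%:R / N%:R =
  (N%:R * tnth u i - ((m i)%:~R * N%:R + (cell N (tnth u i))%:R)) / N%:R.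
  by field; rewrite gt_eqF.
rewrite divr_ge0 ?(ltW N0)// ?subr_ge0//= -[leRHS]mul1r ler_wpM2r ?invr_ge0 ?(ltW N0)//.
by rewrite lerBlDl; exact: ltW.
Qed.

Lemma measurable_cellfun N (g : 'rV['Z_N]_d -> R) : (1 < N)%N ->
  measurable_fun setT (fun u => g (cellv u)).
Proof.
move=> hN.
have -> : (fun u => g (cellv u)) =
    (fun u => \sum_x g x * \1_[set u : tup | cellv u = x] u).
  apply/funext => u; rewrite (bigD1 (cellv u)) //= indicE mem_set// mulr1.
  rewrite big1 ?addr0// => x xu; rewrite indicE memNset ?mulr0//= => h.
  by rewrite h eqxx in xu.
apply: measurable_sum => x; apply: measurable_funM => //.
by apply: measurable_indic; exact: (measurable_cellv hN).
Qed.

Lemma integral_cellfun N (g : 'rV['Z_N]_d -> R) : (1 < N)%N ->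
  (\int[mu]_u (g (cellv u))%:E = (@vol R d N * \sum_x g x)%:E)%E.
Proof.
move=> hN.
under eq_integral => u _.
  rewrite (_ : g (cellv u) = \sum_x g x * \1_[set u : tup | cellv u = x] u).
    over.
  rewrite (bigD1 (cellv u)) //= indicE mem_set// mulr1.
  rewrite big1 ?addr0// => x xu; rewrite indicE memNset ?mulr0//= => h.
  by rewrite h eqxx in xu.
rewrite (integral_sum_indic g (@measurable_cellv R N hN d) (@torus_cellv R N hN d)).
by rewrite -mulr_suml mulrC.
Qed.

Variable phi : 'rV[R]_d -> R.
Hypotheses (per : torus_periodic phi) (cphi : continuous phi).

Lemma lat_cellv_cvg u :
  phi (lat (cellv u : 'rV['Z_n.+2]_d)) @[n --> \oo] --> phi (row_of_tuple u).
Proof.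
apply/cvgrPdist_lt => e e0.
have [delta delta0 hd] := continuous_entries (row_of_tuple u) cphi e0.
near=> n.
have [v hv vl] := @lat_cellv n.+2 u isT.
have vE := hv _ per.
have : phi (lat (cellv u : 'rV['Z_n.+2]_d)) =
    phi (row_of_tuple u - (v - lat (cellv u : 'rV['Z_n.+2]_d))).
  (* The integer translation from [u] to [v] is removed by applying periodicity to a translate of
     [phi]: the lattice value becomes the value of [phi] at a point close to [u] itself. *)
  pose psi y := phi (y - (v - lat (cellv u : 'rV['Z_n.+2]_d))).
  have pper : torus_periodic psi by move=> y i; rewrite /psi addrAC per.
  by have := hv _ pper; rewrite /psi => <-; rewrite opprB addrCA subrr addr0.
move=> ->; apply: hd => i; rewrite !mxE opprB addrCA subrr addr0.
have := vl i; rewrite !mxE => /andP[v0 v1].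
rewrite ger0_norm//; apply: (le_lt_trans v1).
near: n; have := near_infty_natSinv_lt (PosNum delta0).
apply: filterS => n /=; apply: le_lt_trans.
by rewrite lef_pV2 ?posrE// ler_nat.
Unshelve. all: by end_near. Qed.

(** Continuity refers to the topology of row vectors and measurability to the product sigma-algebra
    on tuples; the bridge is a pointwise limit of functions constant on cells. *)
Lemma measurable_row : measurable_fun setT (fun u => phi (row_of_tuple u)).
Proof.
apply: (measurable_fun_cvg (h := fun n u => phi (lat (cellv u : 'rV['Z_n.+2]_d)))).
  by move=> n; apply: (@measurable_cellfun n.+2 (fun x => phi (lat x))).
by move=> u _; exact: lat_cellv_cvg.
Qed.

Lemma periodic_bounded : exists2 M, 0 <= M & forall x, `|phi x| <= M.
Proof.
have [M [_ hM]] : bounded_set (phi @` [set v : 'rV[R]_d | forall i, (`[0, 1]%classic : set R) (v ord0 i)]).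
  apply: compact_bounded; apply: continuous_compact.
    exact: continuous_subspaceT.
  by apply: (@rV_compact R d (fun=> `[0, 1]%classic)) => i; exact: segment_compact.
exists (`|M| + 1); first by rewrite addr_ge0.
move=> x; rewrite -(periodic_int (fun i => - Num.floor (x 0 i)) x per).
apply: (hM (`|M| + 1)); first by rewrite (le_lt_trans (ler_norm M))// ltrDl.
exists (x + \row_i (- Num.floor (x 0 i))%:~R) => // i.
rewrite /= in_itv /= !mxE mulrNz; have /andP[h1 h2] := floor_itv (x 0 i).
by rewrite subr_ge0 h1 lerBlDl -(intrD _ (Num.floor _) 1) ltW.
Qed.

Lemma integrable_row : mu.-integrable setT (fun u => (phi (row_of_tuple u))%:E).
Proof.
have [M M0 hM] := periodic_bounded.
apply: (measurable_bounded_integrable (f := fun u => phi (row_of_tuple u))) => //.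
- by rewrite (le_lt_trans (probability_le1 mu measurableT))// ltry.
- exact: measurable_row.
- exists M; split; first exact: num_real.
  by move=> y My u _ /=; apply: le_trans (ltW My).
Qed.

Lemma riemann_cvg : riemann n.+2 phi @[n --> \oo] --> torus_integral phi.
Proof.
have [M M0 hM] := periodic_bounded.
pose f n u := (phi (lat (cellv u : 'rV['Z_n.+2]_d)))%:E.
pose f0 u := (phi (row_of_tuple u))%:E.
have mf n : measurable_fun setT (f n).
  apply/measurable_EFinP.
  by apply: (@measurable_cellfun n.+2 (fun x => phi (lat x))).
have mf0 : measurable_fun setT f0 by apply/measurable_EFinP; exact: measurable_row.
have cf : {ae mu, forall u, setT u -> f n u @[n --> \oo] --> f0 u}.
  by apply: aeW => u _; apply: cvg_EFin; [exact: nearW|exact: lat_cellv_cvg].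
have iM : mu.-integrable setT (cst M%:E : tup -> \bar R).
  by apply: finite_measure_integrable_cst.
have fM : {ae mu, forall u n, setT u -> (`|f n u| <= cst M%:E u)%E}.
  by apply: aeW => u n _; rewrite /f /= lee_fin.
have [_ _ h] := dominated_convergence measurableT mf mf0 cf iM fM.
have f0int : (\int[mu]_u f0 u)%E \is a fin_num.
  exact: (integrable_fin_num measurableT integrable_row).
suff : (riemann n.+2 phi)%:E @[n --> \oo] --> (torus_integral phi)%:E.
  by move/fine_cvg.
rewrite /torus_integral /Rintegral fineK//.
move: h; apply: cvg_trans; apply: near_eq_cvg; near=> n.
by rewrite /f /= (@integral_cellfun n.+2 (fun x => phi (lat x))).
Unshelve. all: by end_near. Qed.

End riemann_sums.

(** * Fourier series of the heat kernel *)

Section trigonometric_products.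
Context {R : realType} {d : nat}.
Implicit Types (w c : 'I_d -> R) (i j : 'I_d) (x : 'rV[R]_d).

Definition trig (A : R) w c x : R := A * \prod_i cos (w i * x 0 i + c i).

Lemma is_derive_line (f : 'rV[R]_d -> R) x v (df : R) :
  is_derive (0 : R) 1 (fun h : R => f (h *: v + x)) df -> is_derive x v f df.
Proof.
move=> [h1 h2]; split; first by apply/derivable1P; exact: h1.
rewrite -h2 /derive.
set g1 := fun h => h^-1 *: _; set g2 := fun h => h^-1 *: _.
suff -> : g1 = g2 by [].
by apply/funext => h; rewrite /g1 /g2 /= addr0 scale0r add0r [_%:A]mulr1.
Qed.

(** Differentiating a cosine shifts its phase by pi / 2, so partial derivatives stay in the family
    [trig] and C^2 regularity needs no further computation. *)
Definition quarter c i : 'I_d -> R := fun j => c j + (j == i)%:R * (pi / 2).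

Lemma is_derive_trig A w c x i :
  is_derive x (basis_vec R i) (trig A w c) (trig (A * w i) w (quarter c i) x).
Proof.
apply: is_derive_line.
pose B := A * \prod_(j | j != i) cos (w j * x 0 j + c j).
have -> : (fun h : R => trig A w c (h *: basis_vec R i + x)) =
    (fun h => B * cos (w i * h + (w i * x 0 i + c i))).
  apply/funext => h; rewrite /trig /B (bigD1 i) //= !mxE !eqxx /= mulr1.
  rewrite [X in cos X](_ : _ = w i * h + (w i * x 0 i + c i)); last by ring.
  rewrite -mulrA [cos _ * _]mulrC; congr (_ * (_ * _)).
  by apply: eq_bigr => j /negbTE ji; rewrite !mxE ji andbF mulr0 add0r.
have -> : trig (A * w i) w (quarter c i) x = B * (w i * - sin (w i * 0 + (w i * x 0 i + c i))).
  rewrite /trig /B (bigD1 i) //= /quarter eqxx mul1r addrA cosDpihalf.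
  rewrite mulr0 add0r.
  have -> : \prod_(j | j != i) cos (w j * x 0 j + (c j + (j == i)%:R * (pi / 2))) =
      \prod_(j | j != i) cos (w j * x 0 j + c j).
    by apply: eq_bigr => j /negbTE ->; rewrite mul0r addr0.
  by ring.
apply: is_derive_eq.
by rewrite /GRing.scale /= !(mulr0, mulr1, addr0, add0r); ring.
Qed.

Lemma continuous_big (V : topologicalType) (I : Type) (op : R -> R -> R) (x0 : R)
    (r : seq I) (f : I -> V -> R) :
  continuous (fun z : R * R => op z.1 z.2) -> (forall k, continuous (f k)) ->
  continuous (fun y : V => \big[op/x0]_(k <- r) f k y).
Proof.
by move=> cop cf y; apply: (cvg_big cop) => k _; exact: cf.
Qed.

Lemma continuous_trig A w c : continuous (trig A w c).
Proof.
move=> x.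
apply: (@continuousM _ _ (cst A) (fun x => \prod_i cos (w i * x 0 i + c i))).
  exact: cst_continuous.
apply: continuous_big => [|i]; first exact: mul_continuous.
move=> y.
apply: (@continuous_comp _ _ _ (fun y : 'rV[R]_d => w i * y 0 i + c i) cos);
  last exact: continuous_cos.
apply: continuousD; last exact: cst_continuous.
apply: (@continuousM _ _ (cst (w i)) (fun y : 'rV[R]_d => y 0 i)).
  exact: cst_continuous.
exact: coord_continuous.
Qed.

Lemma partial_trig A w c i :
  partial i (trig A w c) = trig (A * w i) w (quarter c i).
Proof.
by apply/funext => x; rewrite /partial; case: (is_derive_trig A w c x i).
Qed.

Lemma cosD_int2pi (x : R) (k : int) : cos (x + 2 * pi * k%:~R) = cos x.
Proof.
case: k => n; first by rewrite -pmulrn cosD_natmul2pi.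
rewrite NegzE mulrNz -pmulrn -[LHS](cosD_natmul2pi _ n.+1); congr cos; ring.
Qed.

Variables (m : 'I_d -> int) (v : 'I_d -> R).

Definition freqs i : R := 2 * pi * (m i)%:~R.

Definition mode : 'rV[R]_d -> R := trig 1 freqs (fun i => - freqs i * v i).

Lemma periodic_trig A c : torus_periodic (trig A freqs c).
Proof.
move=> x i; rewrite /trig; congr (_ * _); apply: eq_bigr => j _.
rewrite !mxE eqxx /= mulrDr addrAC.
have [->|_] := eqVneq j i; last by rewrite mulr0 addr0.
by rewrite mulr1 cosD_int2pi.
Qed.

Lemma C2_trig A c : torus_C2 (trig A freqs c).
Proof.
split.
- exact: periodic_trig.
- exact: continuous_trig.
- move=> i; rewrite partial_trig; split; last exact: continuous_trig.
  by move=> x; case: (is_derive_trig A freqs c x i).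
- move=> i j; rewrite !partial_trig; split; last exact: continuous_trig.
  by move=> x; case: (is_derive_trig (A * freqs i) freqs (quarter c i) x j).
Qed.

Lemma quarter2 A w c i x : trig A w (quarter (quarter c i) i) x = - trig A w c x.
Proof.
rewrite /trig (bigD1 i) //= [in RHS](bigD1 i) //= /quarter eqxx mul1r.
have -> : w i * x 0 i + (c i + pi / 2 + pi / 2) = w i * x 0 i + c i + pi by field.
rewrite cosDpi mulNr mulrN; congr (- (_ * (_ * _))).
by apply: eq_bigr => j /negbTE ->; rewrite !mul0r !addr0.
Qed.

Lemma laplacian_trig A c x :
  laplacian (trig A freqs c) x = - (\sum_i freqs i ^+ 2) * trig A freqs c x.
Proof.
rewrite /laplacian mulNr mulr_suml -sumrN; apply: eq_bigr => i _.
by rewrite !partial_trig quarter2 /trig; ring.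
Qed.

End trigonometric_products.

Section heat_kernel_modes.
Context {R : realType} {d : nat}.
Variable h : R -> 'rV[R]_d -> R.
Hypothesis hh : is_heat_kernel h.
Implicit Types (t s : R) (m : 'I_d -> int) (v : 'I_d -> R).

Lemma periodicM (f g : 'rV[R]_d -> R) : torus_periodic f -> torus_periodic g ->
  torus_periodic (fun x => f x * g x).
Proof. by move=> pf pg x i; rewrite pf pg. Qed.

Lemma torus_integralZ (f : 'rV[R]_d -> R) (c : R) : torus_periodic f ->
  continuous f -> torus_integral (fun u => c * f u) = c * torus_integral f.
Proof. by move=> pf cf; apply: RintegralZl => //; exact: integrable_row. Qed.

Lemma eq_torus_integral (f g : 'rV[R]_d -> R) : f =1 g ->
  torus_integral f = torus_integral g.
Proof. by move=> /funext ->. Qed.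

(** With the integrating factor exp(lambda s) the function is constant on positive times; its value
    is identified by the right limit at 0, the only initial information available. *)
Lemma decay_ode (M : R -> R) (lambda A t : R) : 0 < t ->
  (forall s, 0 < s -> is_derive s 1 M (- lambda * M s)) ->
  M s @[s --> 0^'+] --> A -> M t = expR (- (lambda * t)) * A.
Proof.
move=> t0 dM cM.
pose g s := expR (lambda * s) * M s.
have dg s : 0 < s -> is_derive s 1 g 0.
  move=> s0; have dMs := dM s s0.
  by apply: is_derive_eq; rewrite /GRing.scale /=; ring.
have gt s : 0 < s -> s < t -> g s = g t.
  move=> s0 st.
  have cg : {within `[s, t], continuous g}.
    apply: derivable_within_continuous => y; rewrite in_itv /= => /andP[sy _].
    by case: (dg y (lt_le_trans s0 sy)).
  have dg' y : y \in `]s, t[ -> is_derive y 1 g ((fun=> 0) y).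
    by rewrite in_itv /= => /andP[sy _]; apply: dg; exact: lt_trans sy.
  have [c _ /eqP] := MVT st dg' cg.
  by rewrite mul0r subr_eq0 => /eqP.
have cg : g s @[s --> 0^'+] --> A.
  rewrite -[X in _ --> X]mul1r -expR0 -[X in expR X](mulr0 lambda).
  apply: cvgM => //.
  apply: cvg_at_right_filter.
  apply: (@continuous_comp _ _ _ ( *%R lambda) expR); last exact: continuous_expR.
  exact: mulrl_continuous.
have gA : g t = A.
  apply: (cvg_unique _ (_ : g s @[s --> 0^'+] --> g t) cg) => //.
  apply: cvg_near_cst; near=> s; apply: gt.
    by near: s; exact: nbhs_right_gt.
  by near: s; exact: nbhs_right_lt.
rewrite -gA /g mulrA -expRD addNr expR0 mul1r//.
Unshelve. all: by end_near. Qed.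

(** [mode] is an eigenfunction of the Laplacian, so the forward equation tested on it is the scalar
    equation M' = - lambda M, with initial value the mode at 0. *)
Lemma heat_kernel_mode t m v : 0 < t ->
  torus_integral (fun u => h t u * mode m v u) =
  \prod_i hmode t (v i) (m i)%:~R.
Proof.
move=> t0.
have per := periodic_trig m 1 (fun i => - freqs m i * v i).
have cont := @continuous_trig R d 1 (freqs m) (fun i => - freqs m i * v i).
have C2 := C2_trig m 1 (fun i => - freqs m i * v i).
pose lambda : R := 2^-1 * \sum_i freqs m i ^+ 2.
have -> : \prod_i hmode t (v i) (m i)%:~R = expR (- (lambda * t)) * mode m v 0.
  rewrite /hmode big_split /= /mode /trig mul1r; congr (_ * _).
    rewrite -expR_sum /lambda mulr_sumr mulr_suml -sumrN; congr expR.
    by apply: eq_bigr => i _; rewrite /freqs; field.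
  apply: eq_bigr => i _; rewrite mxE mulr0 add0r /freqs mulNr cosN.
  by congr cos; ring.
apply: (decay_ode t0) (heat_kernel_init hh C2) => s s0.
have := heat_kernel_forward hh C2 s0.
congr (is_derive _ _ _ _).
rewrite -torus_integralZ.
- by apply: eq_torus_integral => u; rewrite laplacian_trig /lambda; ring.
- by apply: periodicM => //; exact: heat_kernel_periodic.
- move=> x; apply: continuousM; first exact: (heat_kernel_continuous hh s0).
  exact: cont.
Qed.

End heat_kernel_modes.

(** * Korovkin approximation by Fejer kernels *)

Section fejer_approximation.
Context {R : realType}.

Definition fejer_kernel n (r : R) : R :=
  n%:R^-1 * \sum_(p < n) \sum_(q < n) cos (2 * pi * (p%:R - q%:R) * r).

(** The double sum is the squared modulus of a geometric sum of exponentials, written as a sum of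
    two squares. *)
Lemma fejer_kernel_ge0 n r : 0 <= fejer_kernel n r.
Proof.
rewrite /fejer_kernel mulr_ge0 ?invr_ge0//.
have -> : \sum_(p < n) \sum_(q < n) cos (2 * pi * (p%:R - q%:R) * r) =
    (\sum_(p < n) cos (2 * pi * p%:R * r)) ^+ 2 +
    (\sum_(p < n) sin (2 * pi * p%:R * r)) ^+ 2.
  rewrite !expr2 !mulr_suml -big_split /=; apply: eq_bigr => p _.
  rewrite !mulr_sumr -big_split /=; apply: eq_bigr => q _.
  by rewrite -cosB; congr cos; ring.
by rewrite addr_ge0 ?sqr_ge0.
Qed.

Section lattice_averages.
Variables (N n : nat) (v : R).
Hypotheses (n0 : (0 < n)%N) (nN : (n < N)%N).

Let point (k : nat) : R := k%:R / N%:R - v.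

Let N0 : 0 < N%:R :> R. Proof. by rewrite ltr0n (leq_trans _ nN). Qed.

(** Quadrature at N equally spaced points is exact for frequencies below N, whatever the shift. The
    moments of the Fejer kernel are thus finite sums, with no integral to compute. *)
Lemma avg_cos j : (j < N)%N ->
  N%:R^-1 * \sum_(k < N) cos (2 * pi * j%:R * point k) = (j == 0)%:R.
Proof.
case: j => [|j] jN.
  rewrite (eq_bigr (fun=> 1)); last by move=> k _; rewrite mulr0 mul0r cos0.
  by rewrite sumr_const card_ord mulVf// gt_eqF.
rewrite (eq_bigr (fun k : 'I_N => cos (2 * pi * j.+1%:R / N%:R * k%:R +
   - (2 * pi * j.+1%:R * v)))); last first.
  by move=> k _; congr cos; rewrite /point; ring.
by rewrite sum_cos_phase ?mulr0.
Qed.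

Lemma avg_toeplitz (f : R -> R -> R) : (forall r y, f (- r) y = f r y) ->
  N%:R^-1 * \sum_(k < N) (n%:R^-1 * \sum_(p < n) \sum_(q < n)
     f (p%:R - q%:R) (point k)) =
  n%:R^-1 * (n%:R * (N%:R^-1 * \sum_(k < N) f 0 (point k)) +
    2 * \sum_(1 <= j < n) (n%:R - j%:R) * (N%:R^-1 * \sum_(k < N) f j%:R (point k))).
Proof.
move=> fe; pose g r := N%:R^-1 * \sum_(k < N) f r (point k).
have ge r : g (- r) = g r.
  by rewrite /g; congr (_ * _); apply: eq_bigr => k _; exact: fe.
rewrite -(toeplitz_sum n ge) -mulr_sumr mulrCA; congr (_ * _).
rewrite mulr_sumr.
under eq_bigr => k _ do rewrite mulr_sumr.
rewrite exchange_big /=; apply: eq_bigr => p _.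
under eq_bigr => k _ do rewrite mulr_sumr.
by rewrite exchange_big /=; apply: eq_bigr => q _; rewrite /g mulr_sumr.
Qed.

Lemma avg_fejer : N%:R^-1 * \sum_(k < N) fejer_kernel n (point k) = 1.
Proof.
rewrite (avg_toeplitz (f := fun r y => cos (2 * pi * r * y))); last first.
  by move=> r y; rewrite mulrN mulNr cosN.
have := avg_cos (leq_trans n0 (ltnW nN)) => /= ->.
rewrite big_nat big1 => [|j /andP[j1 jn]].
  by rewrite mulr0 addr0 mulr1 mulVf// pnatr_eq0 -lt0n.
rewrite avg_cos; last exact: ltn_trans nN.
by rewrite (gtn_eqF j1) mulr0.
Qed.

(** Multiplying by the cosine shifts frequencies by one, hence n < N rather than n <= N. Only j = 1
    contributes, with weight (n - 1) / n. *)
Lemma avg_fejer_cos : N%:R^-1 * \sum_(k < N) fejer_kernel n (point k) *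
    cos (2 * pi * point k) = 1 - n%:R^-1.
Proof.
have nR : 0 < n%:R :> R by rewrite ltr0n.
pose f (r y : R) := cos (2 * pi * r * y) * cos (2 * pi * y).
rewrite (eq_bigr (fun k : 'I_N => n%:R^-1 * \sum_(p < n) \sum_(q < n)
    f (p%:R - q%:R) (point k))); last first.
  move=> k _; rewrite /fejer_kernel -[LHS]mulrA mulr_suml; congr (_ * _).
  by apply: eq_bigr => p _; rewrite mulr_suml.
rewrite avg_toeplitz; last by move=> r y; rewrite /f mulrN mulNr cosN.
have fE j : (0 < j)%N -> (j < n)%N ->
    N%:R^-1 * \sum_(k < N) f j%:R (point k) = (j == 1)%:R / 2.
  move=> j0 jn.
  have j1N : (j.+1 < N)%N by exact: leq_ltn_trans nN.
  transitivity ((N%:R^-1 * \sum_(k < N) cos (2 * pi * j.+1%:R * point k) +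
     N%:R^-1 * \sum_(k < N) cos (2 * pi * j.-1%:R * point k)) / 2).
    rewrite -mulrDr -big_split /= -mulrA mulr_suml; congr (_ * _).
    apply: eq_bigr => k _; rewrite /f.
    have -> : 2 * pi * j.+1%:R * point k = 2 * pi * j%:R * point k + 2 * pi * point k.
      by rewrite -natr1; ring.
    have -> : 2 * pi * j.-1%:R * point k = 2 * pi * j%:R * point k - 2 * pi * point k.
      by rewrite -{2}(prednK j0) -natr1; ring.
    by rewrite cosD cosB; field.
  rewrite !avg_cos//; last by rewrite (leq_ltn_trans (leq_pred _))// (ltn_trans jn).
  by rewrite add0r; congr (_%:R / _); case: j j0 {jn j1N} => [//|[|j]].
have f0 : N%:R^-1 * \sum_(k < N) f 0 (point k) = 0.
  rewrite -[RHS](avg_cos (leq_ltn_trans n0 nN)).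
  congr (_ * _); apply: eq_bigr => k _.
  by rewrite /f mulr0 mul0r cos0 mul1r mulr1.
rewrite f0 mulr0 add0r.
have [n1|n1] := leqP n 1.
  have -> : n = 1%N by apply/eqP; rewrite eqn_leq n1.
  by rewrite big_geq// mulr0 mulr0 invr1 subrr.
rewrite big_ltn// fE//= big_nat big1 ?addr0 => [|j /andP[j1 jn]].
  by field; rewrite gt_eqF.
by rewrite fE ?(ltn_trans _ j1)// (gtn_eqF j1) mul0r mulr0.
Qed.

End lattice_averages.

Context {d : nat}.
Implicit Types (v u : 'rV[R]_d) (h : 'rV[R]_d -> R).

Definition fejer_prod n v u : R := \prod_i fejer_kernel n (u 0 i - v 0 i).

(** Near [v] continuity gives [e]. Elsewhere some coordinate is at distance at least delta from that
    of [v] modulo 1, so the sum is bounded below by [c0], while [h] is bounded. *)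
Lemma korovkin_bound h v e : torus_periodic h -> continuous h -> 0 < e ->
  exists2 M, 0 <= M & forall u, `|h v - h u| <= e +
    M * \sum_i (1 - cos (2 * pi * (u 0 i - v 0 i))).
Proof.
move=> per ch e0.
have [delta0 d0 hd] := continuous_entries v ch e0.
(* The cap 1/4 keeps 2 pi delta in [0, pi], where the cosine is decreasing. *)
pose delta := Num.min delta0 (1 / 4).
have dd0 : 0 < delta by rewrite lt_min d0 /=; lra.
have d4 : delta <= 1 / 4 by rewrite ge_min lexx orbT.
have [B B0 hB] := periodic_bounded per ch.
pose c0 : R := 1 - cos (2 * pi * delta).
have p0 := @pi_gt0 R.
have dpi : 0 <= 2 * pi * delta <= pi by apply/andP; split; nra.
have c00 : 0 < c0.
  rewrite subr_gt0 -[ltRHS](@cos0 R) ltr_cos ?in_itv /= ?lexx ?pi_ge0//.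
  by rewrite mulr_gt0// mulr_gt0.
exists (2 * B / c0); first by rewrite divr_ge0// ?mulr_ge0// ltW.
move=> u.
pose k i : int := Num.floor (u 0 i - v 0 i + 1 / 2).
pose w i : R := u 0 i - v 0 i - (k i)%:~R.
have w2 i : `|w i| <= 1 / 2.
  have /andP[] := floor_itv (u 0 i - v 0 i + 1 / 2); rewrite -/(k i) rmorphD /=.
  by rewrite ler_norml /w; move=> h1 h2; apply/andP; split; lra.
have cw i : cos (2 * pi * (u 0 i - v 0 i)) = cos (2 * pi * `|w i|).
  have <- : cos (2 * pi * w i) = cos (2 * pi * `|w i|).
    by rewrite -[LHS]cos_norm normrM ger0_norm// mulr_ge0// pi_ge0.
  by rewrite -[RHS](cosD_int2pi _ (k i)); congr cos; rewrite /w; ring.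
have S0 i : 0 <= 1 - cos (2 * pi * (u 0 i - v 0 i)) by rewrite subr_ge0 cos_le1.
have [small|/existsNP[i /negP]] := pselect (forall i, `|w i| < delta).
  rewrite -[leLHS]addr0; apply: lerD.
    rewrite -(periodic_int (fun i => - k i) u per); apply/ltW/hd => i.
    rewrite !mxE mulrNz opprD addrA -normrN !opprD !opprK.
    rewrite (_ : _ + _ = w i); last by rewrite /w; ring.
    by apply: (lt_le_trans (small i)); rewrite ge_min lexx.
  by rewrite mulr_ge0 ?sumr_ge0// divr_ge0// ?mulr_ge0// ltW.
rewrite -leNgt => wi.
have h1 : c0 <= 1 - cos (2 * pi * (u 0 i - v 0 i)).
  rewrite lerD2l lerN2 cw.
  have [->|wne] := eqVneq `|w i| delta; first exact: lexx.
  apply/ltW; rewrite ltr_cos ?in_itv /=.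
  - by rewrite ltr_pM2l ?mulr_gt0// lt_neqAle eq_sym wne.
  - exact: dpi.
  - by have := w2 i; have := normr_ge0 (w i); move: `|_| p0 => y p0 y0 y2; apply/andP; split; nra.
have h2 : c0 <= \sum_j (1 - cos (2 * pi * (u 0 j - v 0 j))).
  by rewrite (bigD1 i) //= (le_trans h1)// lerDl sumr_ge0.
have h3 : `|h v - h u| <= 2 * B.
  by apply: (le_trans (ler_normB _ _)); rewrite mulr_natl mulr2n lerD.
apply: (le_trans h3); rewrite -[leLHS]add0r; apply: lerD; first exact: ltW.
by rewrite -mulrA ler_peMr ?mulr_ge0// mulrC ler_pdivlMr// mul1r.
Qed.

Lemma riemann_prod N (f : 'I_d -> nat -> R) : (1 < N)%N ->
  @vol R d N * \sum_(x : 'rV['Z_N]_d) \prod_i f i (x 0 i) =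
  \prod_i (N%:R^-1 * \sum_(k < N) f i k).
Proof.
move=> hN; rewrite big_split /= prodr_const card_ord exprVn; congr (_ * _).
rewrite (sum_prod_torus (fun i (k : 'Z_N) => f i k)).
by apply: eq_bigr => i _; rewrite (sum_Zp hN (f i)).
Qed.

Lemma fejer_prod_ge0 n v u : 0 <= fejer_prod n v u.
Proof. by apply: prodr_ge0 => i _; exact: fejer_kernel_ge0. Qed.

Lemma riemann_fejer_prod N n v : (0 < n)%N -> (n < N)%N -> (1 < N)%N ->
  riemann N (fejer_prod n v) = 1.
Proof.
move=> n0 nN hN; rewrite /riemann.
rewrite (eq_bigr (fun x : 'rV['Z_N]_d =>
   \prod_i fejer_kernel n ((x 0 i)%:R / N%:R - v 0 i))); last first.
  by move=> x _; apply: eq_bigr => i _; rewrite mxE.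
rewrite (riemann_prod (fun i k => fejer_kernel n (k%:R / N%:R - v 0 i)) hN).
by rewrite big1// => i _; exact: avg_fejer.
Qed.

Lemma riemann_fejer_moment N n v i : (0 < n)%N -> (n < N)%N -> (1 < N)%N ->
  riemann N (fun u => (1 - cos (2 * pi * (u 0 i - v 0 i))) * fejer_prod n v u) =
  n%:R^-1.
Proof.
move=> n0 nN hN; rewrite /riemann.
pose g (j : 'I_d) (k : nat) : R := fejer_kernel n (k%:R / N%:R - v 0 j) *
   (if j == i then 1 - cos (2 * pi * (k%:R / N%:R - v 0 j)) else 1).
rewrite (eq_bigr (fun x : 'rV['Z_N]_d => \prod_j g j (x 0 j))); last first.
  move=> x _; rewrite [RHS]big_split /= mulrC /fejer_prod; congr (_ * _).
    by apply: eq_bigr => j _; rewrite mxE.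
  rewrite (bigD1 i) //= eqxx big1 ?mulr1; last by move=> j /negbTE ->.
  by rewrite mxE.
rewrite riemann_prod// (bigD1 i) //= [X in _ * X]big1 ?mulr1.
  rewrite /g /= eqxx.
  under eq_bigr => k _ do rewrite mulrBr mulr1.
  by rewrite sumrB mulrBr avg_fejer// avg_fejer_cos//; ring.
move=> j ji; rewrite /g (negbTE ji).
by under eq_bigr => k _ do rewrite mulr1; rewrite avg_fejer.
Qed.

(** The values of [fejer_prod] on the lattice are nonnegative weights of total mass 1, for which
    each 1 - cos has mean exactly 1 / n. The integral is reached afterwards, letting N tend to
    infinity with n fixed. *)
Lemma riemann_korovkin h v e M n N : 0 <= M ->
  (forall u, `|h v - h u| <= e + M * \sum_i (1 - cos (2 * pi * (u 0 i - v 0 i)))) ->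
  (0 < n)%N -> (n < N)%N -> (1 < N)%N ->
  `|h v - riemann N (fun u => h u * fejer_prod n v u)| <= e + M * d%:R / n%:R.
Proof.
move=> M0 hM n0 nN hN.
have rl (c : R) f : riemann N (fun u => c * f u) = c * riemann N f.
  by rewrite /riemann -mulr_sumr mulrCA.
have rD f g : riemann N (fun u => f u + g u) = riemann N f + riemann N g.
  by rewrite /riemann big_split mulrDr.
have -> : h v = riemann N (fun u => h v * fejer_prod n v u).
  by rewrite rl riemann_fejer_prod// mulr1.
rewrite /riemann -mulrBr -sumrB normrM ger0_norm ?(ltW (vol_gt0 hN))//.
apply: (@le_trans _ _ (riemann N (fun u =>
  e * fejer_prod n v u + M * (\sum_i (1 - cos (2 * pi * (u 0 i - v 0 i))) *
     fejer_prod n v u)))).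
  rewrite ler_wpM2l ?(ltW (vol_gt0 hN))//.
  apply: (le_trans (ler_norm_sum _ _ _)); apply: ler_sum => x _.
  rewrite -mulrBl normrM [X in _ * X]ger0_norm ?fejer_prod_ge0//.
  by rewrite -mulr_suml mulrA -mulrDl ler_wpM2r ?fejer_prod_ge0.
rewrite rD !rl riemann_fejer_prod// mulr1 lerD2l -mulrA ler_wpM2l//.
rewrite /riemann exchange_big mulr_sumr /=.
rewrite (eq_bigr (fun=> n%:R^-1)).
  by rewrite sumr_const card_ord -[leLHS]mulr_natl lexx.
by move=> i _; exact: riemann_fejer_moment.
Qed.

End fejer_approximation.

Section heat_kernel_fejer.
Context {R : realType} {d : nat}.
Variable h : R -> 'rV[R]_d -> R.
Hypothesis hh : is_heat_kernel h.

Lemma fejer_prod_modes n (v u : 'rV[R]_d) : fejer_prod n v u =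
  \sum_(g : {ffun 'I_d -> 'I_n * 'I_n}) (n%:R^-1 ^+ d) *
    mode (fun i => ((g i).1 : nat)%:Z - ((g i).2 : nat)%:Z) (fun i => v 0 i) u.
Proof.
rewrite /fejer_prod /fejer_kernel big_split /= prodr_const card_ord -mulr_sumr.
congr (_ * _).
under eq_bigr => i _ do rewrite pair_big /=.
rewrite bigA_distr_bigA /=; apply: eq_bigr => g _.
rewrite /mode /trig mul1r; apply: eq_bigr => i _; congr cos.
by rewrite /freqs rmorphB /=; ring.
Qed.

Lemma periodic_heat_fejer t n (v : 'rV[R]_d) : 0 < t ->
  torus_periodic (fun u => h t u * fejer_prod n v u).
Proof.
move=> t0 x i; rewrite !fejer_prod_modes (heat_kernel_periodic hh t0).
by congr (_ * _); apply: eq_bigr => g _; rewrite [in LHS]/mode periodic_trig.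
Qed.

Lemma continuous_heat_fejer t n (v : 'rV[R]_d) : 0 < t ->
  continuous (fun u => h t u * fejer_prod n v u).
Proof.
move=> t0 x; apply: continuousM; first exact: (heat_kernel_continuous hh t0).
move: x; change (continuous (fejer_prod n v)).
rewrite (funext (fejer_prod_modes n v)); apply: continuous_big => [|g x].
  exact: add_continuous.
apply: (@continuousM _ _ (cst (n%:R^-1 ^+ d)) (mode _ (fun i => v 0 i))).
  exact: cst_continuous.
exact: continuous_trig.
Qed.

Lemma torus_integral_heat_fejer t n (v : 'rV[R]_d) : 0 < t ->
  torus_integral (fun u => h t u * fejer_prod n v u) =
  \prod_i fejer n t (v 0 i).
Proof.
move=> t0.
pose md (g : {ffun 'I_d -> 'I_n * 'I_n}) :=
  @mode R d (fun i => ((g i).1 : nat)%:Z - ((g i).2 : nat)%:Z) (fun i => v 0 i).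
have per g : torus_periodic (fun u => h t u * md g u).
  by apply: periodicM; [exact: heat_kernel_periodic|exact: periodic_trig].
have cont g : continuous (fun u => h t u * md g u).
  move=> x; apply: continuousM; first exact: (heat_kernel_continuous hh t0).
  exact: continuous_trig.
have int g : (@torus_lebesgue R d).-integrable setT
    (fun u => (n%:R^-1 ^+ d * (h t (row_of_tuple u) * md g (row_of_tuple u)))%:E).
  under eq_fun do rewrite EFinM.
  by apply: integrableZl => //; exact: (integrable_row (per g) (@cont g)).
have -> : torus_integral (fun u => h t u * fejer_prod n v u) =
    \sum_g n%:R^-1 ^+ d * torus_integral (fun u => h t u * md g u).
  rewrite /torus_integral /Rintegral.
  under eq_integral => u _.
    rewrite fejer_prod_modes mulr_sumr.
    under eq_bigr => g _ do rewrite mulrCA -/(md g).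
    rewrite -sumEFin; over.
  rewrite integral_sum//= -sum_fine; last first.
    by move=> g _; exact: (integrable_fin_num measurableT (int g)).
  apply: eq_bigr => g _.
  exact: (torus_integralZ (n%:R^-1 ^+ d) (per g) (@cont g)).
have mdE g : torus_integral (fun u => h t u * md g u) =
    \prod_i hmode t (v 0 i) (((g i).1 : nat)%:Z - ((g i).2 : nat)%:Z)%:~R.
  exact: (heat_kernel_mode hh _ (fun i => v 0 i) t0).
under [LHS]eq_bigr => g _ do rewrite mdE.
rewrite /fejer big_split /= prodr_const card_ord -mulr_sumr; congr (_ * _).
under [RHS]eq_bigr => i _ do rewrite pair_big /=.
rewrite bigA_distr_bigA /=; apply: eq_bigr => g _; apply: eq_bigr => i _.
by rewrite rmorphB.
Qed.

(** The clause on 1 / n serves [dkern_heat], where the comparison with the lattice kernel leaves an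
    error proportional to 1 / n. *)
Lemma heat_kernel_fejer t (v : 'rV[R]_d) e : 0 < t -> 0 < e ->
  exists2 n, (0 < n)%N & n%:R^-1 <= e /\
    `|h t v - \prod_i fejer n t (v 0 i)| <= e.
Proof.
move=> t0 e0.
have per := heat_kernel_periodic hh t0; have cont := heat_kernel_continuous hh t0.
have e20 : 0 < e / 2 by rewrite divr_gt0.
have [M M0 hM] := korovkin_bound v per cont e20.
pose n := (Num.bound (2 * (M * d%:R) / e + e^-1)).+1.
have n0 : (0 < n)%N by [].
have nR : 0 < n%:R :> R by [].
have h1 : 0 <= 2 * (M * d%:R) / e by rewrite !mulr_ge0// invr_ge0 ltW.
have h2 : 0 <= e^-1 by rewrite invr_ge0 ltW.
have nb : 2 * (M * d%:R) / e + e^-1 <= n%:R.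
  by apply: (le_trans (ltW (archi_boundP _))); rewrite ?addr_ge0// ler_nat.
exists n => //; split.
  rewrite -[leRHS]invrK lef_pV2 ?posrE ?invr_gt0//.
  by apply: le_trans nb; rewrite lerDr.
have Mn : M * d%:R / n%:R <= e / 2.
  have : 2 * (M * d%:R) / e <= n%:R by apply: le_trans nb; rewrite lerDl.
  rewrite ler_pdivrMr// ler_pdivrMr// => h'.
  have -> : e / 2 * n%:R = (n%:R * e) / 2 by ring.
  by rewrite ler_pdivlMr// mulrC.
rewrite -torus_integral_heat_fejer//.
have rc := riemann_cvg (@periodic_heat_fejer t n v t0)
  (@continuous_heat_fejer t n v t0).
have : `|h t v - riemann N.+2 (fun u => h t u * fejer_prod n v u)| @[N --> \oo]
   --> `|h t v - torus_integral (fun u => h t u * fejer_prod n v u)|.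
  by apply: cvg_norm; apply: cvgB => //; exact: cvg_cst.
move/cvgr_to_le; apply; near=> N.
apply: (@le_trans _ _ (e / 2 + M * d%:R / n%:R)); last by move: Mn; lra.
apply: riemann_korovkin => //; near: N; exists n => // N /= nN.
by rewrite ltnS (leq_trans nN).
Unshelve. all: by end_near. Qed.

End heat_kernel_fejer.

(** * Coupling on the product space *)

Section Lnorm_square.
Context dO (Omega : measurableType dO) (R : realType) (Q : probability Omega R).
Variables (Z : Omega -> R) (p r : R).
Hypotheses (mZ : measurable_fun setT Z) (p12 : 1 <= p <= 2) (r0 : 0 < r).

Lemma powR_le_sqr (y : R) : 0 <= y -> y `^ p <= 1 + y ^+ 2.
Proof.
move=> y0; have /andP[p1 p2] := p12.
have [y1|y1] := leP y 1.
  apply: (@le_trans _ _ 1); last by rewrite lerDl sqr_ge0.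
  have e1 : 1 `^ p = 1 :> R by rewrite powR1.
  by rewrite -[leRHS]e1; apply: ge0_ler_powR; rewrite ?nnegrE// (le_trans _ p1).
rewrite -[y ^+ 2]powR_mulrn//; apply: (@le_trans _ _ (y `^ 2)).
  by rewrite ler_powR// ltW.
by rewrite lerDr.
Qed.

(** [powR_le_sqr] applied to |Z| / r bounds the p-th moment by 2 r^p, at most (2 r)^p since p >= 1.
    This makes the constant of the theorem independent of p. *)
Lemma Lnorm_le_sqr : (\int[Q]_w (Z w ^+ 2)%:E <= (r ^+ 2)%:E)%E ->
  (Lnorm Q p%:E (EFin \o Z) <= (2 * r)%:E)%E.
Proof.
move=> hZ; have /andP[p1 p2] := p12.
have p0 : 0 < p by exact: lt_le_trans p1.
rewrite unlock.
have -> : (2 * r)%:E = (((2 * r) `^ p)%:E `^ p^-1)%E.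
  rewrite poweR_EFin -powRrM mulfV ?gt_eqF// powRr1//.
  by rewrite mulr_ge0// ltW.
have int0 : (0 <= \int[Q]_w (`|(EFin \o Z) w| `^ p))%E.
  by apply: integral_ge0 => w _; exact: poweR_ge0.
apply: gt0_ler_poweR.
- by rewrite invr_ge0 ltW.
- by rewrite in_itv /= int0 leey.
- by rewrite in_itv /= lee_fin powR_ge0 leey.
have mp : measurable_fun setT (fun w => `|Z w| `^ p).
  by apply: (measurableT_comp (measurable_powR p)); exact: measurableT_comp.
apply: (@le_trans _ _ (\int[Q]_w (r `^ p + r `^ p / r ^+ 2 * Z w ^+ 2)%:E)%E).
  apply: ge0_le_integral => //=.
  - by apply/measurable_EFinP.
  - apply/measurable_EFinP; apply: measurable_funD => //.
    by apply: measurable_funM => //; exact: measurable_funX.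
  - move=> w _; rewrite lee_fin.
    have -> : `|Z w| `^ p = r `^ p * (`|Z w| / r) `^ p.
      rewrite -powRM ?divr_ge0 ?(ltW r0)//; congr (_ `^ p).
      by rewrite mulrC divfK// gt_eqF.
    have -> : r `^ p + r `^ p / r ^+ 2 * Z w ^+ 2 = r `^ p * (1 + (`|Z w| / r) ^+ 2).
      by rewrite exprMn real_normK ?num_real// exprVn; ring.
    by rewrite ler_wpM2l ?powR_ge0// powR_le_sqr// divr_ge0// ltW.
under eq_integral do rewrite EFinD.
rewrite ge0_integralD//=; last 3 first.
- by move=> w _; rewrite lee_fin powR_ge0.
- by move=> w _; rewrite lee_fin mulr_ge0 ?sqr_ge0// divr_ge0 ?powR_ge0 ?sqr_ge0.
- apply/measurable_EFinP; apply: measurable_funM => //.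
  exact: measurable_funX.
rewrite integral_cst//.
have -> : ((r `^ p)%:E * Q setT = (r `^ p)%:E)%E.
  by rewrite -[RHS]mule1; congr (_ * _)%E; exact: probability_setT.
under eq_integral do rewrite EFinM.
rewrite ge0_integralZl//=; last 3 first.
- by apply/measurable_EFinP; exact: measurable_funX.
- by move=> w _; rewrite lee_fin sqr_ge0.
- by rewrite lee_fin divr_ge0 ?powR_ge0 ?sqr_ge0.
apply: (@le_trans _ _ ((r `^ p)%:E + (r `^ p / r ^+ 2)%:E * (r ^+ 2)%:E)%E).
  apply: leeD => //; apply: lee_wpmul2l => //.
  by rewrite lee_fin divr_ge0 ?powR_ge0 ?sqr_ge0.
rewrite -EFinM -EFinD lee_fin divfK ?gt_eqF ?exprn_gt0//.
rewrite powRM ?(ltW r0)//.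
have -> : r `^ p + r `^ p = 2 * r `^ p by ring.
rewrite ler_wpM2r ?powR_ge0//.
by rewrite -[leLHS](@powRr1 R 2)// ler_powR// ler1n.
Qed.

End Lnorm_square.

Section kernel_limit.
Context {R : realType} {d : nat}.
Variables (a b : R) (h : R -> 'rV[R]_d -> R).
Hypotheses (a0 : 0 < a) (ab : a <= b) (hh : is_heat_kernel h).

Definition heat_const : R := d%:R * kern_bound a ^+ d * (4 * mode_const a b).

Lemma heat_const_ge0 : 0 <= heat_const.
Proof.
rewrite /heat_const mulr_ge0//; last by rewrite mulr_ge0// mode_const_ge0.
by rewrite mulr_ge0// exprn_ge0// (le_trans ler01)// kern_bound_ge1.
Qed.

(** The Cesaro mean is only an intermediary: the constants do not depend on its order n, so its
    errors are made smaller than any [e] and just the 1 / N part survives. *)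
Lemma dkern_heat N t (x : 'rV['Z_N]_d) (v : 'rV[R]_d) : (0 < N)%N -> a <= t <= b ->
  (forall i, `|v 0 i - (x 0 i)%:R / N%:R| <= N%:R^-1) ->
  `|\prod_i dkern N t (x 0 i) - h t v| <= heat_const / N%:R.
Proof.
move=> N0 tab vx; have /andP[at_ tb] := tab.
have t0 : 0 < t by exact: lt_le_trans at_.
have H0 := heat_const_ge0.
have H1 : 0 < heat_const + 1 by rewrite ltr_wpDl.
apply/ler_addgt0Pr => e e0.
have e10 : 0 < e / (heat_const + 1) by rewrite divr_gt0.
have [n n0 [ne hn]] := heat_kernel_fejer hh v t0 e10.
have hp : `|\prod_i dkern N t (x 0 i) - \prod_i fejer n t (v 0 i)| <=
    d%:R * kern_bound a ^+ d * (4 * mode_const a b * (N%:R^-1 + n%:R^-1)).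
  apply: prod_diff_le.
  - exact: kern_bound_ge1.
  - rewrite mulr_ge0 ?addr_ge0 ?invr_ge0//.
    by rewrite mulr_ge0// mode_const_ge0.
  - by move=> i; apply: dkern_le.
  - by move=> i; apply: fejer_le.
  - by move=> i; apply: dkern_fejer.
have -> : \prod_i dkern N t (x 0 i) - h t v =
    (\prod_i dkern N t (x 0 i) - \prod_i fejer n t (v 0 i)) -
    (h t v - \prod_i fejer n t (v 0 i)) by ring.
apply: (le_trans (ler_normB _ _)); apply: (le_trans (lerD hp hn)).
have -> : d%:R * kern_bound a ^+ d * (4 * mode_const a b * (N%:R^-1 + n%:R^-1)) =
    heat_const / N%:R + heat_const * n%:R^-1 by rewrite /heat_const; ring.
rewrite -addrA lerD2l.
apply: (@le_trans _ _ ((heat_const + 1) * (e / (heat_const + 1)))).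
  by rewrite mulrDl mul1r lerD2r ler_wpM2l.
by rewrite mulrC divfK// gt_eqF.
Qed.

End kernel_limit.

Section coupling.
Context {R : realType} {d N : nat}.
Hypotheses (hd : (0 < d)%N) (hN : (2 < N)%N).
Local Notation T := 'rV['Z_N]_d.
Local Notation mu := (@torus_lebesgue R d).
Local Notation tup := (d.-tuple (measurableTypeR R)).
Context dO (Omega : measurableType dO) (P : probability Omega R).
Variables (eta : R -> Omega -> T -> R) (a b t : R) (h : R -> 'rV[R]_d -> R).
Hypotheses (etaP : is_averaging_process P (dirac_mass R 0) eta)
  (a0 : 0 < a) (tab : a <= t <= b) (hh : is_heat_kernel h)
  (tauN : 1 <= a / (4 * 8 ^+ d.+1) * N%:R ^+ 2).

Let hN1 : (1 < N)%N := ltnW hN.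
Let NR : 0 < N%:R :> R. Proof. by rewrite ltr0n ltnW. Qed.
Let at_ : a <= t. Proof. by have /andP[] := tab. Qed.
Let ab : a <= b. Proof. by have /andP[h1 h2] := tab; exact: le_trans h2. Qed.
Let t0 : 0 < t. Proof. exact: lt_le_trans at_. Qed.

Definition scaled (w : Omega) (x : T) : R := eta (t * N%:R ^+ 2) w x / unif R x.

(** The cell of a uniform point is uniform on the discrete torus, so the norm of this function on
    the product space is the expected discrete norm, and both norms of the theorem live on one
    space. *)
Definition particle_field (z : Omega * tup) : R := scaled z.1 (cellv z.2) - 1.
Definition heat_field (z : Omega * tup) : R := h t (row_of_tuple z.2) - 1.

Let meta x : measurable_fun setT (fun w => scaled w x).
Proof.
have [m _] := etaP; apply: measurable_funM => //; apply: m.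
by rewrite mulr_ge0 ?sqr_ge0// ltW.
Qed.

Let mheat : measurable_fun setT (fun u : tup => h t (row_of_tuple u)).
Proof. exact: measurable_row (heat_kernel_periodic hh t0) (heat_kernel_continuous hh t0). Qed.

Lemma measurable_particle_field : measurable_fun setT particle_field.
Proof.
apply: measurable_funB => //.
have -> : (fun z : Omega * tup => scaled z.1 (cellv z.2)) =
    (fun z => \sum_x scaled z.1 x * \1_[set u : tup | cellv u = x] z.2).
  apply/funext => z; rewrite (bigD1 (cellv z.2)) //= indicE mem_set// mulr1.
  rewrite big1 ?addr0// => x xu; rewrite indicE memNset ?mulr0//= => e.
  by rewrite e eqxx in xu.
apply: measurable_sum => x; apply: measurable_funM.
  exact: (measurableT_comp (meta x) measurable_fst).
apply: (measurableT_comp _ measurable_snd).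
by apply: measurable_indic; exact: (measurable_cellv hN1).
Qed.

Lemma measurable_heat_field : measurable_fun setT heat_field.
Proof.
by apply: measurable_funB => //; exact: (measurableT_comp mheat measurable_snd).
Qed.

(** The factors 2 come from (A + B)^2 <= 2 A^2 + 2 B^2. The added 1 makes the constant at least 1,
    hence at most its own square, so no square root is needed. *)
Definition coupling_const : R :=
  1 + 2 * variance_const d a + 2 * heat_const (d := d) a b ^+ 2.

Lemma coupling_const_ge1 : 1 <= coupling_const.
Proof.
rewrite /coupling_const -addrA lerDl addr_ge0// mulr_ge0 ?sqr_ge0//.
exact: variance_const_ge0.
Qed.

Lemma field_diff_le z : (particle_field z - heat_field z) ^+ 2 <=
  2 * ((N%:R ^+ d) ^+ 2 * (eta (t * N%:R ^+ 2) z.1 (cellv z.2) -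
      @limit_kern R d N t (cellv z.2)) ^+ 2) +
  2 * (heat_const (d := d) a b / N%:R) ^+ 2.
Proof.
have [v hv vl] := lat_cellv z.2 hN1.
have Nd : N%:R ^+ d != 0 :> R by rewrite expf_neq0// gt_eqF.
have -> : particle_field z - heat_field z =
    N%:R ^+ d * (eta (t * N%:R ^+ 2) z.1 (cellv z.2) - @limit_kern R d N t (cellv z.2)) +
    (\prod_i dkern N t ((cellv z.2 : T) 0 i) - h t v).
  rewrite /particle_field /heat_field /scaled /unif invrK /limit_kern /vol.
  rewrite (hv _ (heat_kernel_periodic hh t0)).
  by field.
set A := N%:R ^+ d * _; set B := _ - h t v.
have hB : `|B| <= heat_const (d := d) a b / N%:R.
  apply: dkern_heat => //; first exact: ltnW.
  move=> i; have := vl i; rewrite mxE => /andP[h1 h2].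
  by rewrite ger0_norm.
have hB2 : B ^+ 2 <= (heat_const (d := d) a b / N%:R) ^+ 2.
  rewrite -[B ^+ 2]ger0_norm ?sqr_ge0// normrX lerXn2r ?nnegrE//.
  by apply: le_trans hB.
have -> : (N%:R ^+ d) ^+ 2 * (eta (t * N%:R ^+ 2) z.1 (cellv z.2) -
    @limit_kern R d N t (cellv z.2)) ^+ 2 = A ^+ 2 by rewrite /A exprMn.
by have := sqr_ge0 (A - B); move: hB2; nra.
Qed.

Lemma integral_field_diff :
  (\int[product_prob P mu]_z ((particle_field z - heat_field z) ^+ 2)%:E <=
   ((coupling_const / N%:R) ^+ 2)%:E)%E.
Proof.
pose V := eta (t * N%:R ^+ 2).
pose H := heat_const (d := d) a b / N%:R.
have Nd : 0 < N%:R ^+ d :> R by rewrite exprn_gt0.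
have mZ : measurable_fun setT (fun z => ((particle_field z - heat_field z) ^+ 2)%:E).
  apply/measurable_EFinP; apply: measurable_funX; apply: measurable_funB.
    exact: measurable_particle_field.
  exact: measurable_heat_field.
rewrite /product_prob fubini_tonelli1//; last first.
  by move=> z; rewrite lee_fin sqr_ge0.
have mV : measurable_fun setT (fun w => \sum_x (V w x - @limit_kern R d N t x) ^+ 2).
  apply: measurable_sum => x; apply: (measurable_funX 2).
  apply: measurable_funB => //; have [m _] := etaP; apply: m.
  by rewrite mulr_ge0 ?sqr_ge0// ltW.
apply: (@le_trans _ _ (\int[P]_w ((2 * N%:R ^+ d) *
    (\sum_x (V w x - @limit_kern R d N t x) ^+ 2) + 2 * H ^+ 2)%:E)%E).
  apply: ge0_le_integral => //=.
  - by move=> w _; apply: integral_ge0 => u _; rewrite lee_fin sqr_ge0.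
  - by apply: measurable_fun_fubini_tonelli_F => // z; rewrite lee_fin sqr_ge0.
  - apply/measurable_EFinP; apply: measurable_funD => //.
    exact: measurable_funM.
  - move=> w _; rewrite /fubini_F.
    pose g x := 2 * ((N%:R ^+ d) ^+ 2 * (V w x - @limit_kern R d N t x) ^+ 2) + 2 * H ^+ 2.
    apply: (@le_trans _ _ (\int[mu]_u (g (cellv u))%:E)%E).
      apply: ge0_le_integral => //=.
      + by move=> u _; rewrite lee_fin sqr_ge0.
      + exact: (measurableT_comp mZ (pair1_measurable w)).
      + by apply/measurable_EFinP; exact: measurable_cellfun.
      + by move=> u _; rewrite lee_fin; exact: (field_diff_le (w, u)).
    rewrite integral_cellfun// lee_fin /g big_split /=.
    have -> : \sum_(x : T) 2 * H ^+ 2 = N%:R ^+ d * (2 * H ^+ 2).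
      by rewrite sumr_const -[LHS]mulr_natl (card_torus hN1).
    rewrite mulrDr -!mulr_sumr.
    rewrite /vol mulKf ?gt_eqF// lerD2r.
    rewrite le_eqVlt; apply/orP; left; apply/eqP.
    by field; rewrite gt_eqF.
under eq_integral do rewrite EFinD EFinM.
have S0 w : 0 <= \sum_x (V w x - @limit_kern R d N t x) ^+ 2.
  by apply: sumr_ge0 => x _; exact: sqr_ge0.
rewrite ge0_integralD//=; last 3 first.
- by move=> w _; rewrite lee_fin mulr_ge0// mulr_ge0// ltW.
- by apply/measurable_EFinP; apply: measurable_funM.
- by move=> w _; rewrite lee_fin mulr_ge0// sqr_ge0.
rewrite integral_cst//.
have -> : ((2 * H ^+ 2)%:E * P setT = (2 * H ^+ 2)%:E)%E.
  by rewrite -[RHS]mule1; congr (_ * _)%E; exact: probability_setT.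
rewrite ge0_integralZl//=; last 2 first.
- exact/measurable_EFinP.
- by move=> w _; rewrite lee_fin.
apply: (@le_trans _ _ ((2 * N%:R ^+ d)%:E *
    (variance_const d a * @vol R d N / N%:R ^+ 2)%:E + (2 * H ^+ 2)%:E)%E).
  apply: leeD => //; apply: lee_wpmul2l; first by rewrite lee_fin mulr_ge0// ltW.
  exact: averaging_l2.
rewrite -EFinM -EFinD lee_fin.
have -> : 2 * N%:R ^+ d * (variance_const d a * @vol R d N / N%:R ^+ 2) + 2 * H ^+ 2 =
    (coupling_const - 1) / N%:R ^+ 2.
  rewrite /coupling_const /vol /H; move: (heat_const _ _) (variance_const _ _) => u w.
  by field; rewrite !gt_eqF.
rewrite exprMn exprVn ler_wpM2r ?invr_ge0 ?sqr_ge0//.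
by have := coupling_const_ge1; move: coupling_const => c; nra.
Qed.

Variable p : R.
Hypothesis p12 : 1 <= p <= 2.

Let p1 : 1 <= p. Proof. by have /andP[] := p12. Qed.
Let p0 : 0 < p. Proof. exact: lt_le_trans p1. Qed.

Lemma Lnorm_particle_field :
  ('E_P[fun w => (dnorm p (fun x => scaled w x - 1) `^ p)%R] `^ p^-1)%E =
  Lnorm (product_prob P mu) p%:E (EFin \o particle_field).
Proof.
rewrite [in RHS]unlock; congr (_ `^ _)%E.
rewrite /product_prob fubini_tonelli1; last 2 first.
- apply: (measurableT_comp (f := fun y : R => (`|y|%:E `^ p)%E)).
    apply/measurable_EFinP.
    by apply: (measurableT_comp (measurable_powR p)).
  exact: measurable_particle_field.
- by move=> z; exact: poweR_ge0.
rewrite unlock; apply: eq_integral => w _; rewrite /fubini_F /=.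
have -> : dnorm p (fun x => scaled w x - 1) `^ p =
    @vol R d N * \sum_x `|scaled w x - 1| `^ p.
  rewrite /dnorm -powRrM mulVf ?gt_eqF// powRr1.
    by rewrite mulr_sumr.
  by apply: sumr_ge0 => x _; rewrite mulr_ge0 ?powR_ge0// invr_ge0 exprn_ge0.
by rewrite -(integral_cellfun (fun x => `|scaled w x - 1| `^ p) hN1).
Qed.

Lemma Lnorm_heat_field :
  torus_norm p (fun u => h t u - 1) =
  Lnorm (product_prob P mu) p%:E (EFin \o heat_field).
Proof.
rewrite /torus_norm unlock; congr (_ `^ _)%E.
rewrite /product_prob fubini_tonelli1; last 2 first.
- apply: (measurableT_comp (f := fun y : R => (`|y|%:E `^ p)%E)).
    apply/measurable_EFinP.
    by apply: (measurableT_comp (measurable_powR p)).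
  exact: measurable_heat_field.
- by move=> z; exact: poweR_ge0.
rewrite -[RHS]/(\int[P]_w (cst (\int[mu]_u (`|(h t (row_of_tuple u) - 1)%:E| `^ p)) w))%E.
rewrite integral_cst//.
rewrite -[LHS]mule1; congr (_ * _)%E; apply/esym; exact: probability_setT.
Qed.

(** Excludes the indeterminate difference of infinities in [coupling_bound]; Minkowski's inequality
    then makes the other norm finite as well. *)
Lemma Lnorm_heat_field_lty :
  (Lnorm (product_prob P mu) p%:E (EFin \o heat_field) < +oo)%E.
Proof.
have [M M0 hM] := periodic_bounded (heat_kernel_periodic hh t0)
  (heat_kernel_continuous hh t0).
have M1 : 0 < M + 1 by rewrite ltr_wpDl.
apply: (@le_lt_trans _ _ (2 * (M + 1))%:E); last by rewrite ltry.
apply: Lnorm_le_sqr => //; first exact: measurable_heat_field.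
apply: (@le_trans _ _ (\int[product_prob P mu]_z (cst ((M + 1) ^+ 2)%:E z))%E).
  apply: ge0_le_integral => //=.
  - by move=> z _; rewrite lee_fin sqr_ge0.
  - by apply/measurable_EFinP; apply: measurable_funX; exact: measurable_heat_field.
  - move=> z _; rewrite lee_fin -[leLHS]ger0_norm ?sqr_ge0// normrX.
    rewrite lerXn2r ?nnegrE ?(ltW M1)// (le_trans (ler_normB _ _))// normr1.
    by rewrite lerD2r.
rewrite integral_cst// -[leRHS]mule1; apply: lee_wpmul2l.
  by rewrite lee_fin sqr_ge0.
by rewrite (@probability_le1 _ _ _ (product_prob P mu) _ measurableT).
Qed.

Lemma coupling_bound :
  (`| 'E_P[fun w => (dnorm p (fun x => scaled w x - 1)%R `^ p)%R] `^ p^-1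
     - torus_norm p (fun u => h t u - 1)%R | <= (2 * coupling_const / N%:R)%:E)%E.
Proof.
rewrite Lnorm_particle_field Lnorm_heat_field.
have mX := measurable_particle_field; have mY := measurable_heat_field.
have c0 : 0 < coupling_const / N%:R.
  by rewrite divr_gt0// (lt_le_trans ltr01)// coupling_const_ge1.
have hXY : (Lnorm (product_prob P mu) p%:E
    (EFin \o (fun z => particle_field z - heat_field z)%R) <=
      (2 * coupling_const / N%:R)%:E)%E.
  rewrite -mulrA; apply: Lnorm_le_sqr => //; first exact: measurable_funB.
  exact: integral_field_diff.
have hYX : (Lnorm (product_prob P mu) p%:E
    (EFin \o (fun z => heat_field z - particle_field z)%R) <=
      (2 * coupling_const / N%:R)%:E)%E.
  rewrite -mulrA; apply: Lnorm_le_sqr => //; first exact: measurable_funB.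
  under eq_integral do rewrite -[_ - _]opprB sqrrN.
  exact: integral_field_diff.
(* The triangle inequality is used in both directions, in additive form, so that no extended real is
   subtracted before both norms are known to be finite. *)
have mk (X Y : Omega * tup -> R) : measurable_fun setT X -> measurable_fun setT Y ->
    (Lnorm (product_prob P mu) p%:E (EFin \o X) <=
     Lnorm (product_prob P mu) p%:E (EFin \o Y) +
     Lnorm (product_prob P mu) p%:E (EFin \o (fun z => X z - Y z)%R))%E.
  move=> mX' mY'.
  have := minkowski_EFin (product_prob P mu) mY' (measurable_funB mX' mY') p1.
  rewrite (_ : (Y \+ _)%R = X)//.
  by apply/funext => z /=; rewrite addrC subrK.
have hX := mk _ _ mX mY; have hY := mk _ _ mY mX.
have := Lnorm_heat_field_lty.
have {}hX := le_trans hX (leeD (lexx _) hXY).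
have {}hY := le_trans hY (leeD (lexx _) hYX).
move: (Lnorm_ge0 (product_prob P mu) p%:E (EFin \o particle_field)) hX hY.
move: (Lnorm_ge0 (product_prob P mu) p%:E (EFin \o heat_field)).
move: (Lnorm _ _ _) (Lnorm _ _ _) => [y| |] [x| |] //=.
rewrite -!EFinD !lee_fin => _ _ hx hy _.
by rewrite ler_norml; apply/andP; split; lra.
Qed.

End coupling.

Theorem proposition2p5 (R : realType) (d : nat) (hd : (1 <= d)%N)
    (a b : R) (ha : 0 < a) (hab : a <= b) :
  exists C : R, 0 < C /\ exists N0 : nat,
  forall (h : R -> 'rV[R]_d -> R), is_heat_kernel h ->
  forall (p : R), 1 <= p <= 2 ->
  forall (N : nat), (1 < N)%N -> (N0 <= N)%N ->
  forall (dO : measure_display) (Omega : measurableType dO)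
    (P : probability Omega R) (eta : R -> Omega -> 'rV['Z_N]_d -> R),
  is_averaging_process P (dirac_mass R 0) eta ->
  (ereal_sup
     [set `| 'E_P[fun w =>
               (dnorm p (fun x => eta (t * N%:R ^+ 2) w x / unif R x - 1) `^ p)%R]
             `^ p^-1
           - torus_norm p (fun u => h t u - 1)%R | | t in `[a, b]%classic]
   <= (C / N%:R)%:E)%E.
Proof.
exists (2 * coupling_const (d := d) a b); split.
  by rewrite mulr_gt0// (lt_le_trans ltr01)// coupling_const_ge1.
(* The Archimedean bound ensures tau N^2 >= 1 with tau = a / (4 * 8^(d + 1)), and the three
   successors ensure 2 < N; the threshold depends on [a] and [d] only. *)
exists (Num.bound (4 * 8 ^+ d.+1 / a)).+3.
move=> h hh p p12 N hN1 hN dO Omega P eta etaP.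
have N2 : (2 < N)%N by exact: leq_trans hN.
have tauN : 1 <= a / (4 * 8 ^+ d.+1) * N%:R ^+ 2.
  have c0 : 0 < 4 * 8 ^+ d.+1 :> R by rewrite mulr_gt0// exprn_gt0.
  have h1 : 4 * 8 ^+ d.+1 / a <= N%:R.
    apply: (le_trans (ltW (archi_boundP _))); first by rewrite divr_ge0 ?ltW.
    by rewrite ler_nat; apply: leq_trans hN; exact/leqW/leqW/leqW.
  have h2 : N%:R <= N%:R ^+ 2 :> R by rewrite expr2 ler_peMr// ler1n ltnW.
  have := le_trans h1 h2; rewrite ler_pdivrMr// => h3.
  by rewrite mulrAC ler_pdivlMr// mul1r [a * _]mulrC.
apply: ge_ereal_sup => _ [t /= + <-]; rewrite in_itv /= => tab.
exact: (coupling_bound hd N2 etaP ha tab hh tauN p12).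
Qed.
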